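(* Let $\alpha,\beta\in\mathbb R$, $\theta=e^{-2\pi i\alpha}$, $\phi=e^{-2\pi i\beta}$, $\tau$ in the complex upper half plane, $n\ge1$, and $x_1,\dots,x_n,y_1,\dots,y_n$ complex variables. For $(\theta,\phi)\ne(1,1)$, with $\mathbf P=\left(P_1\!\left[\begin{array}{c}\theta\\ \phi\end{array}\right](x_i-y_j,\tau)\right)_{1\le i,j\le n}$, $$\det(\mathbf P)=\frac{\vartheta\!\left[\begin{array}{c}-\beta+\frac12\\ \alpha+\frac12\end{array}\right]\big(\sum_{i=1}^n(x_i-y_i),\tau\big)}{\vartheta\!\left[\begin{array}{c}-\beta+\frac12\\ \alpha+\frac12\end{array}\right](0,\tau)}\cdot\frac{\prod_{1\le i<j\le n}K(x_i-x_j,\tau)K(y_i-y_j,\tau)}{\prod_{1\le i,j\le n}K(x_i-y_j,\tau)}.$$ For $(\theta,\phi)=(1,1)$, $$\det(\mathbf Q)=-\frac{K\big(\sum_{i=1}^n(x_i-y_i),\tau\big)\prod_{1\le i<j\le n}K(x_i-x_j,\tau)K(y_i-y_j,\tau)}{\prod_{1\le i,j\le n}K(x_i-y_j,\tau)},$$ where $\mathbf Q$ is the $(n+1)\times(n+1)$ matrix with $\mathbf Q(i,j)=P_1(x_i-y_j,\tau)$ for $1\le i,j\le n$, $\mathbf Q(i,n+1)=\mathbf Q(n+1,j)=1$ for $1\le i,j\le n$, and $\mathbf Q(n+1,n+1)=0$.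
   Context: $q=e^{2\pi i\tau}$, $q^n=e^{2\pi in\tau}$. Twisted Weierstrass function: for $\phi=e^{2\pi i\lambda}$, $0\le\lambda<1$, $(\theta,\phi)\neq(1,1)$, $$P_1\!\left[\begin{array}{c}\theta\\ \phi\end{array}\right](z,\tau)=-\sum_{n\in\mathbb Z+\lambda}\frac{e^{nz}}{1-\theta^{-1}q^{n}}\quad(|q|<|e^z|<1),$$ continued meromorphically to $z\in\mathbb C$. Classical function: $P_1(z,\tau)=\frac1z-\sum_{k\ge2}E_k(\tau)z^{k-1}$ near $z=0$, continued meromorphically, where $E_k=0$ for $k$ odd and $E_k(\tau)=-\frac{B_k}{k!}+\frac2{(k-1)!}\sum_{r\ge1}\frac{r^{k-1}q^r}{1-q^r}$ for $k$ even, $B_k$ Bernoulli numbers. Theta function: $\vartheta\!\left[\begin{array}{c}a\\ b\end{array}\right](z,\tau)=\sum_{n\in\mathbb Z}\exp[i\pi(n+a)^2\tau+(n+a)(z+2\pi ib)]$. Prime form: $K(z,\tau)=\exp(-P_0(z,\tau))$, $P_0(z,\tau)=-\log z+\sum_{k\ge2}\frac1kE_k(\tau)z^k$ (continued to an entire function of $z$), equivalently $K(z,\tau)=\vartheta\!\left[\begin{array}{c}1/2\\1/2\end{array}\right](z,\tau)\big/\partial_z\vartheta\!\left[\begin{array}{c}1/2\\1/2\end{array}\right](0,\tau)$.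
   Formalization: Both right-hand sides carry an extra factor (-1)^{n(n-1)/2}: as printed the two identities have the wrong sign whenever n(n-1)/2 is odd (e.g. n=2, let x_1 tend to y_1 and use that K is odd); for other n the formulas are the printed ones. *)

(* Defs.v *)
From HB Require Import structures.
From mathcomp Require Import all_boot all_order all_algebra.
From mathcomp Require Import complex.
From mathcomp Require Import all_classical all_reals all_analysis.

Set Implicit Arguments.
Unset Strict Implicit.
Unset Printing Implicit Defensive.

Import Order.TTheory GRing.Theory Num.Theory numFieldNormedType.Exports.

Local Open Scope classical_set_scope.
Local Open Scope complex_scope.
Local Open Scope ring_scope.

(* The topology of R[i] is the one given
   by the complex modulus, as for any numFieldType. *)
HB.instance Definition _ (R : realType) := NormedModule.copy R[i] (R[i])^o.

Section Analytic.
Variable R : realType.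
Implicit Types (f : R[i] -> R[i]) (z : R[i]).

Definition analytic_at f z0 := exists a : nat -> R[i],
  \forall z \near z0, series (fun k => a k * (z - z0) ^+ k) @ \oo --> f z.

Definition pole_at f z0 := exists (m : nat) (g : R[i] -> R[i]),
  [/\ analytic_at g z0, g z0 != 0 &
      \forall z \near z0^', f z = g z / (z - z0) ^+ m.+1].

Definition entire f := forall z0, analytic_at f z0.

(* The value of f at a pole is irrelevant, but at every other point f takes
   its analytic value: a meromorphic f has no removable singularity. *)
Definition meromorphic f := forall z0, analytic_at f z0 \/ pole_at f z0.

End Analytic.

Section Functions.
Variable R : realType.
Implicit Types (tau z theta phi : R[i]) (a b lam : R).

Definition expc z : R[i] :=
  (expR (complex.Re z))%:C * (cos (complex.Im z) +i* sin (complex.Im z)).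

Definition twopii : R[i] := 0 +i* (2 * pi).

(* The doubly infinite sum over the integers, each half being summed
   separately; note that Negz k is - k.+1. *)
Definition zsum (u : int -> R[i]) : R[i] :=
  limn (series (fun k : nat => u (Posz k))) +
  limn (series (fun k : nat => u (Negz k))).

Definition in_lattice tau z := exists m n : int,
  z = twopii * (m%:~R + n%:~R * tau).

Definition nome tau : R[i] := expc (twopii * tau).

Definition theta_char a b z tau : R[i] :=
  zsum (fun n => let na : R[i] := n%:~R + a%:C in
    expc (twopii / 2 * na ^+ 2 * tau + na * (z + twopii * b%:C))).

(* Here theta, phi are the unimodular parameters of the twist; q^n stands for
   exp(2 pi i n tau), also for the non-integer n in Z + lam. *)
Definition is_twisted_P1 theta phi tau (f : R[i] -> R[i]) :=
  meromorphic f /\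
  exists lam, [/\ 0 <= lam < 1, phi = expc (twopii * lam%:C) &
    forall z, `|nome tau| < `|expc z| < 1 ->
      f z = - zsum (fun m => let n : R[i] := m%:~R + lam%:C in
              expc (n * z) / (1 - theta^-1 * expc (twopii * n * tau)))].

(* By the identity theorem a continuation is unique away from its poles, so
   that the choice made by xget only affects the values at the poles. *)
Definition twisted_P1 theta phi tau : R[i] -> R[i] :=
  xget (fun=> 0) [set f | is_twisted_P1 theta phi tau f].

End Functions.

Section Bernoulli.
Variable F : fieldType.

(* [:: B_0; ...; B_(n-1)], by sum_(k <= m) 'C(m+1, k) B_k = (m == 0). *)
Fixpoint bernoulli_seq (n : nat) : seq F :=
  if n is m.+1 then
    let s := bernoulli_seq m in
    rcons s (((m == 0)%N%:R - \sum_(k < m) 'C(m.+1, k)%:R * s`_k) / m.+1%:R)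
  else [::].

Definition bernoulli (n : nat) : F := (bernoulli_seq n.+1)`_n.

End Bernoulli.

Section PrimeForm.
Variable R : realType.
Implicit Types (tau z : R[i]).

Definition eisenstein (k : nat) tau : R[i] :=
  if odd k then 0 else
  - (bernoulli R[i] k / k`!%:R) +
  2 / (k.-1)`!%:R *
    limn (series (fun s : nat => let r := s.+1 in
      r%:R ^+ k.-1 * nome tau ^+ r / (1 - nome tau ^+ r))).

Definition is_P1 tau (f : R[i] -> R[i]) :=
  meromorphic f /\
  \forall z \near (0 : R[i])^',
    f z = z^-1 - limn (series (fun j : nat => let k := j.+2 in
                                 eisenstein k tau * z ^+ k.-1)).

Definition P1 tau : R[i] -> R[i] := xget (fun=> 0) [set f | is_P1 tau f].

(* exp (- P_0 (z, tau)) near z = 0, where P_0 (z, tau) is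
   - log z + sum_(k >= 2) E_k(tau) z^k / k; whatever the branch of log, the
   factor exp (log z) is z. *)
Definition is_prime_form tau (f : R[i] -> R[i]) :=
  entire f /\
  \forall z \near (0 : R[i]),
    f z = z * expc (- limn (series (fun j : nat => let k := j.+2 in
                                      k%:R^-1 * eisenstein k tau * z ^+ k))).

Definition prime_form tau : R[i] -> R[i] :=
  xget (fun=> 0) [set f | is_prime_form tau f].

End PrimeForm.

(* Main.v *)
Require Import Defs.
From HB Require Import structures.
From mathcomp Require Import all_boot all_order all_algebra.
From mathcomp Require Import perm complex finmap.
From mathcomp Require Import all_classical all_reals all_analysis.
From mathcomp Require Import ring lra zify.

Set Implicit Arguments.
Unset Strict Implicit.
Unset Printing Implicit Defensive.

Import Order.TTheory GRing.Theory Num.Theory numFieldNormedType.Exports.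

Local Open Scope classical_set_scope.
Local Open Scope complex_scope.
Local Open Scope ring_scope.

(* Let Theta (z) = sum_n (-1)^n q^(n (n + 1) / 2) exp ((n + 1/2) z), a constant
   multiple of the odd theta function.

   Regrouping the double series of Theta (x + y) Theta (x - y) by the parity of
   the sum of the two indices shows that it is B (x) A (y) - A (x) B (y) for some
   A and B, whence the three-term identity of Theta.  That identity says that a
   Schur complement of the matrix F_s (x_i - y_j), F_s (z) = K (z + s) / (K (z) K (s)),
   is again, up to row and column factors, of the same form with another s; this
   gives det (F_s (x_i - y_j)) by induction (Frobenius).

   Multiplying sum_n exp (n z) / (1 - exp (s) q^n) by Theta (z) gives a Laurent
   series in exp (z) whose coefficients obey the first order recurrence of those
   of Theta (z + s); hence this sum is - F_s (z) (Kronecker), and the twisted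
   function is exp (lam z) F_s (z) with s = 2 pi i (alpha + lam tau), where lam is
   the representative of - beta in [0, 1).  The factors exp (lam z) turn Theta (z + s)
   into the theta function with characteristics.

   Letting s tend to 0 in Kronecker's formula gives P_1 = Theta' / Theta, and then
   K = Theta / Theta' (0) by integration.  The untwisted determinant is the limit
   s -> 0 of Frobenius's, as F_s (z) = 1 / K (s) + P_1 (z) + o (1). *)

(** * Unconditional sums *)

(** The definitions give series as one-sided limits and functions by continuation and choice. Both
    are first replaced by rigid notions: sums over an arbitrary index type, controlled by absolute
    summability, for which regrouping, Fubini and dominated convergence hold; and explicit quotients
    of theta series, to which the identity theorem for meromorphic functions ties the chosen
    functions.

    The zeros of Theta come out of Kronecker's formula itself. Multiplied by 1 - exp z and taken at
    z = 0, it says c(s) Theta(s) = - Theta'(0) for every s off the lattice. Were Theta'(0) zero, the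
    series would vanish near 0 for some s, although its product with 1 - exp z tends to 1. Hence
    Theta'(0), and then Theta(s) for every s off the lattice, is nonzero.

    Frobenius's induction replaces s by s + x_1 - y_1, which may be a zero of K, so it runs over s
    in punctured neighbourhoods and is completed by continuity. The limit s to 0 of Kronecker's
    formula fixes the logarithmic derivative up to an additive constant, which parity determines. *)

Section Modulus.
Variable R : realType.
Implicit Types z w : R[i].

(** The norm of [R[i]] takes its values in [R[i]] itself; this real-valued copy puts all estimates
    in the real field [R]. *)
Definition cabs z : R := complex.Re `|z|.

Lemma cabsE z : (cabs z)%:C = `|z|.
Proof. by rewrite /cabs RRe_real// normr_real. Qed.

Lemma cabs_ge0 z : 0 <= cabs z.
Proof. by rewrite -ler0c cabsE normr_ge0. Qed.

Lemma cabsM z w : cabs (z * w) = cabs z * cabs w.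
Proof. by apply: complexI; rewrite rmorphM/= !cabsE normrM. Qed.

Lemma cabs0 : cabs 0 = 0.
Proof. by apply: complexI; rewrite cabsE normr0. Qed.

Lemma cabs1 : cabs 1 = 1.
Proof. by apply: complexI; rewrite cabsE normr1. Qed.

Lemma cabsN z : cabs (- z) = cabs z.
Proof. by apply: complexI; rewrite !cabsE normrN. Qed.

Lemma cabsD z w : cabs (z + w) <= cabs z + cabs w.
Proof. by rewrite -lecR rmorphD/= !cabsE ler_normD. Qed.

Lemma cabs_sum n (u : 'I_n -> R[i]) : cabs (\sum_(k < n) u k) <= \sum_(k < n) cabs (u k).
Proof.
elim/big_rec2: _ => [|i a c _ ih]; first by rewrite cabs0.
by apply: (le_trans (cabsD _ _)); rewrite lerD2l.
Qed.

Lemma cabsB z w : cabs (z - w) <= cabs z + cabs w.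
Proof. by rewrite (le_trans (cabsD _ _))// cabsN. Qed.

Lemma cabsC z w : cabs (z - w) = cabs (w - z).
Proof. by rewrite -cabsN opprB. Qed.

Lemma cabs_eq0 z : (cabs z == 0) = (z == 0).
Proof.
by rewrite -(inj_eq (@complexI R)) cabsE normr_eq0.
Qed.

Lemma cabs_gt0 z : (0 < cabs z) = (z != 0).
Proof. by rewrite lt_def cabs_eq0 cabs_ge0 andbT. Qed.

Lemma cabsX z n : cabs (z ^+ n) = cabs z ^+ n.
Proof. by apply: complexI; rewrite rmorphXn/= !cabsE normrX. Qed.

Lemma cabsV z : cabs z^-1 = (cabs z)^-1.
Proof. by apply: complexI; rewrite fmorphV/= !cabsE normfV. Qed.

Lemma cabs_real (x : R) : cabs x%:C = `|x|.
Proof. by apply: complexI; rewrite cabsE normc_def/= expr0n addr0 sqrtr_sqr. Qed.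

Lemma cabs_nat n : cabs n%:R = n%:R.
Proof. by apply: complexI; rewrite cabsE normr_nat rmorph_nat. Qed.

Lemma Re_le_cabs z : `|complex.Re z| <= cabs z.
Proof. by rewrite -lecR cabsE normc_ge_Re. Qed.

Lemma Im_le_cabs z : `|complex.Im z| <= cabs z.
Proof.
case: z => a b; rewrite -lecR cabsE normc_def lecR/=.
by rewrite -sqrtr_sqr ler_wsqrtr// lerDr sqr_ge0.
Qed.

Lemma ReD z w : complex.Re (z + w) = complex.Re z + complex.Re w.
Proof. by case: z; case: w. Qed.

Lemma ImD z w : complex.Im (z + w) = complex.Im z + complex.Im w.
Proof. by case: z; case: w. Qed.

Lemma complex_ext z w :
  complex.Re z = complex.Re w -> complex.Im z = complex.Im w -> z = w.
Proof. by case: z => a b; case: w => c d /= -> ->. Qed.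

End Modulus.

(** * Nonnegative sums over arbitrary index types *)

Section RealSums.
Variable R : realType.

(** [\esum] is a supremum over finite subsets, hence a sum only for nonnegative families; moduli or
    positive parts are taken first. *)
Definition fsumm (I : choiceType) (g : I -> R) : Prop :=
  (\esum_(i in [set: I]) (g i)%:E < +oo)%E.

Definition nsum (I : choiceType) (g : I -> R) : R :=
  fine (\esum_(i in [set: I]) (g i)%:E).

Section OneIndex.
Variable I : choiceType.
Implicit Types f g h : I -> R.

Lemma esum_nsum g : (forall i, 0 <= g i) -> fsumm g ->
  \esum_(i in [set: I]) (g i)%:E = (nsum g)%:E.
Proof.
move=> g0 sg; rewrite /nsum fineK// ge0_fin_numE// esum_ge0// => i _.
by rewrite lee_fin.
Qed.

Lemma nsum_ge0 g : (forall i, 0 <= g i) -> 0 <= nsum g.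
Proof. by move=> g0; apply: fine_ge0; apply: esum_ge0 => i _; rewrite lee_fin. Qed.

Lemma fsumm_le f g : (forall i, f i <= g i) -> fsumm g -> fsumm f.
Proof. by move=> fg; apply: le_lt_trans; apply: le_esum => i _; rewrite lee_fin. Qed.

Lemma nsum_le f g : (forall i, 0 <= f i) -> (forall i, f i <= g i) ->
  fsumm g -> nsum f <= nsum g.
Proof.
move=> f0 fg sg; have sf := fsumm_le fg sg.
have g0 i : 0 <= g i by exact: le_trans (f0 i) (fg i).
rewrite -lee_fin -!esum_nsum//; apply: le_esum => i _; by rewrite lee_fin.
Qed.

Lemma eq_nsum f g : f =1 g -> nsum f = nsum g.
Proof. by move=> fg; congr nsum; exact/funext. Qed.

Lemma esumDr f g : (forall i, 0 <= f i) -> (forall i, 0 <= g i) ->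
  \esum_(i in [set: I]) (f i + g i)%:E =
  (\esum_(i in [set: I]) (f i)%:E + \esum_(i in [set: I]) (g i)%:E)%E.
Proof.
by move=> f0 g0; rewrite -esumD// => i _; rewrite lee_fin.
Qed.

Lemma fsummD f g : (forall i, 0 <= f i) -> (forall i, 0 <= g i) ->
  fsumm f -> fsumm g -> fsumm (fun i => f i + g i).
Proof. by move=> f0 g0 sf sg; rewrite /fsumm esumDr// lte_add_pinfty. Qed.

Lemma nsumD f g : (forall i, 0 <= f i) -> (forall i, 0 <= g i) ->
  fsumm f -> fsumm g -> nsum (fun i => f i + g i) = nsum f + nsum g.
Proof.
by move=> f0 g0 sf sg; rewrite /nsum esumDr// !esum_nsum.
Qed.

Lemma fsum_le_nsum g (A : {fset I}) : (forall i, 0 <= g i) -> fsumm g ->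
  \sum_(i <- A) g i <= nsum g.
Proof.
move=> g0 sg; rewrite -lee_fin -esum_nsum// -sumEFin.
apply: ereal_sup_ubound; exists [set` A] => //.
by rewrite fsbig_finite//= set_fsetK.
Qed.

Lemma nsum_approx g e : (forall i, 0 <= g i) -> fsumm g -> 0 < e ->
  exists A : {fset I}, nsum g - e < \sum_(i <- A) g i.
Proof.
move=> g0 sg e0.
have : ((nsum g - e)%:E < \esum_(i in [set: I]) (g i)%:E)%E.
  by rewrite esum_nsum// lte_fin ltrBlDr ltrDl.
move=> /ereal_sup_gt[_ [A [finA _] <-]].
rewrite fsbig_finite//= sumEFin lte_fin => h.
by exists (fset_set A).
Qed.

Lemma nsum_le_bound g c : (forall i, 0 <= g i) ->
  (forall A : {fset I}, \sum_(i <- A) g i <= c) -> fsumm g /\ nsum g <= c.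
Proof.
move=> g0 h.
have hE : (\esum_(i in [set: I]) (g i)%:E <= c%:E)%E.
  apply: ge_ereal_sup => _ [A [finA _] <-].
  by rewrite fsbig_finite//= sumEFin lee_fin.
have sg : fsumm g by apply: le_lt_trans hE _; rewrite ltry.
by split => //; rewrite -lee_fin -esum_nsum.
Qed.

Lemma fsummZ c g : 0 <= c -> (forall i, 0 <= g i) -> fsumm g ->
  fsumm (fun i => c * g i) /\ nsum (fun i => c * g i) <= c * nsum g.
Proof.
move=> c0 g0 sg; apply: nsum_le_bound => [i|A]; first by rewrite mulr_ge0.
by rewrite -mulr_sumr ler_wpM2l// fsum_le_nsum.
Qed.

Lemma le_nsum_term g i : (forall i, 0 <= g i) -> fsumm g -> g i <= nsum g.
Proof.
by move=> g0 sg; have := fsum_le_nsum [fset i]%fset g0 sg; rewrite big_seq_fset1.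
Qed.

End OneIndex.

Section Reindex.
Variables I J : choiceType.

Lemma esum_inj (e : I -> J) (f : J -> \bar R) : injective e ->
  (forall j, ~ range e j -> f j = 0%E) ->
  \esum_(j in [set: J]) f j = \esum_(i in [set: I]) f (e i).
Proof.
move=> inje f0; rewrite -(@esum_image _ _ _ setT e f); last by move=> x y _ _ /inje.
rewrite [RHS]esum_mkcond; apply: eq_esum => j _.
by case: ifPn => // /negP; rewrite inE => /f0.
Qed.

Lemma nsum_inj (e : I -> J) (g : J -> R) : injective e ->
  (forall j, ~ range e j -> g j = 0) -> nsum g = nsum (g \o e).
Proof. by move=> ie g0; rewrite /nsum (esum_inj ie)// => j /g0 ->. Qed.

Lemma fsumm_inj (e : I -> J) (g : J -> R) : injective e ->
  (forall j, ~ range e j -> g j = 0) -> fsumm g <-> fsumm (g \o e).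
Proof. by move=> ie g0; rewrite /fsumm (esum_inj ie)// => j /g0 ->. Qed.

Lemma esum_pair (g : I * J -> R) : (forall p, 0 <= g p) ->
  \esum_(p in [set: I * J]) (g p)%:E =
  \esum_(i in [set: I]) \esum_(j in [set: J]) (g (i, j))%:E.
Proof.
move=> g0; rewrite (@esum_esum _ _ _ _ (fun=> setT) (fun i j => (g (i, j))%:E)).
  have -> : [set: I] `*`` (fun=> [set: J]) = setT by apply/seteqP; split.
  by apply: eq_esum => -[].
by move=> *; rewrite lee_fin.
Qed.

Lemma fsumm_pair (g : I * J -> R) : (forall p, 0 <= g p) -> fsumm g ->
  [/\ forall i, fsumm (fun j => g (i, j)),
      fsumm (fun i => nsum (fun j => g (i, j))) &
      nsum g = nsum (fun i => nsum (fun j => g (i, j)))].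
Proof.
move=> g0 sg.
have s1 i : fsumm (fun j => g (i, j)).
  move: sg; rewrite /fsumm esum_pair//; apply: le_lt_trans.
  rewrite [leRHS](esumID [set i])/=; last first.
    by move=> ? _; apply: esum_ge0 => *; rewrite lee_fin.
  rewrite setTI esum_set1; last by apply: esum_ge0 => *; rewrite lee_fin.
  by rewrite leeDl// esum_ge0// => *; apply: esum_ge0 => *; rewrite lee_fin.
have E : \esum_(p in [set: I * J]) (g p)%:E =
         \esum_(i in [set: I]) (nsum (fun j => g (i, j)))%:E.
  by rewrite esum_pair//; apply: eq_esum => i _; rewrite esum_nsum.
split => //; first by rewrite /fsumm -E.
by rewrite {1}/nsum E.
Qed.

Lemma fsumm_pairI (g : I * J -> R) (h : I -> R) : (forall p, 0 <= g p) ->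
  (forall i, fsumm (fun j => g (i, j))) ->
  (forall i, nsum (fun j => g (i, j)) <= h i) -> fsumm h -> fsumm g.
Proof.
move=> g0 s1 le sh; rewrite /fsumm esum_pair//.
apply: le_lt_trans sh; apply: le_esum => i _.
by rewrite esum_nsum// lee_fin.
Qed.

End Reindex.
End RealSums.

(** * Absolutely summable complex families: linearity, Fubini, products *)

Section ComplexSums.
Variable R : realType.

Definition summ (I : choiceType) (f : I -> R[i]) : Prop :=
  fsumm (fun i => cabs (f i)).

Definition rsum (I : choiceType) (g : I -> R) : R :=
  nsum (fun i => Num.max (g i) 0) - nsum (fun i => Num.max (- g i) 0).

(** Built from positive and negative parts, so that reindexing and Fubini descend from [\esum]. For
    a family that is not summable the value is meaningless, since [fine] sends [+oo] to 0. *)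
Definition csum (I : choiceType) (f : I -> R[i]) : R[i] :=
  rsum (fun i => complex.Re (f i)) +i* rsum (fun i => complex.Im (f i)).

Section OneIndex.
Variable I : choiceType.
Implicit Types (a b g h : I -> R) (f : I -> R[i]).

Lemma nsumZ c g : 0 <= c -> (forall i, 0 <= g i) -> fsumm g ->
  nsum (fun i => c * g i) = c * nsum g.
Proof.
rewrite le_eqVlt => /predU1P[<- g0 sg|c0 g0 sg].
  rewrite mul0r /nsum esum1// => i _; by rewrite mul0r.
have [s1 l1] := fsummZ (ltW c0) g0 sg.
apply/eqP; rewrite eq_le l1/=.
have ci : 0 <= c^-1 by rewrite invr_ge0 ltW.
have [_ l2] := fsummZ ci (fun i => mulr_ge0 (ltW c0) (g0 i)) s1.
rewrite mulrC -ler_pdivlMr// mulrC; apply: le_trans l2.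
rewrite le_eqVlt; apply/orP; left; apply/eqP; apply: eq_nsum => i.
by rewrite mulrA mulVf ?mul1r// gt_eqF.
Qed.

Lemma posneg (x : R) : Num.max x 0 - Num.max (- x) 0 = x.
Proof. by case: (lerP x 0) => h; case: (lerP (- x) 0) => h'; lra. Qed.

Lemma max0_ge0 (x : R) : 0 <= Num.max x 0.
Proof. by rewrite le_max lexx orbT. Qed.

Lemma max0_le_norm (x : R) : Num.max x 0 <= `|x|.
Proof. by rewrite ge_max ler_norm normr_ge0. Qed.

Lemma norm_posneg (x : R) : `|x| = Num.max x 0 + Num.max (- x) 0.
Proof.
case: (lerP x 0) => h; first by rewrite ler0_norm// max_l ?add0r// oppr_ge0.
by rewrite gtr0_norm// max_r ?addr0// oppr_le0 ltW.
Qed.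

Lemma fsumm_pos g : fsumm (fun i => `|g i|) -> fsumm (fun i => Num.max (g i) 0).
Proof. by apply: fsumm_le => i; exact: max0_le_norm. Qed.

Lemma fsumm_neg g : fsumm (fun i => `|g i|) -> fsumm (fun i => Num.max (- g i) 0).
Proof. by apply: fsumm_le => i; rewrite -normrN max0_le_norm. Qed.

(** Any decomposition into nonnegative summable parts dominates the canonical one, and cross-adding
    the two compares their sums. Linearity and Fubini then only require a convenient choice of [a]
    and [b]. *)
Lemma rsumE g a b : (forall i, 0 <= a i) -> (forall i, 0 <= b i) ->
  fsumm a -> fsumm b -> (forall i, g i = a i - b i) -> rsum g = nsum a - nsum b.
Proof.
move=> a0 b0 sa sb gE.
set p := fun i => Num.max (g i) 0; set n := fun i => Num.max (- g i) 0.
have p0 i : 0 <= p i by exact: max0_ge0.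
have n0 i : 0 <= n i by exact: max0_ge0.
have sp : fsumm p.
  by apply: fsumm_le sa => i; rewrite /p gE ge_max a0 gerBl b0.
have sn : fsumm n.
  by apply: fsumm_le sb => i; rewrite /n gE opprB ge_max b0 gerBl a0.
have : nsum p + nsum b = nsum a + nsum n.
  rewrite -!nsumD//; apply: eq_nsum => i.
  by have := posneg (g i); rewrite -/(p i) -/(n i) gE; lra.
by rewrite /rsum -/p -/n; lra.
Qed.

Lemma rsumD g h : fsumm (fun i => `|g i|) -> fsumm (fun i => `|h i|) ->
  rsum (fun i => g i + h i) = rsum g + rsum h.
Proof.
move=> sg sh.
have P := @max0_ge0.
rewrite (@rsumE _ (fun i => Num.max (g i) 0 + Num.max (h i) 0)
   (fun i => Num.max (- g i) 0 + Num.max (- h i) 0)).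
- rewrite !nsumD//; rewrite /rsum; last 4 first.
  + exact: fsumm_neg. + exact: fsumm_neg. + exact: fsumm_pos. + exact: fsumm_pos.
  lra.
- by move=> i; rewrite addr_ge0.
- by move=> i; rewrite addr_ge0.
- by apply: fsummD => //; exact: fsumm_pos.
- by apply: fsummD => //; exact: fsumm_neg.
- by move=> i; have := posneg (g i); have := posneg (h i); lra.
Qed.

Lemma rsumZ c g : fsumm (fun i => `|g i|) ->
  rsum (fun i => c * g i) = c * rsum g.
Proof.
move=> sg; have P := @max0_ge0.
have sp := fsumm_pos sg; have sn := fsumm_neg sg.
have [c0|c0] := lerP 0 c.
  rewrite (@rsumE _ (fun i => c * Num.max (g i) 0)
    (fun i => c * Num.max (- g i) 0)).
  - by rewrite !nsumZ// -mulrBr.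
  - by move=> i; rewrite mulr_ge0.
  - by move=> i; rewrite mulr_ge0.
  - by case: (fsummZ c0 (fun i => P (g i)) sp).
  - by case: (fsummZ c0 (fun i => P (- g i)) sn).
  - by move=> i; rewrite -mulrBr posneg.
have c1 : 0 <= - c by rewrite oppr_ge0 ltW.
rewrite (@rsumE _ (fun i => - c * Num.max (- g i) 0)
    (fun i => - c * Num.max (g i) 0)).
- by rewrite !nsumZ// /rsum; ring.
- by move=> i; rewrite mulr_ge0.
- by move=> i; rewrite mulr_ge0.
- by case: (fsummZ c1 (fun i => P (- g i)) sn).
- by case: (fsummZ c1 (fun i => P (g i)) sp).
- by move=> i; rewrite -mulrBr -{1}(posneg (g i)); ring.
Qed.

Lemma rsum_le g : fsumm (fun i => `|g i|) -> `|rsum g| <= nsum (fun i => `|g i|).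
Proof.
move=> sg; have P := @max0_ge0.
have sp := fsumm_pos sg; have sn := fsumm_neg sg.
have -> : nsum (fun i => `|g i|) =
    nsum (fun i => Num.max (g i) 0) + nsum (fun i => Num.max (- g i) 0).
  rewrite -nsumD//; apply: eq_nsum => i.
  exact: norm_posneg.
rewrite /rsum; have := nsum_ge0 (fun i => P (g i)).
have := nsum_ge0 (fun i => P (- g i)).
set x := nsum _; set y := nsum _ => y0 x0.
by rewrite ler_norml; apply/andP; split; lra.
Qed.

Lemma eq_rsum g h : g =1 h -> rsum g = rsum h.
Proof. by move=> gh; congr rsum; exact/funext. Qed.

Lemma eq_csum f1 f2 : f1 =1 f2 -> csum f1 = csum f2.
Proof. by move=> gh; congr csum; exact/funext. Qed.

Lemma eq_summ f1 f2 : f1 =1 f2 -> summ f1 -> summ f2.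
Proof. by move=> /funext ->. Qed.

Lemma summ_le f g : (forall i, cabs (f i) <= g i) -> fsumm g -> summ f.
Proof. exact: fsumm_le. Qed.

Lemma summ_dom f1 f2 : (forall i, cabs (f1 i) <= cabs (f2 i)) -> summ f2 -> summ f1.
Proof. exact: fsumm_le. Qed.

Lemma summ_Re f : summ f -> fsumm (fun i => `|complex.Re (f i)|).
Proof. by apply: fsumm_le => i; exact: Re_le_cabs. Qed.

Lemma summ_Im f : summ f -> fsumm (fun i => `|complex.Im (f i)|).
Proof. by apply: fsumm_le => i; exact: Im_le_cabs. Qed.

Lemma summD f1 f2 : summ f1 -> summ f2 -> summ (fun i => f1 i + f2 i).
Proof.
move=> s1 s2; apply: (@fsumm_le _ _ _ (fun i => cabs (f1 i) + cabs (f2 i))).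
  by move=> i; exact: cabsD.
by apply: fsummD => // i; exact: cabs_ge0.
Qed.

Lemma summZ c f : summ f -> summ (fun i => c * f i).
Proof.
move=> sf; have [+ _] := fsummZ (cabs_ge0 c) (fun i => cabs_ge0 (f i)) sf.
by apply: fsumm_le => i; rewrite cabsM.
Qed.

Lemma summN f : summ f -> summ (fun i => - f i).
Proof. by apply: fsumm_le => i; rewrite cabsN. Qed.

Lemma csumD f1 f2 : summ f1 -> summ f2 ->
  csum (fun i => f1 i + f2 i) = csum f1 + csum f2.
Proof.
move=> s1 s2; apply: complex_ext; rewrite /csum/=.
  rewrite (eq_rsum (h := fun i => complex.Re (f1 i) + complex.Re (f2 i))).
    by rewrite rsumD//; exact: summ_Re.
  by move=> i; exact: ReD.
rewrite (eq_rsum (h := fun i => complex.Im (f1 i) + complex.Im (f2 i))).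
  by rewrite rsumD//; exact: summ_Im.
by move=> i; exact: ImD.
Qed.

Lemma csumZ c f : summ f -> csum (fun i => c * f i) = c * csum f.
Proof.
move=> sf; have sr := summ_Re sf; have si := summ_Im sf.
have sZ (d : R) g : fsumm (fun i => `|g i|) -> fsumm (fun i => `|d * g i|).
  move=> sg; have [+ _] := fsummZ (normr_ge0 d) (fun i => normr_ge0 (g i)) sg.
  by apply: fsumm_le => i; rewrite normrM.
case: c => x y; apply: complex_ext; rewrite /csum/=.
  rewrite (eq_rsum (h := fun i => x * complex.Re (f i) + (- y) * complex.Im (f i))).
    by rewrite rsumD; [rewrite !rsumZ// mulNr| exact: sZ..].
  by move=> i; case: (f i) => u v /=; rewrite mulNr.
rewrite (eq_rsum (h := fun i => x * complex.Im (f i) + y * complex.Re (f i))).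
  by rewrite rsumD; [rewrite !rsumZ//| exact: sZ..].
by move=> i; case: (f i) => u v /=.
Qed.

Lemma csumN f : summ f -> csum (fun i => - f i) = - csum f.
Proof.
move=> sf; rewrite -mulN1r -csumZ//; by apply: eq_csum => i; rewrite mulN1r.
Qed.

Lemma csumB f1 f2 : summ f1 -> summ f2 ->
  csum (fun i => f1 i - f2 i) = csum f1 - csum f2.
Proof. by move=> s1 s2; rewrite csumD ?csumN//; exact: summN. Qed.

Lemma csum0 : csum (fun _ : I => 0) = 0.
Proof.
have z : nsum (fun _ : I => 0 : R) = 0 by rewrite /nsum esum1.
apply: complex_ext; rewrite /csum/= /rsum.
  rewrite (@eq_nsum _ _ _ (fun=> 0)) ?z; last by move=> i; rewrite maxxx.
  by rewrite (@eq_nsum _ _ _ (fun=> 0)) ?z ?subrr// => i; rewrite oppr0 maxxx.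
rewrite (@eq_nsum _ _ _ (fun=> 0)) ?z; last by move=> i; rewrite maxxx.
by rewrite (@eq_nsum _ _ _ (fun=> 0)) ?z ?subrr// => i; rewrite oppr0 maxxx.
Qed.

Lemma cabs_csum f : summ f -> cabs (csum f) <= nsum (fun i => cabs (f i)).
Proof.
move=> sf; set s := csum f.
have [->|s0] := eqVneq s 0.
  by rewrite cabs0 nsum_ge0// => i; exact: cabs_ge0.
(* The unimodular [u] rotates the sum onto the nonnegative real axis; estimating real and imaginary
   parts separately would cost a constant factor. *)
pose u := (cabs s)%:C / s.
have u1 : cabs u = 1.
  by rewrite /u cabsM cabs_real cabsV ger0_norm ?cabs_ge0// mulfV ?cabs_eq0.
have us : csum (fun i => u * f i) = (cabs s)%:C.
  by rewrite csumZ// -/s /u divfK.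
have <- : complex.Re (csum (fun i => u * f i)) = cabs s by rewrite us.
apply: (le_trans (ler_norm _)); rewrite /csum/=.
have su : summ (fun i => u * f i) by exact: summZ.
apply: (le_trans (rsum_le (summ_Re su))).
apply: nsum_le => // i; apply: (le_trans (Re_le_cabs _)).
by rewrite cabsM u1 mul1r.
Qed.

Lemma cabs_csum_le f g : (forall i, cabs (f i) <= g i) -> fsumm g ->
  cabs (csum f) <= nsum g.
Proof.
move=> fg sg; apply: (le_trans (cabs_csum (summ_le fg sg))).
by apply: nsum_le => // i; exact: cabs_ge0.
Qed.

Lemma csum_fset (A : {fset I}) f : (forall i, i \notin A -> f i = 0) ->
  summ f /\ csum f = \sum_(i <- A) f i.
Proof.
have E (a : I -> \bar R) : (forall i, (0 <= a i)%E) ->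
    (forall i, i \notin A -> a i = 0%E) ->
    \esum_(i in [set: I]) a i = (\sum_(i <- A) a i)%E.
  move=> a0 aA.
  rewrite (_ : (\sum_(i <- A) a i)%E = \esum_(i in [set` A]) a i); last first.
    by rewrite esum_fset// fsbig_finite//= set_fsetK.
  rewrite [RHS]esum_mkcond; apply: eq_esum => i _.
  by rewrite mem_setE; case: ifPn => // /aA.
move=> fA; split.
  rewrite /summ /fsumm E.
  - by rewrite sumEFin ltry.
  - by move=> i; rewrite lee_fin cabs_ge0.
  - by move=> i /fA ->; rewrite cabs0.
have N (g : I -> R) : (forall i, i \notin A -> g i = 0) -> rsum g = \sum_(i <- A) g i.
  move=> gA; rewrite /rsum /nsum !E.
  - rewrite !sumEFin/= -sumrB; apply: eq_bigr => i _; exact: posneg.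
  - by move=> i; rewrite lee_fin max0_ge0.
  - by move=> i /gA ->; rewrite oppr0 maxxx.
  - by move=> i; rewrite lee_fin max0_ge0.
  - by move=> i /gA ->; rewrite maxxx.
apply: complex_ext; rewrite /csum/= N; try by move=> i /fA ->.
  by elim/big_rec2: _ => // i y1 y2 _ ->; rewrite ReD.
by elim/big_rec2: _ => // i y1 y2 _ ->; rewrite ImD.
Qed.

Lemma csum_single (i0 : I) f : (forall i, i != i0 -> f i = 0) ->
  summ f /\ csum f = f i0.
Proof.
move=> f0; have [|sf ->] := @csum_fset [fset i0]%fset f.
  by move=> i; rewrite inE => /f0.
by rewrite big_seq_fset1.
Qed.

End OneIndex.

Section TwoIndices.
Variables I J : choiceType.

Lemma csum_inj (e : I -> J) (f : J -> R[i]) : injective e ->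
  (forall j, ~ range e j -> f j = 0) -> csum f = csum (f \o e).
Proof.
move=> ie f0; rewrite /csum /rsum.
by congr (_ +i* _); congr (_ - _); rewrite (nsum_inj ie)// => j /f0 ->;
  rewrite ?oppr0 maxxx.
Qed.

Lemma summ_inj (e : I -> J) (f : J -> R[i]) : injective e ->
  (forall j, ~ range e j -> f j = 0) -> summ f <-> summ (f \o e).
Proof. by move=> ie f0; apply: (fsumm_inj ie) => j /f0 ->; rewrite cabs0. Qed.

Lemma summ_comp (e : I -> J) (f : J -> R[i]) : injective e ->
  summ f -> summ (f \o e).
Proof.
move=> ie sf; pose g j := if j \in range e then f j else 0.
have sg : summ g.
  by apply: summ_dom sf => j; rewrite /g; case: ifP => // _; rewrite cabs0 cabs_ge0.
have : summ (g \o e).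
  apply/(summ_inj ie) => // j h; rewrite /g; case: ifPn => //.
  by rewrite inE => /h.
apply: eq_summ => i /=; rewrite /g ifT// inE; by exists i.
Qed.

Lemma bij_range (e : I -> J) (e' : J -> I) : cancel e e' -> cancel e' e ->
  injective e /\ forall j, range e j.
Proof. by move=> c1 c2; split; [exact: can_inj c1|move=> j; exists (e' j)]. Qed.

Lemma csum_bij (e : I -> J) (e' : J -> I) (f : J -> R[i]) :
  cancel e e' -> cancel e' e -> csum f = csum (f \o e).
Proof. by move=> c1 c2; have [ie re] := bij_range c1 c2; apply: csum_inj => // j []. Qed.

Lemma summ_bij (e : I -> J) (e' : J -> I) (f : J -> R[i]) :
  cancel e e' -> cancel e' e -> summ f <-> summ (f \o e).
Proof. by move=> c1 c2; have [ie re] := bij_range c1 c2; apply: summ_inj => // j []. Qed.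

Lemma rsum_pair (g : I * J -> R) : fsumm (fun p => `|g p|) ->
  rsum g = rsum (fun i => rsum (fun j => g (i, j))).
Proof.
move=> sg; have P := @max0_ge0.
have [p1 p2 p3] := fsumm_pair (fun p => P (g p)) (fsumm_pos sg).
have [n1 n2 n3] := fsumm_pair (fun p => P (- g p)) (fsumm_neg sg).
rewrite {1}/rsum p3 n3; symmetry; apply: rsumE => //.
- by move=> i; apply: nsum_ge0.
- by move=> i; apply: nsum_ge0.
Qed.

Lemma csum_pair (f : I * J -> R[i]) : summ f ->
  csum f = csum (fun i => csum (fun j => f (i, j))).
Proof.
move=> sf; rewrite /csum/=.
by congr (_ +i* _); apply: rsum_pair; [exact: summ_Re|exact: summ_Im].
Qed.

Lemma summ_pair2 (f : I * J -> R[i]) : summ f ->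
  summ (fun i => csum (fun j => f (i, j))).
Proof.
move=> sf; have [h1 h2 _] := fsumm_pair (fun p => cabs_ge0 (f p)) sf.
by apply: summ_le h2 => i; apply: cabs_csum; exact: h1.
Qed.

Lemma summ_pairI (f : I * J -> R[i]) (h : I -> R) :
  (forall i, summ (fun j => f (i, j))) ->
  (forall i, nsum (fun j => cabs (f (i, j))) <= h i) -> fsumm h -> summ f.
Proof. by move=> h1 h2 h3; apply: fsumm_pairI h2 h3 => // p; exact: cabs_ge0. Qed.

Lemma summ_prod (f : I -> R[i]) (g : J -> R[i]) : summ f -> summ g ->
  summ (fun p : I * J => f p.1 * g p.2).
Proof.
move=> sf sg.
have g0 i : 0 <= cabs (g i) by exact: cabs_ge0.
apply: (@summ_pairI _ (fun i => nsum (fun j => cabs (g j)) * cabs (f i))).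
- by move=> i; exact: (summZ (f i) sg).
- move=> i /=; rewrite (@eq_nsum _ _ _ (fun j => cabs (f i) * cabs (g j))).
    by rewrite nsumZ ?cabs_ge0// mulrC.
  by move=> j; rewrite cabsM.
- by have [] := fsummZ (nsum_ge0 g0) (fun i => cabs_ge0 (f i)) sf.
Qed.

End TwoIndices.

Lemma csum_swap (I J : choiceType) (f : I * J -> R[i]) : summ f ->
  csum (fun i => csum (fun j => f (i, j))) = csum (fun j => csum (fun i => f (i, j))).
Proof.
move=> sf; rewrite -csum_pair//.
pose sw (A B : Type) (p : A * B) := (p.2, p.1).
have c1 A B : cancel (@sw A B) (@sw B A) by case.
have s2 : summ (f \o (@sw J I)) by apply/(summ_bij f (c1 _ _) (c1 _ _)).
by rewrite (csum_bij f (c1 _ _) (c1 _ _)) csum_pair.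
Qed.

Lemma csum_prod (I J : choiceType) (f : I -> R[i]) (g : J -> R[i]) :
  summ f -> summ g -> csum f * csum g = csum (fun p : I * J => f p.1 * g p.2).
Proof.
move=> sf sg; rewrite csum_pair; last exact: summ_prod.
rewrite mulrC -csumZ//; apply: eq_csum => i /=.
by rewrite csumZ// mulrC.
Qed.

Lemma csum_bool (I : choiceType) (f : bool * I -> R[i]) :
  summ (fun i => f (true, i)) -> summ (fun i => f (false, i)) ->
  summ f /\ csum f = csum (fun i => f (true, i)) + csum (fun i => f (false, i)).
Proof.
move=> st sff.
have sf : summ f.
  apply: (@summ_pairI _ _ f (fun b => nsum (fun i => cabs (f (b, i))))) => //.
    by case.
  have [] := @csum_fset _ [fset true; false]%fset
    (fun b => (nsum (fun i => cabs (f (b, i))))%:C).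
    by case; rewrite !inE.
  move=> + _; apply: fsumm_le => b; rewrite cabs_real; exact: ler_norm.
split => //; rewrite csum_pair//.
have [|_ ->] := @csum_fset _ [fset true; false]%fset
    (fun b => csum (fun i => f (b, i))).
  by case; rewrite !inE.
by rewrite big_fsetU1 ?inE//= big_seq_fset1.
Qed.

End ComplexSums.

(** * Limits *)

Section Limits.
Variable R : realType.
Implicit Types (z w l : R[i]).

Lemma cvgcP (T : Type) (F : set_system T) {FF : Filter F} (f : T -> R[i]) l :
  f @ F --> l <-> forall e : R, 0 < e -> \forall t \near F, cabs (f t - l) <= e.
Proof.
split=> [/cvgrPdistC_le h e e0|h].
  have e0' : 0 < e%:C by rewrite ltcR.
  by near do rewrite -lecR cabsE; exact: (h _ e0').
apply/cvgrPdistC_le => e e0.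
have eE : (complex.Re e)%:C = e by rewrite RRe_real// gtr0_real.
have e0' : 0 < complex.Re e by rewrite -ltcR eE.
by rewrite -eE; near do rewrite -cabsE lecR; exact: h.
Unshelve. all: by end_near. Qed.

Lemma summE (I : choiceType) (f : I -> R[i]) :
  summ f <-> fsumm (fun i => cabs (f i)).
Proof. by []. Qed.

Definition tends (T : Type) (F : set_system T) (f : T -> R[i]) l : Prop :=
  forall e : R, 0 < e -> \forall t \near F, cabs (f t - l) <= e.

Section Tends.
Context {T : Type} {F : set_system T} {FF : Filter F}.
Implicit Types f g : T -> R[i].

Lemma tendsP f l : tends F f l <-> f @ F --> l.
Proof. by split=> [h|/cvgcP//]; apply/cvgcP. Qed.

Lemma tends_near f g l : (\forall t \near F, f t = g t) -> tends F f l -> tends F g l.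
Proof. by move=> fg h e e0; apply: filterS2 fg (h e e0) => t ->. Qed.

Lemma tends_ext f g l : f =1 g -> tends F f l -> tends F g l.
Proof. by move=> /funext ->. Qed.

Lemma tends_cst c : tends F (fun=> c) c.
Proof. by move=> e e0; apply: filterS filterT => t _; rewrite subrr cabs0 ltW. Qed.

Lemma tendsD f g l m : tends F f l -> tends F g m -> tends F (fun t => f t + g t) (l + m).
Proof. by move=> /tendsP fl /tendsP gm; apply/tendsP; exact: (cvgD fl gm). Qed.

Lemma tendsN f l : tends F f l -> tends F (fun t => - f t) (- l).
Proof. by move=> /tendsP fl; apply/tendsP; exact: (cvgN fl). Qed.

Lemma tendsB f g l m : tends F f l -> tends F g m -> tends F (fun t => f t - g t) (l - m).
Proof. by move=> fl gm; exact: tendsD fl (tendsN gm). Qed.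

Lemma tendsM f g l m : tends F f l -> tends F g m -> tends F (fun t => f t * g t) (l * m).
Proof. by move=> /tendsP fl /tendsP gm; apply/tendsP; exact: (cvgM fl gm). Qed.

Lemma tendsV f l : l != 0 -> tends F f l -> tends F (fun t => (f t)^-1) l^-1.
Proof. by move=> l0 /tendsP fl; apply/tendsP; exact: (cvgV l0 fl). Qed.

Lemma tends_sum (I : eqType) (r : seq I) (f : I -> T -> R[i]) (l : I -> R[i]) :
  (forall i, i \in r -> tends F (f i) (l i)) ->
  tends F (fun t => \sum_(i <- r) f i t) (\sum_(i <- r) l i).
Proof.
elim: r => [_|i r IH h].
  by rewrite big_nil; apply: tends_ext (tends_cst 0) => t; rewrite big_nil.
rewrite big_cons; apply: (@tends_ext (fun t => f i t + \sum_(j <- r) f j t)).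
  by move=> t; rewrite big_cons.
apply: tendsD; first by apply: h; rewrite mem_head.
by apply: IH => j jr; apply: h; rewrite inE jr orbT.
Qed.

Lemma tends_prod (I : eqType) (r : seq I) (f : I -> T -> R[i]) (l : I -> R[i]) :
  (forall i, i \in r -> tends F (f i) (l i)) ->
  tends F (fun t => \prod_(i <- r) f i t) (\prod_(i <- r) l i).
Proof.
elim: r => [_|i r IH h].
  by rewrite big_nil; apply: tends_ext (tends_cst 1) => t; rewrite big_nil.
rewrite big_cons; apply: (@tends_ext (fun t => f i t * \prod_(j <- r) f j t)).
  by move=> t; rewrite big_cons.
apply: tendsM; first by apply: h; rewrite mem_head.
by apply: IH => j jr; apply: h; rewrite inE jr orbT.
Qed.

Lemma tends_exp f l k : tends F f l -> tends F (fun t => f t ^+ k) (l ^+ k).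
Proof.
move=> fl; elim: k => [|k IH]; first by rewrite expr0; exact: tends_cst.
rewrite exprS; apply: tends_ext (tendsM fl IH) => t; by rewrite exprS.
Qed.

Lemma tends_det n (M : T -> 'M[R[i]]_n) (L : 'M[R[i]]_n) :
  (forall i j, tends F (fun t => M t i j) (L i j)) ->
  tends F (fun t => \det (M t)) (\det L).
Proof.
move=> h; rewrite /determinant.
apply: (@tends_sum _ _ (fun (s : {perm 'I_n}) t => (-1) ^+ s * \prod_i M t i (s i))
  (fun s : {perm 'I_n} => (-1) ^+ s * \prod_i L i (s i))) => s _.
apply: tendsM; first exact: tends_cst.
by apply: (@tends_prod _ _ (fun (i : 'I_n) t => M t i (s i)) (fun i => L i (s i))) => i _; exact: h.
Qed.

End Tends.

Lemma tends_comp (T U : Type) (F : set_system T) (G : set_system U) (g : T -> U)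
    (f : U -> R[i]) l :
  (forall P, G P -> F (g @^-1` P)) -> tends G f l -> tends F (f \o g) l.
Proof. by move=> gFG fl e e0; exact: gFG (fl e e0). Qed.

Lemma nbhscP z (P : R[i] -> Prop) :
  (\forall w \near z, P w) <->
  exists2 e : R, 0 < e & forall w, cabs (w - z) < e -> P w.
Proof.
split.
  move=> /nbhs_ballP[e /= e0 h].
  have eE : (complex.Re e)%:C = e by rewrite RRe_real// gtr0_real.
  exists (complex.Re e); first by rewrite -ltcR eE.
  move=> w wz; apply: h; rewrite /ball/= -eE.
  by rewrite -cabsE ltcR cabsC.
move=> [e e0 h]; apply/nbhs_ballP; exists e%:C; first by rewrite /= ltcR.
move=> w /=; rewrite /ball/= -cabsE ltcR => wz; apply: h.
by rewrite cabsC.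
Qed.

Lemma dnbhscP z (P : R[i] -> Prop) :
  (\forall w \near z^', P w) <->
  exists2 e : R, 0 < e & forall w, w != z -> cabs (w - z) < e -> P w.
Proof.
rewrite /dnbhs /= /within/= -/(nbhs z _).
split.
  move=> /(@nbhscP z (fun w => w != z -> P w))[e e0 h]; exists e => // w w1 w2; exact: h.
move=> [e e0 h]; apply/(@nbhscP z (fun w => w != z -> P w)); exists e => // w w1 w2; exact: h.
Qed.

Lemma dnbhsc_proper z : ProperFilter (z^').
Proof.
apply: Build_ProperFilter_ex => P /dnbhscP[e e0 h].
exists (z + (e / 2)%:C); apply: h.
  rewrite -subr_eq0 addrC addKr -cabs_eq0 cabs_real.
  by rewrite gt_eqF// normr_gt0 gt_eqF// divr_gt0.
by rewrite addrC addKr cabs_real gtr0_norm ?divr_gt0//; lra.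
Qed.

Lemma cvgc_lim (f : nat -> R[i]) l : f @ \oo --> l -> limn f = l.
Proof. by move=> h; apply: cvg_lim h; exact: norm_hausdorff. Qed.

Lemma cvgc_unique (T : Type) (F : set_system T) {FF : ProperFilter F}
  (f : T -> R[i]) l1 l2 : f @ F --> l1 -> f @ F --> l2 -> l1 = l2.
Proof. by move=> h1 h2; apply: (cvg_unique _ h1 h2); exact: norm_hausdorff. Qed.

Lemma tends_unique (T : Type) (F : set_system T) {FF : ProperFilter F}
  (f : T -> R[i]) l1 l2 : tends F f l1 -> tends F f l2 -> l1 = l2.
Proof. by move=> /tendsP h1 /tendsP h2; exact: cvgc_unique h1 h2. Qed.

Lemma tends_subid z : tends (nbhs z) (fun w => w - z) 0.
Proof. by move=> e e0; apply/nbhscP; exists e => // w /ltW; rewrite subr0. Qed.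

Lemma tends_id z : tends (nbhs z) id z.
Proof. by move=> e e0; apply/nbhscP; exists e => // w /ltW. Qed.

Lemma tends_punct f z l : tends (nbhs z) f l -> tends (z^') f l.
Proof. by move=> h e /h H; exact: nbhs_dnbhs H. Qed.

Lemma tends_nbhs (T : Type) (F : set_system T) (g : T -> R[i]) z :
  tends F g z -> Filter F -> forall P, nbhs z P -> F (g @^-1` P).
Proof.
move=> gz FF P /nbhscP[e e0 h].
have e2 : 0 < e / 2 by rewrite divr_gt0.
by apply: filterS (gz _ e2) => t gt; apply: h; lra.
Qed.

Lemma tends_le (T : Type) (F : set_system T) {FF : ProperFilter F}
  (f : T -> R[i]) l (M : R) : tends F f l -> (\forall t \near F, cabs (f t) <= M) ->
  cabs l <= M.
Proof.
move=> h hM; rewrite leNgt; apply/negP => lM.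
have e0 : 0 < (cabs l - M) / 2 by rewrite divr_gt0// subr_gt0.
have [t [h1 h2]] := @filter_ex _ F _ _ (filterI (h _ e0) hM).
have : cabs l <= cabs (f t) + cabs (f t - l).
  by have := cabsB (f t) (f t - l); rewrite opprB addrC subrK.
by lra.
Qed.

(* Tannery's theorem: dominated convergence for sums. *)
Lemma tends_csum (T : Type) (F : set_system T) {FF : ProperFilter F} (I : choiceType)
    (f : T -> I -> R[i]) (l : I -> R[i]) (M : I -> R) :
  (\forall t \near F, forall i, cabs (f t i) <= M i) -> fsumm M ->
  (forall i, tends F (fun t => f t i) (l i)) ->
  tends F (fun t => csum (f t)) (csum l).
Proof.
move=> fM sM fl.
have M0 i : 0 <= M i.
  have [t /(_ i)] := @filter_ex _ F _ _ fM; apply: le_trans; exact: cabs_ge0.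
have lM i : cabs (l i) <= M i.
  by apply: (tends_le (fl i)); apply: filterS fM => t.
have sl : summ l by exact: summ_le sM.
move=> e e0.
(* Outside [A] both families are bounded by [M], so their difference contributes at most twice
   [e / 4]; the finite part takes the other [e / 2]. *)
have e4 : 0 < e / 4 by rewrite divr_gt0.
have [A hA] := nsum_approx M0 sM e4.
pose MA i := if i \in A then 0 else M i.
have MA0 i : 0 <= MA i by rewrite /MA; case: ifP.
have sMA : fsumm MA by apply: fsumm_le sM => i; rewrite /MA; case: ifP.
have tailA : nsum MA <= e / 4.
  have [s1 h1] : fsumm (fun i => if i \in A then M i else 0) /\
    \sum_(i <- A) M i <= nsum (fun i => if i \in A then M i else 0).
    have s1 : fsumm (fun i => if i \in A then M i else 0).
      by apply: fsumm_le sM => i; case: ifP.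
    split => //; apply: le_trans (fsum_le_nsum A _ s1); last first.
      by move=> i; case: ifP.
    rewrite le_eqVlt; apply/orP; left; apply/eqP.
    by rewrite big_seq [RHS]big_seq; apply: eq_bigr => i ->.
  have : nsum M = nsum (fun i => if i \in A then M i else 0) + nsum MA.
    rewrite -nsumD//; last by move=> i; case: ifP.
    by apply: eq_nsum => i; rewrite /MA; case: ifP; rewrite ?addr0 ?add0r.
  by lra.
have hsum : tends F (fun t => \sum_(i <- A) (f t i - l i)) 0.
  have E0 : \sum_(i <- A) (l i - l i) = 0 :> R[i] by apply: big1 => i _; rewrite subrr.
  have := @tends_sum _ F _ _ A (fun i t => f t i - l i) (fun i => l i - l i).
  rewrite E0; apply => i _.
  exact: tendsB (fl i) (tends_cst (l i)).
have e2 : 0 < e / 2 by rewrite divr_gt0.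
have near1 := hsum _ e2.
apply: filterS (filterI fM near1) => t [ft].
rewrite subr0 => h1.
have sf : summ (f t) by exact: summ_le sM.
rewrite -csumB//.
pose a i := if i \in A then f t i - l i else 0.
pose b i := if i \in A then 0 else f t i - l i.
have [|sa Ea] := @csum_fset _ _ A a; first by move=> i /negbTE; rewrite /a => ->.
have lb i : cabs (b i) <= 2 * MA i.
  rewrite /b /MA; case: ifP => _; first by rewrite cabs0 mulr0.
  by have := cabsB (f t i) (l i); have := ft i; have := lM i; lra.
have [s2 l2] := fsummZ (ler0n _ 2) MA0 sMA.
have sb : summ b by exact: summ_le s2.
rewrite (@eq_csum _ _ _ (fun i => a i + b i)); last first.
  by move=> i; rewrite /a /b; case: ifP; rewrite ?addr0 ?add0r.
rewrite csumD//; apply: (le_trans (cabsD _ _)).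
have -> : cabs (csum a) = cabs (\sum_(i <- A) (f t i - l i)).
  rewrite Ea; congr cabs; rewrite big_seq [RHS]big_seq.
  by apply: eq_bigr => i; rewrite /a => ->.
have := cabs_csum_le lb s2; lra.
Qed.

Lemma csum_finite n (f : nat -> R[i]) : (forall k, (n <= k)%N -> f k = 0) ->
  summ f /\ csum f = \sum_(k < n) f k.
Proof.
move=> f0; have [|s ->] := @csum_fset _ _ [fset k in iota 0 n]%fset f.
  by move=> k; rewrite !inE/= mem_iota/= add0n -leqNgt; exact: f0.
split=> //; rewrite -(big_mkord xpredT f) /index_iota subn0.
apply: perm_big; apply: uniq_perm; rewrite ?fset_uniq ?iota_uniq//.
by move=> k; rewrite !inE.
Qed.

(** Partial sums are unconditional sums of truncations, so this is dominated convergence with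
    majorant [cabs (f k)]. It is the bridge to the [limn (series _)] of the definitions. *)
Lemma csum_nat (f : nat -> R[i]) : summ f -> series f @ \oo --> csum f.
Proof.
move=> sf.
apply/tendsP.
apply: (@tends_ext _ _ (fun n => csum (fun k => if (k < n)%N then f k else 0))).
  move=> n; have [|_ ->] := @csum_finite n (fun k => if (k < n)%N then f k else 0).
    by move=> k; rewrite leqNgt => /negbTE ->.
  by rewrite /series/= big_mkord; apply: eq_bigr => k _; rewrite ltn_ord.
apply: (@tends_csum _ \oo _ _ _ _ (fun k => cabs (f k))).
- apply: nearW => n k; case: ifP => // _; rewrite cabs0; exact: cabs_ge0.
- exact: ((summE _).1 sf).
- move=> k; apply: (@tends_near _ _ _ (fun=> f k)); last exact: tends_cst.
  by exists k.+1 => // n /= kn; rewrite kn.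
Qed.

Lemma limn_csum (f : nat -> R[i]) : summ f -> limn (series f) = csum f.
Proof. by move=> sf; apply: cvgc_lim; exact: csum_nat. Qed.

Definition int_of_bn (p : bool * nat) : int := if p.1 then Posz p.2 else Negz p.2.
Definition bn_of_int (n : int) : bool * nat :=
  match n with Posz k => (true, k) | Negz k => (false, k) end.

Lemma int_of_bnK : cancel int_of_bn bn_of_int. Proof. by case=> [[] n]. Qed.
Lemma bn_of_intK : cancel bn_of_int int_of_bn. Proof. by case. Qed.

Lemma csum_int (u : int -> R[i]) :
  summ (fun k : nat => u (Posz k)) -> summ (fun k : nat => u (Negz k)) ->
  summ u /\ csum u = csum (fun k : nat => u (Posz k)) + csum (fun k : nat => u (Negz k)).
Proof.
move=> s1 s2; have [s E] := @csum_bool _ _ (u \o int_of_bn) s1 s2.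
split; first exact/(summ_bij u int_of_bnK bn_of_intK).
by rewrite (csum_bij u int_of_bnK bn_of_intK) E.
Qed.

Lemma summ_int (u : int -> R[i]) : summ u ->
  summ (fun k : nat => u (Posz k)) /\ summ (fun k : nat => u (Negz k)).
Proof.
move=> s; split; first by apply: (summ_comp (e := Posz)) => // x y [].
by apply: (summ_comp (e := Negz)) => // x y [].
Qed.

Lemma zsum_csum (u : int -> R[i]) : summ u -> zsum u = csum u.
Proof.
move=> s; have [s1 s2] := summ_int s; have [_ ->] := csum_int s1 s2.
by rewrite /zsum !limn_csum.
Qed.

Lemma fsumm_ratio (g : nat -> R) (r : R) N : (forall k, 0 <= g k) -> r < 1 ->
  (forall k, (N <= k)%N -> g k.+1 <= r * g k) -> fsumm g.
Proof.
move=> g0 r1 gr.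
(* A ratio [r <= 0] is allowed and makes all terms beyond [N] vanish. *)
have [r0|r0] := lerP r 0.
  have gz k : (N < k)%N -> g k = 0.
    case: k => // k /= Nk; apply/le_anti; rewrite g0 andbT.
    by apply: (le_trans (gr _ Nk)); rewrite mulr_le0_ge0.
  have [|s _] := @csum_finite N.+1 (fun k => (g k)%:C).
    by move=> k /gz ->.
  by apply: fsumm_le s => k; rewrite cabs_real ler_norm.
have r1' : 0 < 1 - r by rewrite subr_gt0.
pose c := \sum_(k < N) g k + g N / (1 - r).
have bnd n : \sum_(k < N + n) g k <= \sum_(k < N) g k + g N * ((1 - r ^+ n) / (1 - r)) /\
   g (N + n)%N <= g N * r ^+ n.
  elim: n => [|n [IH1 IH2]].
    by rewrite addn0 expr0 subrr mul0r mulr0 addr0 mulr1.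
  rewrite addnS big_ord_recr/=; split.
    have -> : (1 - r ^+ n.+1) / (1 - r) = (1 - r ^+ n) / (1 - r) + r ^+ n.
      by rewrite exprS; field; rewrite gt_eqF.
    by rewrite mulrDr addrA lerD.
  apply: (le_trans (gr _ (leq_addr _ _))).
  by rewrite exprS mulrCA ler_wpM2l// ltW.
have bnd2 n : \sum_(k < n) g k <= c.
  have h : \sum_(k < n) g k <= \sum_(k < N + n) g k.
    by rewrite addnC big_split_ord/= lerDl sumr_ge0.
  apply: (le_trans h); apply: (le_trans (bnd n).1); rewrite /c lerD2l.
  apply: ler_wpM2l => //; rewrite ler_piMl ?invr_ge0 ?ltW//.
  by rewrite ltrBlDr ltrDl exprn_gt0.
have [//|A|//] := @nsum_le_bound _ _ g c.
pose m := (\max_(i <- A) i).+1.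
apply: le_trans (bnd2 m).
have -> : \sum_(k < m) g k = \sum_(k <- iota 0 m) g k.
  by rewrite -(big_mkord xpredT g) /index_iota subn0.
have sub : {subset A <= iota 0 m}.
  move=> k kA; rewrite mem_iota/= add0n ltnS.
  by apply: (@leq_bigmax_seq _ _ _ (fun i => i)).
rewrite [leRHS](bigID (fun i => i \in A))/= ler_wpDr ?sumr_ge0//.
rewrite le_eqVlt; apply/orP; left; apply/eqP; rewrite -[RHS]big_filter.
apply: perm_big; apply: uniq_perm; rewrite ?fset_uniq ?filter_uniq//.
  exact: (iota_uniq 0 m).
by move=> k; rewrite mem_filter; case: (boolP (k \in A)) => //= /sub ->.
Qed.

Lemma fsumm_geo (r : R) : 0 <= r < 1 -> fsumm (fun k => r ^+ k).
Proof.
move=> /andP[r0 r1]; apply: (@fsumm_ratio _ r 0%N) => // k.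
  by rewrite exprn_ge0.
by rewrite exprS.
Qed.

End Limits.

Global Opaque cabs fsumm nsum summ csum analytic_at tends.

(** * Power series and analytic functions *)

Section PowerSeries.
Variable R : realType.
Implicit Types (a b : nat -> R[i]) (f g : R[i] -> R[i]) (z h : R[i]) (r : R).

(** Absolute convergence is asked on the closed disc, rim included: one summable majorant then
    serves all its points. *)
Definition has_ps a r f z0 :=
  [/\ 0 < r, summ (fun k => a k * r%:C ^+ k) &
      forall h, cabs h <= r -> f (z0 + h) = csum (fun k => a k * h ^+ k)].

Lemma ps_summ a r h : cabs h <= r -> summ (fun k => a k * r%:C ^+ k) ->
  summ (fun k => a k * h ^+ k).
Proof.
move=> hr; apply: summ_dom => k; rewrite !cabsM !cabsX ler_wpM2l ?cabs_ge0//.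
by rewrite lerXn2r ?nnegrE ?cabs_ge0// cabs_real (le_trans hr)// ler_norm.
Qed.

Lemma ps_shrink a r r' f z0 : 0 < r' <= r -> has_ps a r f z0 -> has_ps a r' f z0.
Proof.
move=> /andP[r0 rr] [_ s fE]; split.
- exact: r0.
- by apply: ps_summ s; rewrite cabs_real ger0_norm ?(ltW r0).
- by move=> h hr; apply: fE; exact: le_trans rr.
Qed.

Lemma ps_near a r f g z0 : has_ps a r f z0 -> (\forall z \near z0, f z = g z) ->
  exists2 r', 0 < r' <= r & has_ps a r' g z0.
Proof.
move=> fa /nbhscP[e e0 h].
pose r' := Num.min r (e / 2).
have [r0 _ _] := fa.
have r'0 : 0 < r' <= r.
  by rewrite /r' lt_min r0 divr_gt0//= ge_min lexx.
exists r' => //; have [_ s fE] := ps_shrink r'0 fa.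
split => //; first by case/andP: r'0.
move=> k kr; rewrite -h ?fE//; rewrite [z0 + k]addrC addrK.
apply: (le_lt_trans kr); rewrite /r'; apply: (@le_lt_trans _ _ (e / 2)).
  by rewrite ge_min lexx orbT.
by lra.
Qed.

Lemma geo_summ a (r : R) N : 0 < r ->
  (forall k, (N <= k)%N -> cabs (a k) * (2 * r) ^+ k <= 1) ->
  summ (fun k => a k * r%:C ^+ k).
Proof.
move=> r0 h.
pose u k := if (k < N)%N then a k * r%:C ^+ k else 0.
have [|su _] := @csum_finite _ N u.
  by move=> k; rewrite /u leqNgt => /negbTE ->.
apply: (@summ_le _ _ _ (fun k => cabs (u k) + (2^-1) ^+ k)).
  move=> k; rewrite /u; case: ltnP => kN.
    by rewrite lerDl exprn_ge0.
  rewrite cabs0 add0r cabsM cabsX cabs_real gtr0_norm//.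
  have := h _ kN; rewrite exprMn mulrCA mulrC => h1.
  by rewrite exprVn -[leRHS]mul1r ler_pdivlMr ?exprn_gt0.
apply: fsummD.
- by move=> i; exact: cabs_ge0.
- by move=> i; rewrite exprn_ge0.
- exact: ((summE _).1 su).
- by apply: fsumm_geo; lra.
Qed.

(** Abel's argument: the terms at distance [e / 2] tend to 0, hence are eventually at most 1, and at
    distance [e / 4] they decay like powers of 1/2. The factor 2 in [geo_summ] is this halving. *)
Lemma analyticP f z0 : analytic_at f z0 <-> exists a r, has_ps a r f z0.
Proof.
Transparent analytic_at.
split=> [[a /nbhscP[e e0 h]]|[a [r [r0 s fE]]]]; last first.
  exists a; apply/nbhscP; exists r => // w wr.
  have E : z0 + (w - z0) = w by ring.
  rewrite -{2}E fE ?ltW//.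
  by apply: csum_nat; apply: ps_summ s; exact: ltW.
have c1 : cabs ((z0 + (e / 2)%:C) - z0) < e.
  by rewrite addrAC subrr add0r cabs_real gtr0_norm ?divr_gt0//; lra.
have e4 : 0 < e / 4 by rewrite divr_gt0.
have /cvg_series_cvg_0 : cvgn (series (fun k => a k * ((z0 + (e / 2)%:C) - z0) ^+ k)).
  by apply/cvg_ex; eexists; exact: h c1.
rewrite addrAC subrr add0r => /cvgcP /(_ 1 ltr01) [N _ hN].
have s : summ (fun k => a k * (e / 4)%:C ^+ k).
  apply: (@geo_summ _ _ N) => // k Nk.
  have := hN k Nk; rewrite /= subr0 cabsM cabsX cabs_real gtr0_norm ?divr_gt0//.
  by have -> : 2 * (e / 4) = e / 2 by lra.
exists a, (e / 4); split=> // k kr.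
have hk : cabs (z0 + k - z0) < e by rewrite addrAC subrr add0r; lra.
have := h _ hk; rewrite addrAC subrr add0r => h1.
by apply: cvgc_unique h1 _; apply: csum_nat; exact: ps_summ s.
Qed.

Lemma analytic_near f g z0 : (\forall z \near z0, f z = g z) ->
  analytic_at f z0 -> analytic_at g z0.
Proof.
move=> fg /analyticP[a [r fa]]; have [r' _ ga] := ps_near fa fg.
by apply/analyticP; exists a, r'.
Qed.

Lemma ps_center a r f z0 : has_ps a r f z0 -> f z0 = a 0%N.
Proof.
move=> [r0 _ /(_ 0)]; rewrite cabs0 addr0 => ->; last exact: ltW.
have [|_ ->] := @csum_single _ _ 0%N (fun k => a k * 0 ^+ k).
  by case=> // k _; rewrite expr0n mulr0.
by rewrite expr0 mulr1.
Qed.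

Lemma ps_tends a r f z0 h : has_ps a r f z0 -> cabs h < r ->
  tends (nbhs (z0 + h)) f (f (z0 + h)).
Proof.
move=> [r0 s fE] hr; rewrite fE ?ltW//.
have nr : \forall w \near z0 + h, cabs (w - z0) <= r.
  apply/nbhscP; exists (r - cabs h); first by rewrite subr_gt0.
  move=> w wh; have := cabsD (w - (z0 + h)) h.
  have -> : w - (z0 + h) + h = w - z0 by ring.
  by lra.
apply: (@tends_near _ _ _ _ (fun w => csum (fun k => a k * (w - z0) ^+ k))).
  by apply: filterS nr => w wr; rewrite -fE//; congr f; ring.
apply: (@tends_csum _ _ _ _ _ (fun w k => a k * (w - z0) ^+ k) _
  (fun k => cabs (a k * r%:C ^+ k))).
- apply: filterS nr => w wr k; rewrite !cabsM !cabsX ler_wpM2l ?cabs_ge0//.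
  by rewrite lerXn2r ?nnegrE ?cabs_ge0// cabs_real (le_trans wr)// ler_norm.
- exact: ((summE _).1 s).
- move=> k; apply: tendsM; first exact: tends_cst.
  have E : h = z0 + h - z0 by ring.
  rewrite {2}E; apply: tends_exp; apply: tendsB; [exact: tends_id|exact: tends_cst].
Qed.

Lemma analytic_tends f z0 : analytic_at f z0 -> tends (nbhs z0) f (f z0).
Proof.
move=> /analyticP[a [r fa]]; have [r0 _ _] := fa.
by have := @ps_tends a r f z0 0 fa; rewrite cabs0 addr0; exact.
Qed.

Lemma cauchy_prod (u v : nat -> R[i]) : summ u -> summ v ->
  summ (fun k => \sum_(i < k.+1) u i * v (k - i)%N) /\
  csum u * csum v = csum (fun k => \sum_(i < k.+1) u i * v (k - i)%N).
Proof.
move=> su sv.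
(* [F] lives on pairs [(k, i)] with [i <= k], row [k] holding the products of total degree [k]; [e]
   sends [(i, j)] to [(i + j, i)]. *)
pose F (p : nat * nat) := if (p.2 <= p.1)%N then u p.2 * v (p.1 - p.2)%N else 0.
pose e (p : nat * nat) := ((p.1 + p.2)%N, p.1).
have ie : injective e.
  by move=> [i j] [i' j'] [] /= + E; rewrite E => /addnI ->.
have F0 j : ~ range e j -> F j = 0.
  move=> hj; rewrite /F; case: ifPn => // le; exfalso; apply: hj.
  by exists (j.2, (j.1 - j.2)%N) => //; case: j le => k i /= le; rewrite /e/= subnKC.
have Fe : F \o e =1 (fun p => u p.1 * v p.2).
  by move=> [i j]; rewrite /F /e/= leq_addr addKn.
have sF : summ F.
  apply/(summ_inj ie F0); apply: eq_summ (summ_prod su sv) => p; by rewrite Fe.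
have inner k : csum (fun i => F (k, i)) = \sum_(i < k.+1) u i * v (k - i)%N.
  have [|_ ->] := @csum_finite _ k.+1 (fun i => F (k, i)).
    by move=> i; rewrite /F/= ltnNge => /negbTE ->.
  by apply: eq_bigr => i _; rewrite /F/= -ltnS ltn_ord.
split.
  by apply: eq_summ (summ_pair2 sF) => k; rewrite inner.
rewrite csum_prod// -(eq_csum Fe) -csum_inj// csum_pair//.
by apply: eq_csum => k; rewrite inner.
Qed.

Lemma convE a b k h : \sum_(i < k.+1) (a i * h ^+ i) * (b (k - i)%N * h ^+ (k - i)) =
  (\sum_(i < k.+1) a i * b (k - i)%N) * h ^+ k.
Proof.
rewrite mulr_suml; apply: eq_bigr => i _.
have -> : h ^+ k = h ^+ i * h ^+ (k - i) by rewrite -exprD subnKC// -ltnS.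
ring.
Qed.

Lemma ps_mul a b r f g z0 : has_ps a r f z0 -> has_ps b r g z0 ->
  has_ps (fun k => \sum_(i < k.+1) a i * b (k - i)%N) r (fun z => f z * g z) z0.
Proof.
move=> [r0 sa fE] [_ sb gE]; split=> //.
  have [s _] := cauchy_prod sa sb; apply: eq_summ s => k; exact: convE.
move=> h hr; rewrite fE// gE//.
have [_ ->] := cauchy_prod (ps_summ hr sa) (ps_summ hr sb).
by apply: eq_csum => k; exact: convE.
Qed.

Lemma ps_add a b r f g z0 : has_ps a r f z0 -> has_ps b r g z0 ->
  has_ps (fun k => a k + b k) r (fun z => f z + g z) z0.
Proof.
move=> [r0 sa fE] [_ sb gE]; split=> //.
  apply: eq_summ (summD sa sb) => k; by rewrite mulrDl.
move=> h hr; rewrite fE// gE// -csumD; [|exact: ps_summ sa|exact: ps_summ sb].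
by apply: eq_csum => k; rewrite mulrDl.
Qed.

Lemma ps_single (c : R[i]) m r z0 : 0 < r ->
  has_ps (fun k => if k == m then c else 0) r (fun z => c * (z - z0) ^+ m) z0.
Proof.
move=> r0; have E h : summ (fun k => (if k == m then c else 0) * h ^+ k) /\
    csum (fun k => (if k == m then c else 0) * h ^+ k) = c * h ^+ m.
  have [|s ->] := @csum_single _ _ m (fun k => (if k == m then c else 0) * h ^+ k).
    by move=> k /negbTE ->; rewrite mul0r.
  by rewrite eqxx.
split=> //; first by case: (E r%:C).
by move=> h _; case: (E h) => _ ->; rewrite addrAC subrr add0r.
Qed.

Lemma analytic_pair f g z0 : analytic_at f z0 -> analytic_at g z0 ->
  exists a b r, has_ps a r f z0 /\ has_ps b r g z0.
Proof.
move=> /analyticP[a [r fa]] /analyticP[b [r' gb]].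
have [r0 _ _] := fa; have [r0' _ _] := gb.
exists a, b, (Num.min r r'); split.
  by apply: ps_shrink fa; rewrite lt_min r0 r0' ge_min lexx.
by apply: ps_shrink gb; rewrite lt_min r0 r0' ge_min lexx orbT.
Qed.

Lemma analyticM f g z0 : analytic_at f z0 -> analytic_at g z0 ->
  analytic_at (fun z => f z * g z) z0.
Proof.
move=> fa ga; have [a [b [r [h1 h2]]]] := analytic_pair fa ga.
by apply/analyticP; eexists _, r; exact: ps_mul h1 h2.
Qed.

Lemma analyticD f g z0 : analytic_at f z0 -> analytic_at g z0 ->
  analytic_at (fun z => f z + g z) z0.
Proof.
move=> fa ga; have [a [b [r [h1 h2]]]] := analytic_pair fa ga.
by apply/analyticP; eexists _, r; exact: ps_add h1 h2.
Qed.

Lemma analytic_pow c m z0 : analytic_at (fun z => c * (z - z0) ^+ m) z0.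
Proof. by apply/analyticP; eexists _, 1; exact: ps_single. Qed.

Lemma analytic_cst c z0 : analytic_at (fun=> c) z0.
Proof.
have := @analytic_pow c 0 z0; apply: analytic_near.
by apply/nbhscP; exists 1 => // w _; rewrite expr0 mulr1.
Qed.

Lemma analyticZ c f z0 : analytic_at f z0 -> analytic_at (fun z => c * f z) z0.
Proof. by move=> fa; exact: (analyticM (analytic_cst c z0) fa). Qed.

Lemma analyticB f g z0 : analytic_at f z0 -> analytic_at g z0 ->
  analytic_at (fun z => f z - g z) z0.
Proof.
move=> fa ga; have := analyticD fa (analyticZ (-1) ga); apply: analytic_near.
by apply/nbhscP; exists 1 => // w _; rewrite mulN1r.
Qed.

(** Course-of-values recursion: as [G n] reads only entries below [n], entry [n] no longer changes
    after [n + 1] iterations of [T]. *)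
Lemma strong_rec (G : nat -> (nat -> R[i]) -> R[i]) :
  (forall n b1 b2, (forall k, (k < n)%N -> b1 k = b2 k) -> G n b1 = G n b2) ->
  exists b, forall n, b n = G n b.
Proof.
move=> hG; pose T (b : nat -> R[i]) n := G n b.
pose it m := iter m T (fun=> 0).
have st n : forall m m', (n < m)%N -> (n < m')%N -> it m n = it m' n.
  elim/ltn_ind: n => n IH [//|m] [//|m'] nm nm'.
  rewrite /it !iterS /T; apply: hG => k kn.
  by apply: IH => //; [exact: (leq_trans kn)|exact: (leq_trans kn)].
exists (fun n => it n.+1 n) => n; rewrite /it iterS {1}/T; apply: hG => k kn.
exact: (st k n k.+1 kn (ltnSn k)).
Qed.

Lemma partial_le_nsum (g : nat -> R) n : (forall k, 0 <= g k) -> fsumm g ->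
  \sum_(k < n) g k <= nsum g.
Proof.
move=> g0 sg; apply: le_trans (fsum_le_nsum [fset k in iota 0 n]%fset g0 sg).
rewrite -(big_mkord xpredT g) /index_iota subn0 le_eqVlt; apply/orP; left; apply/eqP.
apply: perm_big; apply: uniq_perm; rewrite ?fset_uniq ?iota_uniq//.
by move=> k; rewrite !inE.
Qed.

Lemma ps_inv a r f z0 : has_ps a r f z0 -> a 0%N != 0 ->
  exists b r', has_ps b r' (fun z => (f z)^-1) z0.
Proof.
move=> fa a0; have [r0 sa fE] := fa.
have ca0 : 0 < cabs (a 0%N) by rewrite cabs_gt0.
pose S := nsum (fun k => cabs (a k * r%:C ^+ k)).
have S0 : 0 <= S by apply: nsum_ge0 => k; exact: cabs_ge0.
(* Shrinking the radius to [t * r] with [t <= 1] multiplies the nonconstant terms by at most [t], so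
   that their absolute sum is at most [t * S], hence at most [cabs (a 0)]. *)
pose t := cabs (a 0%N) / (S + cabs (a 0%N)).
have den : 0 < S + cabs (a 0%N) by rewrite ltr_wpDl.
have t0 : 0 < t by rewrite divr_gt0.
have t1 : t <= 1 by rewrite ler_pdivrMr// mul1r lerDr.
have tS : t * S <= cabs (a 0%N).
  rewrite /t mulrAC ler_pdivrMr// ler_wpM2l ?lerDl// ltW//.
pose p := t * r.
have p0 : 0 < p by rewrite mulr_gt0.
have bnd n : \sum_(k < n) cabs (a k.+1) * p ^+ k.+1 <= cabs (a 0%N).
  apply: le_trans tS.
  apply: (@le_trans _ _ (t * \sum_(k < n) cabs (a k.+1) * r ^+ k.+1)).
    rewrite mulr_sumr; apply: ler_sum => k _.
    rewrite /p exprMn mulrCA; apply: ler_wpM2r.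
      by rewrite mulr_ge0 ?cabs_ge0// exprn_ge0// ltW.
    by rewrite exprS; apply: ler_piMr; [exact: ltW|apply: exprn_ile1; [exact: ltW|]].
  apply: ler_wpM2l; first exact: ltW.
  have := partial_le_nsum n.+1 (fun k => cabs_ge0 (a k * r%:C ^+ k)) ((summE _).1 sa).
  rewrite big_ord_recl/=; apply: le_trans.
  apply: ler_wpDl; first exact: cabs_ge0.
  apply: ler_sum => k _; rewrite cabsM cabsX cabs_real gtr0_norm//.
have [b bE] : exists b, forall n, b n =
    (fun n b => if n is m.+1 then - (a 0%N)^-1 * \sum_(k < m.+1) a k.+1 * b (m - k)%N
     else (a 0%N)^-1) n b.
  apply: strong_rec => -[//|m] b1 b2 h; congr (_ * _).
  apply: eq_bigr => k _; rewrite h// ltnS leq_subr//.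
have b0E : b 0%N = (a 0%N)^-1 by rewrite bE.
(* At radius [p] the nonconstant coefficients of [f] together weigh no more than [a 0], so the
   recursion cannot exceed the weight of the first coefficient of the inverse. Halving [p] then
   gives geometric decay. *)
have bb n : cabs (b n) * p ^+ n <= cabs (a 0%N)^-1.
  elim/ltn_ind: n => -[_|m IH].
    by rewrite b0E expr0 mulr1.
  rewrite bE cabsM cabsN -mulrA ler_piMr ?cabs_ge0//.
  have := bnd m.+1 => bm.
  have h : cabs (\sum_(k < m.+1) a k.+1 * b (m - k)%N) * p ^+ m.+1 <=
      \sum_(k < m.+1) (cabs (a k.+1) * p ^+ k.+1) * (cabs (b (m - k)%N) * p ^+ (m - k)).
    apply: le_trans (ler_wpM2r (exprn_ge0 _ (ltW p0)) (cabs_sum _)) _.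
    rewrite mulr_suml; apply: ler_sum => k _; rewrite cabsM le_eqVlt; apply/orP; left.
    have -> : p ^+ m.+1 = p ^+ k.+1 * p ^+ (m - k).
      by rewrite -exprD addSn subnKC// -ltnS.
    by apply/eqP; ring.
  have h2 : cabs (\sum_(k < m.+1) a k.+1 * b (m - k)%N) * p ^+ m.+1 <= 1.
    apply: (le_trans h).
    apply: (@le_trans _ _ (\sum_(k < m.+1) (cabs (a k.+1) * p ^+ k.+1) * cabs (a 0%N)^-1)).
      apply: ler_sum => k _; rewrite ler_wpM2l//.
        by rewrite mulr_ge0 ?cabs_ge0// exprn_ge0// ltW.
      by apply: IH; rewrite ltnS leq_subr.
    by rewrite -mulr_suml cabsV ler_pdivrMr// mul1r.
  exact: h2.
pose r' := p / 2.
have r'0 : 0 < r' by rewrite divr_gt0.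
have sb : summ (fun k => b k * r'%:C ^+ k).
  have half : 0 <= (2^-1 : R) < 1 by apply/andP; split; lra.
  have [s _] := fsummZ (cabs_ge0 (a 0%N)^-1)
    (fun k => exprn_ge0 k (proj1 (andP half))) (fsumm_geo half).
  apply: summ_le s => k; rewrite cabsM cabsX cabs_real gtr0_norm//.
  by rewrite /r' exprMn mulrA ler_wpM2r// exprn_ge0// invr_ge0.
have rr' : 0 < r' <= r.
  rewrite r'0/= /r' /p; apply: (@le_trans _ _ (t * r)).
    by have := p0; rewrite /p; lra.
  by rewrite ler_piMl// ltW.
pose g z := csum (fun k => b k * (z - z0) ^+ k).
have gb : has_ps b r' g z0.
  by split; [by []|by []|move=> h _; rewrite /g addrAC subrr add0r].
have [_ _ fgE] := ps_mul (ps_shrink rr' fa) gb.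
exists b, r'; split; [exact: r'0|exact: sb|move=> h hr].
have <- : g (z0 + h) = csum (fun k => b k * h ^+ k).
  by rewrite /g addrAC subrr add0r.
have E1 : f (z0 + h) * g (z0 + h) = 1.
  rewrite fgE//.
  have [|_ ->] := @csum_single _ _ 0%N
    (fun k => (\sum_(i < k.+1) a i * b (k - i)%N) * h ^+ k).
    case=> // m _; rewrite big_ord_recl/= subn0 (bE m.+1) mulrA mulrN mulfV//.
    by rewrite mulN1r addNr mul0r.
  by rewrite big_ord1 expr0 mulr1 subn0 b0E mulfV.
have fn0 : f (z0 + h) != 0.
  by apply/eqP => f0; move: E1; rewrite f0 mul0r => /eqP; rewrite eq_sym oner_eq0.
by rewrite -[LHS]mulr1 -E1 mulrA mulVf// mul1r.
Qed.

Lemma analyticV f z0 : analytic_at f z0 -> f z0 != 0 ->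
  analytic_at (fun z => (f z)^-1) z0.
Proof.
move=> /analyticP[a [r fa]]; rewrite (ps_center fa) => a0.
by apply/analyticP; exact: ps_inv fa a0.
Qed.

Lemma analytic_div f g z0 : analytic_at f z0 -> analytic_at g z0 -> g z0 != 0 ->
  analytic_at (fun z => f z / g z) z0.
Proof. by move=> fa ga g0; apply: analyticM fa _; exact: analyticV. Qed.

Lemma analytic_neq0 f z0 : analytic_at f z0 -> f z0 != 0 ->
  \forall z \near z0, f z != 0.
Proof.
move=> /analytic_tends h f0.
have c0 : 0 < cabs (f z0) / 2 by rewrite divr_gt0// cabs_gt0.
apply: filterS (h _ c0) => w; apply: contraTneq => ->.
by rewrite sub0r cabsN -ltNge; lra.
Qed.

Lemma ps_drop a r f z0 m : has_ps a r f z0 -> (forall k, (k < m)%N -> a k = 0) ->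
  exists g, [/\ analytic_at g z0, g z0 = a m &
    \forall z \near z0, f z = (z - z0) ^+ m * g z].
Proof.
move=> [r0 sa fE] am.
pose g z := csum (fun k => a (k + m)%N * (z - z0) ^+ k).
have im : injective (fun k => (k + m)%N) by move=> x y /addIn.
have rg j : ~ range (fun k => (k + m)%N) j -> (j < m)%N.
  move=> hj; rewrite ltnNge; apply/negP => mj; apply: hj.
  by exists (j - m)%N => //; rewrite subnK.
have s1 : summ (fun k => a (k + m)%N * r%:C ^+ k).
  have := summ_comp im sa.
  have rm : r%:C ^+ m != 0 :> R[i].
    by rewrite expf_neq0// -cabs_eq0 cabs_real gt_eqF// normr_gt0 gt_eqF.
  move=> /(summZ (r%:C ^+ m)^-1); apply: eq_summ => k /=.
  by rewrite exprD; field.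
have ga : has_ps (fun k => a (k + m)%N) r g z0.
  by split; [by []|by []|move=> h _; rewrite /g addrAC subrr add0r].
exists g; split.
- by apply/analyticP; eexists _, r; exact: ga.
- by rewrite (ps_center ga) add0n.
- apply/nbhscP; exists r => // w wr.
  have E : z0 + (w - z0) = w by ring.
  rewrite -{1}E fE ?ltW// (csum_inj im); last first.
    by move=> j /rg /am ->; rewrite mul0r.
  rewrite /g -csumZ; last by apply: ps_summ s1; exact: ltW.
  by apply: eq_csum => k /=; rewrite exprD; ring.
Qed.

Lemma analytic_zero f z0 : analytic_at f z0 ->
  (\forall z \near z0, f z = 0) \/
  exists m g, [/\ analytic_at g z0, g z0 != 0 &
    \forall z \near z0, f z = (z - z0) ^+ m * g z].
Proof.
move=> /analyticP[a [r fa]].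
have [a0|/existsNP[k0 /eqP ak0]] := pselect (forall k, a k = 0).
  left; have [r0 _ fE] := fa; apply/nbhscP; exists r => // w wr.
  have E : z0 + (w - z0) = w by ring.
  rewrite -E fE ?ltW// -[RHS](csum0 _ nat); apply: eq_csum => k.
  by rewrite a0 mul0r.
right; have ex : exists k, a k != 0 by exists k0.
have [g [g1 g2 g3]] := @ps_drop _ _ _ _ (ex_minn ex) fa
  ltac:(by case: ex_minnP => m _ mm k km; apply/eqP; apply: contraTT km => /mm; rewrite -leqNgt).
exists (ex_minn ex), g; split => //.
by rewrite g2; case: ex_minnP.
Qed.

Lemma analytic_zero_dich f z0 : analytic_at f z0 ->
  (\forall z \near z0, f z = 0) \/ (\forall z \near z0^', f z != 0).
Proof.
move=> fa; have [|[m [g [ga g0 fE]]]] := analytic_zero fa; first by left.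
right; have : \forall z \near z0, f z = (z - z0) ^+ m * g z /\ g z != 0.
  exact: filterI fE (analytic_neq0 ga g0).
move=> /nbhscP[e e0 h].
apply/dnbhscP; exists e => // w w1 w2; have [-> gw] := h _ w2.
by rewrite mulf_neq0// expf_neq0// subr_eq0.
Qed.

End PowerSeries.

(** * Complex derivatives and functions with derivative zero *)

Section Derivatives.
Variable R : realType.
Implicit Types (f g phi : R[i] -> R[i]) (z w l : R[i]).

(* Caratheodory's form of complex differentiability. *)
Definition Cder f z l := exists phi,
  [/\ phi z = l, tends (nbhs z) phi l & \forall w \near z, f w = f z + phi w * (w - z)].

Lemma Cder_tends f z l : Cder f z l -> tends (nbhs z) f (f z).
Proof.
move=> [phi [_ phil fE]].
have H : tends (nbhs z) (fun w => f z + phi w * (w - z)) (f z + l * 0).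
  exact: tendsD (tends_cst (f z)) (tendsM phil (tends_subid z)).
rewrite mulr0 addr0 in H; apply: tends_near H.
by apply: filterS fE => w ->.
Qed.

Lemma Cder_near f g z l : (\forall w \near z, f w = g w) -> Cder f z l -> Cder g z l.
Proof.
move=> fg [phi [pz pl fE]]; exists phi; split=> //.
have fgz : f z = g z by exact: nbhs_singleton fg.
by apply: filterS2 fg fE => w <- ->; rewrite fgz.
Qed.

Lemma CderM f g z l m : Cder f z l -> Cder g z m ->
  Cder (fun w => f w * g w) z (l * g z + f z * m).
Proof.
move=> [p [pz pl fE]] gd; have gc := Cder_tends gd; move: gd => [q [qz ql gE]].
exists (fun w => p w * g w + f z * q w); split.
- by rewrite pz qz.
- exact: tendsD (tendsM pl gc) (tendsM (tends_cst _) ql).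
- apply: filterS2 fE gE => w fw gw.
  rewrite mulrDl; rewrite [in LHS]fw [g w in LHS]gw [g w in RHS]gw; ring.
Qed.

Lemma Cder_cst c z : Cder (fun=> c) z 0.
Proof.
exists (fun=> 0); split; [by []|exact: tends_cst|].
by apply/nbhscP; exists 1 => // w _; rewrite mul0r addr0.
Qed.

Lemma CderZ c f z l : Cder f z l -> Cder (fun w => c * f w) z (c * l).
Proof. by move=> fd; have := CderM (Cder_cst c z) fd; rewrite mul0r add0r. Qed.

Lemma Cder_comp f g z l m : Cder g z m -> Cder f (g z) l ->
  Cder (f \o g) z (l * m).
Proof.
move=> gd [p [pz pl fE]]; have gc := Cder_tends gd; move: gd => [q [qz ql gE]].
exists (fun w => p (g w) * q w); split.
- by rewrite pz qz.
- by apply: tendsM ql; apply: tends_comp pl; exact: tends_nbhs gc _.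
- have fgE : \forall w \near z, f (g w) = f (g z) + p (g w) * (g w - g z).
    exact: (tends_nbhs gc _ fE).
  apply: filterS2 gE fgE => w gw /= ->.
  by rewrite [X in _ + _ * (X - _)]gw; ring.
Qed.

Lemma tends_addr z c : tends (nbhs z) (fun w => w + c) (z + c).
Proof. by apply: tendsD; [exact: tends_id|exact: tends_cst]. Qed.

Lemma Cder_shift f z c l : Cder f (z + c) l -> Cder (fun w => f (w + c)) z l.
Proof.
move=> [p [pz pl E]]; exists (fun w => p (w + c)); split=> //.
  by apply: tends_comp pl; exact: tends_nbhs (tends_addr z c) _.
apply: filterS (tends_nbhs (tends_addr z c) _ E) => w /= ->.
by rewrite opprD addrACA subrr addr0.
Qed.

Lemma Cder_subc f z c l : Cder f z l -> Cder (fun w => f w - c) z l.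
Proof.
move=> [p [pz pl E]]; exists p; split=> //.
by apply: filterS E => w ->; rewrite addrAC.
Qed.

Lemma tends_shift f z c : analytic_at f (z + c) ->
  tends (z^') (fun w => f (w + c)) (f (z + c)).
Proof.
move=> /analytic_tends fz; apply: tends_punct.
by apply: tends_comp fz; exact: tends_nbhs (tends_addr z c) _.
Qed.

Lemma Cder_inv z : z != 0 -> Cder (fun w => w^-1) z (- z^-1 ^+ 2).
Proof.
move=> z0; exists (fun w => - (w^-1 * z^-1)); split.
- by rewrite expr2.
- rewrite expr2; apply: tendsN; apply: tendsM; last exact: tends_cst.
  exact: tendsV z0 (tends_id z).
- have : \forall w \near z, w != 0.
    apply/nbhscP; exists (cabs z); first by rewrite cabs_gt0.
    by move=> w; apply: contraTneq => ->; rewrite sub0r cabsN ltxx.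
  by apply: filterS => w w0; field; rewrite w0 z0.
Qed.

Lemma ps_Cder a r f z : has_ps a r f z -> Cder f z (a 1%N).
Proof.
move=> fa; have [r0 _ _] := fa; have fz := ps_center fa.
have := ps_add fa (ps_single (- a 0%N) 0 z r0) => H.
have [|g [ga g0 gE]] := ps_drop (m := 1) H.
  by case=> // _; rewrite eqxx subrr.
exists g; split.
- by rewrite g0/= addr0.
- by have := analytic_tends ga; rewrite g0/= addr0.
- apply: filterS gE => w; rewrite expr0 mulr1 expr1 => h.
  by rewrite fz mulrC -h addrC subrK.
Qed.

Lemma Cder_unique f z l m : Cder f z l -> Cder f z m -> l = m.
Proof.
move=> [p [pz pl fE]] [q [qz ql gE]].
have PF := dnbhsc_proper z.
apply: (@tends_unique _ _ z^' PF p l m (tends_punct pl)).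
apply: tends_near (tends_punct ql).
have [e e0 h] := (nbhscP _ _).1 fE; have [e' e0' h'] := (nbhscP _ _).1 gE.
apply/dnbhscP; exists (Num.min e e'); first by rewrite lt_min e0.
move=> w wz; rewrite lt_min => /andP[w1 w2].
have := h _ w1; rewrite (h' _ w2) => /addrI /mulIf -> //.
by rewrite subr_eq0.
Qed.

(** Bernoulli's inequality, in the weakened form that absorbs the factor [k] of a derived series
    into a larger radius. *)
Lemma bern (x : R) k : 0 <= x -> k%:R * x <= (1 + x) ^+ k.
Proof.
move=> x0; suff : 1 + k%:R * x <= (1 + x) ^+ k by lra.
elim: k => [|k IH]; first by rewrite expr0 mul0r addr0.
rewrite exprS; apply: (@le_trans _ _ ((1 + x) * (1 + k%:R * x))).
  rewrite -natr1; have : 0 <= k%:R * x * x by rewrite !mulr_ge0.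
  by lra.
by rewrite ler_wpM2l//; lra.
Qed.

(** The difference quotient of [z ^+ k] is a sum of mixed powers of [w] and [z], so the Caratheodory
    factor of [f] is again a series. Dominated convergence lets [w] tend to [z]; the majorant comes
    from k p^(k-1) <= r^k / (x p), where r = p (1 + x). *)
Lemma ps_deriv a r f z : has_ps a r f 0 -> cabs z < r ->
  summ (fun k => a k * k%:R * z ^+ k.-1) /\
  Cder f z (csum (fun k => a k * k%:R * z ^+ k.-1)).
Proof.
move=> fa zr; have [r0 sa fE] := fa.
pose p := (cabs z + r) / 2.
have zp : cabs z < p by rewrite /p; lra.
have pr : p < r by rewrite /p; lra.
have p0 : 0 < p by apply: le_lt_trans zp; exact: cabs_ge0.
pose x := r / p - 1.
have x0 : 0 < x by rewrite subr_gt0 ltr_pdivlMr// mul1r.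
have rE : r = p * (1 + x) by rewrite /x addrC subrK mulrC divfK// gt_eqF.
have kp k : k%:R * p ^+ k.-1 <= (x * p)^-1 * r ^+ k.
  case: k => [|k]; first by rewrite mul0r expr0 mulr1 invr_ge0 mulr_ge0 ?ltW.
  have -> : r ^+ k.+1 = p ^+ k.+1 * (1 + x) ^+ k.+1 by rewrite -exprMn -rE.
  rewrite [leRHS]mulrC ler_pdivlMr; last exact: mulr_gt0.
  rewrite /=.
  have := bern k.+1 (ltW x0) => h.
  rewrite (_ : _ * (x * p) = p ^+ k.+1 * (k.+1%:R * x)); last by rewrite exprS; ring.
  by rewrite ler_pM2l// exprn_gt0.
pose M k := cabs (a k) * (k%:R * p ^+ k.-1).
have sM : fsumm M.
  have xp : 0 <= (x * p)^-1 by rewrite invr_ge0 mulr_ge0 ?ltW.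
  have [s _] := fsummZ xp (fun k => cabs_ge0 (a k * r%:C ^+ k)) ((summE _).1 sa).
  apply: fsumm_le s => k; rewrite cabsM cabsX cabs_real gtr0_norm// /M.
  by rewrite [leRHS]mulrCA ler_wpM2l// cabs_ge0.
pose phi w := csum (fun k => a k * \sum_(i < k) w ^+ (k.-1 - i) * z ^+ i).
have bnd w : cabs w <= p -> forall k, cabs (a k * \sum_(i < k) w ^+ (k.-1 - i) * z ^+ i) <= M k.
  move=> wp k; rewrite cabsM /M ler_wpM2l ?cabs_ge0//.
  have -> : k%:R * p ^+ k.-1 = \sum_(i < k) p ^+ k.-1.
    by rewrite sumr_const card_ord mulr_natl.
  apply: (le_trans (cabs_sum _)); apply: ler_sum => i _; rewrite cabsM !cabsX.
  have -> : p ^+ k.-1 = p ^+ (k.-1 - i) * p ^+ i.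
    by rewrite -exprD subnK//; case: k i => [[]//|k i] /=; rewrite -ltnS.
  by apply: ler_pM; rewrite ?exprn_ge0 ?cabs_ge0// lerXn2r ?nnegrE ?cabs_ge0 ?(ltW p0)// ltW.
have phz : phi z = csum (fun k => a k * k%:R * z ^+ k.-1).
  apply: eq_csum => k; rewrite -mulrA; congr (_ * _).
  rewrite (eq_bigr (fun=> z ^+ k.-1)) ?sumr_const ?card_ord ?mulr_natl// => i _.
  by rewrite -exprD subnK//; case: k i => [[]//|k i] /=; rewrite -ltnS.
have sz : summ (fun k => a k * k%:R * z ^+ k.-1).
  apply: summ_le sM => k; rewrite /M -mulrA cabsM ler_wpM2l ?cabs_ge0//.
  rewrite cabsM cabs_nat cabsX ler_wpM2l// lerXn2r ?nnegrE ?cabs_ge0 ?(ltW p0)//.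
  exact: ltW.
split=> //.
have nz : \forall w \near z, cabs w <= p.
  apply/nbhscP; exists (p - cabs z); first by rewrite subr_gt0.
  by move=> w wz; have := cabsD (w - z) z; rewrite subrK; lra.
exists phi; split=> //.
- rewrite -phz.
  apply: (@tends_csum _ _ (nbhs z) _ _
    (fun w k => a k * \sum_(i < k) w ^+ (k.-1 - i) * z ^+ i) _ M) => //.
    by apply: filterS nz => w; exact: bnd.
  move=> k; apply: tendsM; first exact: tends_cst.
  apply: (@tends_sum _ _ _ _ _ _ (fun (i : 'I_k) w => w ^+ (k.-1 - i) * z ^+ i)
     (fun i : 'I_k => z ^+ (k.-1 - i) * z ^+ i)) => i _.
  apply: tendsM; last exact: tends_cst.
  by apply: tends_exp; exact: tends_id.
- apply: filterS nz => w wp.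
  have h1 := fE z (ltW zr); have h2 := fE w (le_trans wp (ltW pr)).
  rewrite !add0r in h1 h2; rewrite h1 h2 addrC; apply/eqP; rewrite -subr_eq; apply/eqP.
  rewrite -csumB; last 2 first.
  + by apply: ps_summ sa; exact: le_trans wp (ltW pr).
  + by apply: ps_summ sa; exact: ltW.
  rewrite mulrC -csumZ; last by apply: summ_le sM => k; exact: bnd.
  by apply: eq_csum => k; rewrite -mulrBr subrXX mulrCA.
Qed.

Lemma Re_path f z (t : R) l : Cder f (t%:C * z) l ->
  is_derive t 1 (fun t => complex.Re (f (t%:C * z))) (complex.Re (l * z)).
Proof.
move=> [p [pz pl fE]].
suff H : (fun h : R => h^-1 *: (((fun t => complex.Re (f (t%:C * z))) \o shift t) (h *: 1)
    - complex.Re (f (t%:C * z)))) @ 0^' --> complex.Re (l * z).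
  apply: DeriveDef; first by apply/cvg_ex; exists (complex.Re (l * z)).
  by apply: cvg_lim H.
apply/cvgrPdistC_le => e e0.
pose c := cabs z + 1.
have c0 : 0 < c by rewrite ltr_wpDl ?cabs_ge0.
have ec : 0 < e / c by rewrite divr_gt0.
have : \forall w \near t%:C * z, cabs (p w - l) <= e / c /\
    f w = f (t%:C * z) + p w * (w - t%:C * z).
  exact: filterI (pl _ ec) fE.
move=> /nbhscP[d d0 h].
rewrite near_withinE; apply/nbhs_ballP; exists (d / c); first by rewrite /= divr_gt0.
move=> k; rewrite /ball/= sub0r normrN => kd k0.
have wd : cabs ((k + t)%:C * z - t%:C * z) < d.
  rewrite rmorphD/= mulrDl addrK cabsM cabs_real.
  apply: (@le_lt_trans _ _ (`|k| * c)); first by rewrite ler_wpM2l// /c lerDl.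
  by rewrite -ltr_pdivlMr.
have [h1 h2] := h _ wd.
rewrite /GRing.scale/= mulr1 h2.
have -> : (k + t)%:C * z - t%:C * z = k%:C * z by rewrite rmorphD/= mulrDl addrK.
rewrite ReD addrAC subrr add0r.
have -> : k^-1 * complex.Re (p ((k + t)%:C * z) * (k%:C * z)) =
    complex.Re (p ((k + t)%:C * z) * z).
  rewrite mulrCA [complex.Re (k%:C * _)](_ : _ = k * complex.Re (p ((k + t)%:C * z) * z)).
    by rewrite mulKf.
  by case: (p _ * z) => u v /=; rewrite mul0r subr0.
have -> : complex.Re (p ((k + t)%:C * z) * z) - complex.Re (l * z) =
    complex.Re ((p ((k + t)%:C * z) - l) * z).
  by rewrite mulrBl; case: (_ * z) => u v; case: (l * z).
apply: (le_trans (Re_le_cabs _)); rewrite cabsM.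
apply: (@le_trans _ _ (e / c * c)); last by rewrite divfK// gt_eqF.
by rewrite ler_pM ?cabs_ge0// /c lerDl.
Qed.

(** The real mean value theorem applies to [Re (c * f)] along the segment from 0 to [z], for each
    [c]; the conjugate of the increment as [c] yields a squared modulus. Derivatives are asked at
    interior points only: the function of the application, [Gaux], is merely shown to be continuous
    at 0. *)
Lemma Cder0_const f z :
  (forall t : R, 0 < t < 1 -> Cder f (t%:C * z) 0) ->
  (forall t : R, 0 <= t <= 1 -> tends (nbhs (t%:C * z)) f (f (t%:C * z))) ->
  f z = f 0.
Proof.
move=> fd fc; set d := f z - f 0.
have main c : complex.Re (c * d) = 0.
  pose F t := complex.Re (c * f (t%:C * z)).
  have [||s _] := @MVT R F (fun=> 0) 0 1 ltr01.
  - move=> t; rewrite in_itv/= => /fd /(CderZ c) /Re_path.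
    by rewrite mulr0 mul0r.
  - apply: continuous_in_subspaceT => t; rewrite inE/= in_itv/= => t01.
    apply/cvgrPdistC_le => e e0.
    have H : tends (nbhs (t%:C * z)) (fun w => c * f w) (c * f (t%:C * z)).
      exact: tendsM (tends_cst c) (fc t t01).
    have /nbhscP[dl d0 h] := H e e0.
    pose k := cabs z + 1.
    have k0 : 0 < k by rewrite ltr_wpDl ?cabs_ge0.
    apply/nbhs_ballP; exists (dl / k); first by rewrite /= divr_gt0.
    move=> u; rewrite /ball/= => tu; rewrite /F.
    have -> : complex.Re (c * f (u%:C * z)) - complex.Re (c * f (t%:C * z)) =
        complex.Re (c * f (u%:C * z) - c * f (t%:C * z)).
      by case: (c * _) => ? ?; case: (c * _).
    apply: (le_trans (Re_le_cabs _)); apply: h.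
    rewrite -mulrBl -rmorphB cabsM cabs_real distrC.
    apply: (@le_lt_trans _ _ (`|t - u| * k)); first by rewrite ler_wpM2l// /k lerDl.
    by rewrite -ltr_pdivlMr.
  - rewrite mul0r /F mul1r mul0r => h.
    by rewrite /d mulrBr; move: h; case: (c * _) => ? ?; case: (c * _).
have : complex.Re (d^*%C * d) = 0 by exact: main.
rewrite mulrC -sqr_normc -cabsE -rmorphXn/= => /eqP.
by rewrite expf_eq0/= cabs_eq0 subr_eq0 => /eqP.
Qed.

End Derivatives.

(** * Meromorphic functions *)

Section Meromorphic.
Variable R : realType.
Implicit Types (f g : R[i] -> R[i]) (z w : R[i]).

Lemma mero_local f z0 : analytic_at f z0 \/ pole_at f z0 ->
  exists m g, analytic_at g z0 /\ \forall z \near z0^', f z = g z / (z - z0) ^+ m.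
Proof.
move=> [fa|[m [g [ga _ fE]]]]; last by exists m.+1, g.
exists 0%N, f; split=> //; apply/dnbhscP; exists 1 => // w _ _.
by rewrite expr0 divr1.
Qed.

(** Clearing the two pole orders turns [f1 = f2] into the vanishing of one analytic function, which
    is locally zero or has isolated zeros. *)
Lemma mero_dich f1 f2 z0 : meromorphic f1 -> meromorphic f2 ->
  (\forall z \near z0^', f1 z = f2 z) \/ (\forall z \near z0^', f1 z != f2 z).
Proof.
move=> m1 m2; have [a [g1 [ga1 E1]]] := mero_local (m1 z0).
have [b [g2 [ga2 E2]]] := mero_local (m2 z0).
pose H z := g1 z * (1 * (z - z0) ^+ b) - g2 z * (1 * (z - z0) ^+ a).
have Ha : analytic_at H z0.
  exact: (analyticB (analyticM ga1 (analytic_pow 1 b z0)) (analyticM ga2 (analytic_pow 1 a z0))).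
have key : \forall z \near z0^', (f1 z == f2 z) = (H z == 0).
  have /dnbhscP[e e0 h1] := E1; have /dnbhscP[e' e0' h2] := E2.
  apply/dnbhscP; exists (Num.min e e'); first by rewrite lt_min e0.
  move=> w wz; rewrite lt_min => /andP[w1 w2].
  have d0 : w - z0 != 0 by rewrite subr_eq0.
  rewrite h1// h2// /H !mul1r eqr_div ?expf_neq0// subr_eq0.
  by [].
have PF := dnbhsc_proper z0.
have [/nbhs_dnbhs H0|H0] := analytic_zero_dich Ha.
  by left; apply: filterS2 key H0 => w /= kE Hw; apply/eqP; rewrite kE Hw.
by right; apply: filterS2 key H0 => w /= ->.
Qed.

Lemma punct_open (P : R[i] -> Prop) z0 : (\forall z \near z0^', P z) ->
  exists2 e : R, 0 < e & forall w, cabs (w - z0) < e -> \forall z \near w^', P z.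
Proof.
move=> /dnbhscP[e e0 h]; exists e => // w wz.
have [->|wn] := eqVneq w z0; first by apply/dnbhscP; exists e.
apply/dnbhscP; exists (Num.min (cabs (w - z0)) (e - cabs (w - z0))).
  by rewrite lt_min subr_gt0 wz cabs_gt0 subr_eq0 wn.
move=> v _; rewrite lt_min => /andP[v1 v2]; apply: h.
  by apply: contraTneq v1 => ->; rewrite -leNgt cabsC.
by have := cabsD (v - w) (w - z0); rewrite addrA subrK; lra.
Qed.

(** Local agreement is an open condition and so, by [mero_dich], is its failure. Pulled back to the
    line through [z0] and [z1], this reduces to connectedness of [R]; punctured neighbourhoods make
    poles on the line harmless. *)
Lemma mero_identity f1 f2 z0 z1 : meromorphic f1 -> meromorphic f2 ->
  (\forall z \near z0^', f1 z = f2 z) -> \forall z \near z1^', f1 z = f2 z.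
Proof.
move=> m1 m2 h0.
pose S z := \forall w \near z^', f1 w = f2 w.
pose p (t : R) := z0 + t%:C * (z1 - z0).
have popen (Q : R[i] -> Prop) : (forall z, Q z ->
    exists2 e : R, 0 < e & forall w, cabs (w - z) < e -> Q w) ->
    open [set t | Q (p t)].
  move=> hQ; rewrite openE => t /= /hQ[e e0 h].
  pose k := cabs (z1 - z0) + 1.
  have k0 : 0 < k by rewrite ltr_wpDl ?cabs_ge0.
  apply/nbhs_ballP; exists (e / k); first by rewrite /= divr_gt0.
  move=> u; rewrite /ball/= => tu; apply: h.
  have -> : p u - p t = (u - t)%:C * (z1 - z0) by rewrite /p rmorphB/=; ring.
  rewrite cabsM cabs_real distrC.
  apply: (@le_lt_trans _ _ (`|t - u| * k)); first by rewrite ler_wpM2l// /k lerDl.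
  by rewrite -ltr_pdivlMr.
have notS z : ~ S z -> \forall w \near z^', f1 w != f2 w.
  by case: (@mero_dich f1 f2 z m1 m2).
have conn : connected [set: R] by apply/connected_intervalP.
have op1 : open [set t | S (p t)] by apply: popen => z; exact: punct_open.
have op2 : open (~` [set t | S (p t)]).
  apply: (@popen (fun z => ~ S z)) => z /notS /punct_open[e e0 h].
  exists e => // w /h hw Sw.
  have PF := dnbhsc_proper w.
  by have [v [v1 v2]] := @filter_ex _ _ PF _ (filterI hw Sw); rewrite v2 eqxx in v1.
suff E : [set t | S (p t)] = [set: R].
  have : [set: R] 1 by [].
  by rewrite -E /= /p mul1r addrC subrK.
apply: conn.
- by exists 0 => /=; rewrite /p mul0r addr0.
- by exists [set t | S (p t)]; rewrite ?setTI.
- exists [set t | S (p t)]; last by rewrite setTI.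
  rewrite -[X in closed X]setCK; exact: open_closedC.
Qed.

(** Agreement around [z1] extends to [z1] itself: if [f1] had a pole there, its leading value [g z1]
    would be the limit of [f2 z * (z - z1) ^+ m.+1], which is 0. *)
Lemma mero_eq f1 f2 z0 z1 : meromorphic f1 -> meromorphic f2 ->
  (\forall z \near z0^', f1 z = f2 z) -> analytic_at f2 z1 -> f1 z1 = f2 z1.
Proof.
move=> m1 m2 /mero_identity-/(_ z1 m1 m2) E f2a.
have PF := dnbhsc_proper z1.
have t2 : tends (z1^') f2 (f2 z1) by apply: tends_punct; exact: analytic_tends.
have [f1a|[m [g [ga g0 fE]]]] := m1 z1.
  have t1 : tends (z1^') f1 (f1 z1) by apply: tends_punct; exact: analytic_tends.
  exact: (tends_unique t1 (tends_near (filterS (fun w (h : f1 w = f2 w) => esym h) E) t2)).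
have tg : tends (z1^') g (g z1) by apply: tends_punct; exact: analytic_tends.
have tz : tends (z1^') (fun z => f2 z * (z - z1) ^+ m.+1) (f2 z1 * 0 ^+ m.+1).
  by apply: tendsM t2 _; apply: tends_exp; apply: tends_punct; exact: tends_subid.
suff : g z1 = f2 z1 * 0 ^+ m.+1.
  by rewrite expr0n/= mulr0 => /eqP; rewrite (negbTE g0).
apply: (tends_unique tg); apply: tends_near tz.
have : \forall z \near z1^', f1 z = f2 z /\ f1 z = g z / (z - z1) ^+ m.+1.
  exact: filterI E fE.
move=> /dnbhscP[e e0 h].
apply/dnbhscP; exists e => // w wz we; have [<- ->] := h w wz we.
by rewrite divfK// expf_neq0// subr_eq0.
Qed.

Lemma entire_mero f : entire f -> meromorphic f.
Proof. by move=> fe z; left; exact: fe. Qed.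

Lemma entire_eq f1 f2 z0 : entire f1 -> entire f2 ->
  (\forall z \near z0, f1 z = f2 z) -> f1 =1 f2.
Proof.
move=> e1 e2 h z; apply: (@mero_eq _ _ z0); [exact: entire_mero|exact: entire_mero| |exact: e2].
exact: nbhs_dnbhs h.
Qed.

Lemma div_pole (N D : R[i] -> R[i]) z0 : analytic_at N z0 -> analytic_at D z0 ->
  N z0 != 0 -> D z0 = 0 -> ~ (\forall z \near z0, D z = 0) ->
  pole_at (fun z => N z / D z) z0.
Proof.
move=> Na Da N0 D0 Dn; have [//|[m [g [ga g0 DE]]]] := analytic_zero Da.
case: m DE => [|m] DE.
  exfalso; have := nbhs_singleton DE; rewrite expr0 mul1r D0 => h.
  by rewrite -h eqxx in g0.
exists m, (fun z => N z / g z); split.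
- exact: analytic_div.
- by rewrite mulf_neq0// invr_neq0.
- have : \forall z \near z0, D z = (z - z0) ^+ m.+1 * g z /\ g z != 0.
    exact: filterI DE (analytic_neq0 ga g0).
  move=> /nbhscP[e e0 h]; apply/dnbhscP; exists e => // w wz we.
  have [-> gw] := h w we; have d0 : w - z0 != 0 by rewrite subr_eq0.
  by field; rewrite gw expf_neq0.
Qed.

(** Since [x / 0 = 0], a common zero of equal orders would leave a wrong value at a removable
    singularity, which [meromorphic] excludes. A numerator that is nonzero where [D] vanishes makes
    every such point a genuine pole. *)
Lemma div_mero (N D : R[i] -> R[i]) : entire N -> entire D ->
  (forall z, D z = 0 -> N z != 0) -> (exists z, D z != 0) ->
  meromorphic (fun z => N z / D z).
Proof.
move=> Ne De h [z1 D1] z; have [D0|D0] := eqVneq (D z) 0; last first.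
  by left; apply: analytic_div.
right; apply: div_pole => //; first exact: h.
move=> Dz; have := @entire_eq D (fun=> 0) z De _ Dz z1.
have z0e : entire (fun _ : R[i] => 0) by move=> w; exact: analytic_cst.
by move=> H; move: D1; rewrite (H z0e) eqxx.
Qed.

End Meromorphic.

(** * The exponential *)

Section Exponential.
Variable R : realType.
Implicit Types (z w h : R[i]) (x y : R).

Lemma real_tends (u : nat -> R) (l : R) : u @ \oo --> l ->
  tends \oo (fun n => (u n)%:C) l%:C.
Proof.
move=> /cvgrPdistC_le h e e0; near=> n.
rewrite -rmorphB/= cabs_real; near: n; exact: h.
Unshelve. all: by end_near. Qed.

Definition expt z (k : nat) : R[i] := z ^+ k / k`!%:R.

Lemma summ_expt z : summ (expt z).
Proof.
pose x := cabs z; have x0 : 0 <= x by exact: cabs_ge0.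
apply/summE; apply: (@fsumm_ratio _ _ 2^-1 (Num.bound (2 * x))).
- by move=> k; exact: cabs_ge0.
- by lra.
- move=> k Nk; rewrite /expt !cabsM !cabsX !cabsV !cabs_nat -/x.
  have k0 : (k`!%:R : R) != 0 by rewrite pnatr_eq0 -lt0n fact_gt0.
  have k1 : (k.+1%:R : R) != 0 by rewrite pnatr_eq0.
  have -> : x ^+ k.+1 / k.+1`!%:R = x / k.+1%:R * (x ^+ k / k`!%:R).
    by rewrite factS natrM exprS; field; rewrite k0 addrC natr1 k1.
  rewrite ler_wpM2r//; first by rewrite mulr_ge0 ?exprn_ge0// invr_ge0.
  rewrite ler_pdivrMr ?ltr0n//.
  have h1 : 2 * x < (Num.bound (2 * x))%:R by apply: archi_boundP; rewrite mulr_ge0.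
  have h2 : (Num.bound (2 * x))%:R <= k.+1%:R :> R by rewrite ler_nat (leq_trans Nk).
  by lra.
Qed.

Lemma fact_neq0 k : (k`!%:R : R[i]) != 0.
Proof. by rewrite pnatr_eq0 -lt0n fact_gt0. Qed.

Lemma expt_conv z w k : \sum_(i < k.+1) expt z i * expt w (k - i) = expt (z + w) k.
Proof.
rewrite /expt addrC exprDn mulr_suml; apply: eq_bigr => i _.
have ik : (i <= k)%N by rewrite -ltnS.
have /(congr1 (fun n => n%:R : R[i])) := bin_fact ik.
rewrite !natrM => <-; rewrite -[_ *+ _]mulr_natr.
have bn : ('C(k, i)%:R : R[i]) != 0 by rewrite pnatr_eq0 -lt0n bin_gt0.
by field; rewrite bn !fact_neq0.
Qed.

Lemma csum_exptD z w : csum (expt (z + w)) = csum (expt z) * csum (expt w).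
Proof.
have [_ ->] := cauchy_prod (summ_expt z) (summ_expt w).
by apply: eq_csum => k; rewrite expt_conv.
Qed.

Lemma csum_expt_real x : csum (expt x%:C) = (expR x)%:C.
Proof.
have /tendsP h1 := csum_nat (summ_expt x%:C).
have h2 := real_tends (is_cvg_series_exp_coeff x).
apply: tends_unique h1 _; apply: tends_ext h2 => n.
rewrite /series/= rmorph_sum/=; apply: eq_bigr => k _.
by rewrite /exp_coeff/= /expt rmorphM/= rmorphXn fmorphV/= rmorph_nat.
Qed.

(** Written with [odd] and halves so as to match [cos_coeff] and [sin_coeff] term by term. *)
Lemma i_exp k : ('i : R[i]) ^+ k =
  ((~~ odd k)%:R * (-1) ^+ k./2) +i* ((odd k)%:R * (-1) ^+ k.-1./2).
Proof.
suff H m : ('i : R[i]) ^+ m.*2 = ((-1) ^+ m)%:C.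
  rewrite -{1}(odd_double_half k) exprD H.
  case: (boolP (odd k)) => ok; rewrite /= ?(expr0, expr1, mul0r, mul1r, mulr0, mulr1).
    apply: complex_ext; rewrite /= ?(mul0r, mul1r, mulr0, mulr1, addr0, subr0, add0r)//.
      by rewrite oppr0.
    have -> : k.-1 = k./2.*2 by rewrite -[in LHS](odd_double_half k) ok.
    by rewrite doubleK.
  by [].
rewrite -muln2 mulnC exprM sqr_i; elim: m => [|m IH] //.
by rewrite !exprS IH rmorphM/= rmorphN1.
Qed.

Lemma csum_expt_imag y : csum (expt ('i * y%:C)) = cos y +i* sin y.
Proof.
have /tendsP h1 := csum_nat (summ_expt ('i * y%:C)).
have h2 : tends \oo (fun n => (series (cos_coeff y) n)%:C) (cos y)%:C.
  apply: real_tends; rewrite cos.unlock; exact: is_cvg_series_cos_coeff.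
have h3 : tends \oo (fun n => (series (sin_coeff y) n)%:C) (sin y)%:C.
  apply: real_tends; rewrite sin.unlock; exact: is_cvg_series_sin_coeff.
have E : cos y +i* sin y = (cos y)%:C + 'i * (sin y)%:C.
  by rewrite {1}[_ +i* _]complexE.
rewrite E; apply: tends_unique h1 _.
apply: (@tends_ext _ _ _ (fun n => (series (cos_coeff y) n)%:C +
    'i * (series (sin_coeff y) n)%:C)); last first.
  by apply: tendsD; [exact: h2|apply: tendsM; [exact: tends_cst|exact: h3]].
move=> n; rewrite /series/= !rmorph_sum/= mulr_sumr -big_split/=.
apply: eq_bigr => k _; rewrite /expt exprMn i_exp /cos_coeff /sin_coeff/=.
rewrite -rmorphXn/= -(rmorph_nat (real_complex R)) -fmorphV/=.
apply: complex_ext; rewrite /= !(mul0r, mul1r, mulr0, subr0, addr0, add0r)//.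
Qed.

(** [expc] is defined by real functions; its power series gives the addition law, as a Cauchy
    product, and the Taylor expansion of exponential sums. *)
Lemma expcE z : expc z = csum (expt z).
Proof.
by rewrite {2}[z]complexE csum_exptD csum_expt_real csum_expt_imag.
Qed.

Lemma expcD z w : expc (z + w) = expc z * expc w.
Proof. by rewrite !expcE csum_exptD. Qed.

Lemma expc0 : expc (0 : R[i]) = 1.
Proof. by rewrite /expc/= expR0 cos0 sin0 mul1r. Qed.

Lemma expc_neq0 z : expc z != 0.
Proof.
apply/eqP => h; have := expcD z (- z); rewrite subrr expc0 h mul0r => /eqP.
by rewrite oner_eq0.
Qed.

Lemma expcN z : expc (- z) = (expc z)^-1.
Proof.
apply: (mulfI (expc_neq0 z)); by rewrite -expcD subrr expc0 mulfV// expc_neq0.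
Qed.

Lemma expcB z w : expc (z - w) = expc z / expc w.
Proof. by rewrite expcD expcN. Qed.

Lemma expcMn k z : expc (k%:R * z) = expc z ^+ k.
Proof.
elim: k => [|k IH]; first by rewrite mul0r expc0.
by rewrite -natr1 mulrDl mul1r expcD IH exprSr.
Qed.

Lemma expcMz (k : int) z : expc (k%:~R * z) = expc z ^ k.
Proof.
case: k => k; first exact: expcMn.
by rewrite NegzE mulrNz mulNr expcN expcMn -exprnN.
Qed.

Lemma cabs_expc z : cabs (expc z) = expR (complex.Re z).
Proof.
rewrite /expc cabsM cabs_real ger0_norm ?expR_ge0//.
rewrite (_ : cabs (_ +i* _) = 1) ?mulr1//.
by apply: complexI; rewrite cabsE normc_def/= cos2Dsin2 sqrtr1.
Qed.

Lemma expc_def z : expc z =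
  (expR (complex.Re z))%:C * (cos (complex.Im z) +i* sin (complex.Im z)).
Proof. by []. Qed.

Opaque expc.

Lemma cabs_expc_le z : cabs (expc z) <= expR (cabs z).
Proof. by rewrite cabs_expc ler_expR (le_trans (ler_norm _))// Re_le_cabs. Qed.

Lemma csum_nonneg (I : choiceType) (g : I -> R) : (forall i, 0 <= g i) -> fsumm g ->
  summ (fun i => (g i)%:C) /\ csum (fun i => (g i)%:C) = (nsum g)%:C.
Proof.
move=> g0 sg.
have s0 : fsumm (fun _ : I => 0 : R).
  by apply: fsumm_le sg.
have z0 : nsum (fun _ : I => 0 : R) = 0.
  apply/le_anti; rewrite nsum_ge0// andbT.
  by case: (@nsum_le_bound _ _ (fun _ : I => 0 : R) 0) => // A; rewrite big1.
split.
  by apply: summ_le sg => i; rewrite cabs_real ger0_norm.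
Transparent csum.
apply: complex_ext; rewrite /csum/=.
  by rewrite (@rsumE _ _ _ g (fun=> 0))// ?z0 ?subr0// => i; rewrite subr0.
by rewrite (@rsumE _ _ _ (fun=> 0) (fun=> 0))// ?z0 ?subr0// => i; rewrite subr0.
Qed.
Opaque csum.

Lemma nsum_expR x : 0 <= x -> fsumm (fun k => x ^+ k / k`!%:R) /\
  nsum (fun k => x ^+ k / k`!%:R) = expR x.
Proof.
move=> x0.
have E k : (x ^+ k / k`!%:R)%:C = expt x%:C k.
  by rewrite /expt rmorphM/= rmorphXn fmorphV/= rmorph_nat.
have g0 k : 0 <= x ^+ k / k`!%:R by rewrite mulr_ge0 ?exprn_ge0// invr_ge0.
have s : fsumm (fun k => x ^+ k / k`!%:R).
  apply: fsumm_le ((summE _).1 (summ_expt x%:C)) => k.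
  by rewrite -E cabs_real ler_norm.
split=> //; apply: complexI; have [_ <-] := csum_nonneg g0 s.
by rewrite -csum_expt_real; apply: eq_csum => k; exact: E.
Qed.

Section ExpSums.
Variables (I : choiceType) (c nu : I -> R[i]).

Definition expsum z := csum (fun i => c i * expc (nu i * z)).

Lemma summ_expsum z r : cabs z <= r -> fsumm (fun i => cabs (c i) * expR (cabs (nu i) * r)) ->
  summ (fun i => c i * expc (nu i * z)).
Proof.
move=> zr s; apply: summ_le s => i; rewrite cabsM ler_wpM2l ?cabs_ge0//.
by rewrite (le_trans (cabs_expc_le _))// ler_expR cabsM ler_wpM2l// cabs_ge0.
Qed.

(** Expanding the exponentials gives a double series whose row [i] has absolute sum at most
    [cabs (c i) * expR (cabs (nu i) * r)]; Fubini collects the powers of the variable. *)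
Lemma expsum_ps0 r : 0 < r -> fsumm (fun i => cabs (c i) * expR (cabs (nu i) * r)) ->
  has_ps (fun k => csum (fun i => c i * expt (nu i) k)) r expsum 0.
Proof.
move=> r0 s.
pose F h (p : I * nat) := c p.1 * expt (nu p.1 * h) p.2.
have sF h : cabs h <= r -> summ (F h).
  move=> hr; apply: (summ_pairI (h := fun i => cabs (c i) * expR (cabs (nu i) * r))) => //.
    by move=> i; exact: (summZ (c i) (summ_expt (nu i * h))).
  move=> i; have x0 : 0 <= cabs (nu i) * r by rewrite mulr_ge0 ?cabs_ge0// ltW.
  have [s1 <-] := nsum_expR x0.
  rewrite -nsumZ ?cabs_ge0//; last first.
    by move=> k; rewrite mulr_ge0 ?exprn_ge0// invr_ge0.
  apply: nsum_le => [k|k|]; first exact: cabs_ge0.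
    rewrite /F/= cabsM ler_wpM2l ?cabs_ge0// /expt cabsM cabsX cabsM cabsV cabs_nat.
    rewrite ler_wpM2r ?invr_ge0// lerXn2r ?nnegrE ?mulr_ge0 ?cabs_ge0 ?(ltW r0)//.
    by rewrite ler_wpM2l// cabs_ge0.
  have g0 k : 0 <= (cabs (nu i) * r) ^+ k / k`!%:R.
    by rewrite mulr_ge0 ?exprn_ge0// invr_ge0.
  by have [] := fsummZ (cabs_ge0 (c i)) g0 s1.
have FE h i k : F h (i, k) = (c i * expt (nu i) k) * h ^+ k.
  by rewrite /F /expt/= exprMn; ring.
have sc k : summ (fun i => c i * expt (nu i) k).
  have rr : cabs r%:C <= r by rewrite cabs_real gtr0_norm.
  have cF : summ (fun i => F r%:C (i, k)).
    apply: (summ_comp (e := fun i => (i, k)) _ (sF _ rr)) => //.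
    by move=> x y [].
  have rk : r%:C ^+ k != 0 :> R[i].
    by rewrite expf_neq0// -cabs_eq0 cabs_real gt_eqF// normr_gt0 gt_eqF.
  apply: eq_summ (summZ (r%:C ^+ k)^-1 cF) => i.
  by rewrite FE mulrC mulfK.
have col h k : csum (fun i => F h (i, k)) = csum (fun i => c i * expt (nu i) k) * h ^+ k.
  rewrite mulrC -csumZ//; apply: eq_csum => i; rewrite FE; ring.
split=> //.
- have rr : cabs r%:C <= r by rewrite cabs_real gtr0_norm.
  pose sw (p : nat * I) := (p.2, p.1).
  have sS : summ (F r%:C \o sw).
    by apply: summ_comp (sF _ rr) => -[a b] [a' b'] [] -> ->.
  by apply: eq_summ (summ_pair2 sS) => k; rewrite -col.
- move=> h hr; rewrite add0r /expsum.
  transitivity (csum (fun i => csum (fun k => F h (i, k)))).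
    by apply: eq_csum => i; rewrite /F/= csumZ ?expcE//; exact: summ_expt.
  by rewrite csum_swap; [apply: eq_csum => k; exact: col|exact: sF].
Qed.

End ExpSums.

Lemma expsum_ps (I : choiceType) (c nu : I -> R[i]) z0 r : 0 < r ->
  fsumm (fun i => cabs (c i) * expR (cabs (nu i) * (cabs z0 + r))) ->
  has_ps (fun k => csum (fun i => c i * expc (nu i * z0) * expt (nu i) k)) r
    (expsum c nu) z0.
Proof.
move=> r0 s.
have [|_ s1 E] := @expsum_ps0 I (fun i => c i * expc (nu i * z0)) nu r r0.
  apply: fsumm_le s => i; rewrite mulrDr expRD mulrA ler_wpM2r ?expR_ge0//.
  rewrite cabsM ler_wpM2l ?cabs_ge0// (le_trans (cabs_expc_le _))//.
  by rewrite cabsM.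
split=> // h hr; rewrite -(E h hr) add0r; apply: eq_csum => i.
by rewrite mulrDr expcD mulrA.
Qed.

(** Summability on every disc at once; [expsum] is then entire and can be differentiated term by
    term. *)
Definition exp_summable (I : choiceType) (c nu : I -> R[i]) :=
  forall r : R, fsumm (fun i => cabs (c i) * expR (cabs (nu i) * r)).

Section EntireExpSums.
Variables (I : choiceType) (c nu : I -> R[i]).
Hypothesis cnu : exp_summable c nu.

Lemma expsum_entire : entire (expsum c nu).
Proof. by move=> z; apply/analyticP; eexists _, 1; exact: expsum_ps. Qed.

Lemma expsum_Cder z : Cder (expsum c nu) z (expsum (fun i => c i * nu i) nu z).
Proof.
have := ps_Cder (expsum_ps (ltr01) (cnu (cabs z + 1))).
rewrite (_ : csum _ = expsum (fun i => c i * nu i) nu z)//.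
by apply: eq_csum => i; rewrite /expt expr1 divr1; ring.
Qed.

Lemma expsum_summ z : summ (fun i => c i * expc (nu i * z)).
Proof. exact: summ_expsum (lexx _) (cnu _). Qed.

End EntireExpSums.

(** The exponential is the exponential sum with a single term, indexed by [unit]. *)
Lemma Cder_expc z : Cder (@expc R) z (expc z).
Proof.
have s : exp_summable (fun _ : unit => 1 : R[i]) (fun=> 1).
  move=> r; have [|+ _] := @csum_single _ unit tt (fun=> (expR r)%:C); first by case.
  by move/summE; apply: fsumm_le => -[]; rewrite cabs1 !mul1r cabs_real ler_norm.
have E (w : R[i]) : expsum (fun _ : unit => 1) (fun=> 1) w = expc w.
  rewrite /expsum.
  have [|_ ->] := @csum_single _ unit tt (fun=> 1 * expc (1 * w)); first by case.
  by rewrite !mul1r.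
have := expsum_Cder s z.
rewrite (_ : expsum _ _ z = expc z); last first.
  by rewrite -E; apply: eq_csum => i; rewrite mulr1.
by apply: Cder_near; apply/nbhscP; exists 1 => // w _; exact: E.
Qed.

Lemma expc_analytic z0 (a : R[i]) : analytic_at (fun z => expc (a * z)) z0.
Proof.
have s : exp_summable (fun _ : unit => 1 : R[i]) (fun=> a).
  move=> r; have [|+ _] := @csum_single _ unit tt (fun=> (expR (cabs a * r))%:C); first by case.
  by move/summE; apply: fsumm_le => -[]; rewrite cabs1 !mul1r cabs_real ler_norm.
apply: analytic_near (expsum_entire s z0).
apply/nbhscP; exists 1 => // w _; rewrite /expsum.
have [|_ ->] := @csum_single _ unit tt (fun=> 1 * expc (a * w)); first by case.
by rewrite !mul1r.
Qed.

Lemma expc_twopii_int (m : int) : expc (twopii R * m%:~R) = 1.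
Proof.
rewrite mulrC expcMz (_ : expc _ = 1) ?exp1rz// expc_def/= expR0 mul1r.
have -> : 2 * pi = pi *+ 2 :> R by rewrite mulr_natl.
by rewrite cos2pi sin2pi.
Qed.

Lemma expc_eq1 z : expc z = 1 -> exists m : int, z = twopii R * m%:~R.
Proof.
move=> h.
have x0 : complex.Re z = 0.
  apply: expR_inj; rewrite -cabs_expc h cabs1 expR0 //.
(* Removing [m] full turns leaves an angle [t] in [0, 2 pi) with sine 0; only 0 and pi qualify, and
   pi has cosine -1. *)
pose m := Num.floor (complex.Im z / (2 * pi)).
have pi0 : 0 < pi :> R by exact: pi_gt0.
have p2 : 0 < 2 * pi :> R by lra.
pose w := z - twopii R * m%:~R.
have ew : expc w = 1 by rewrite expcB h expc_twopii_int divr1.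
have mE : (m%:~R : R[i]) = (m%:~R : R)%:C by rewrite rmorph_int.
have rw : complex.Re w = 0.
  by rewrite /w mE; move: x0; case: (z) => a b /= ->; rewrite !(mul0r, mulr0) subrr subr0.
pose t := complex.Im w.
have tE : t = complex.Im z - 2 * pi * m%:~R.
  by rewrite /t /w mE; case: (z) => a b /=; rewrite !(mul0r, mulr0) add0r.
have t01 : 0 <= t < 2 * pi.
  have /andP[h1 h2] := mem_rg1_floor (complex.Im z / (2 * pi)).
  rewrite -/m in h1 h2.
  rewrite ler_pdivlMr// in h1; rewrite ltr_pdivrMr// in h2.
  rewrite tE; move: h2; rewrite mulrDl => h2.
  by apply/andP; split; lra.
have wE : w = 'i * t%:C by rewrite [LHS]complexE rw add0r.
have [ct st] : cos t = 1 /\ sin t = 0.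
  move: ew; rewrite expc_def rw expR0 mul1r -/t => -[] //.
exists m; suff t0 : t = 0.
  by apply/eqP; rewrite -subr_eq0 -/w wE t0 mulr0.
have /andP[t0 t2] := t01.
have [tp|tp] := ltrP 0 t; last by apply/le_anti; rewrite t0 tp.
exfalso.
have [t1|t1|t1] := ltrgtP t pi.
- have : 0 < sin t by apply: sin_gt0_pi; rewrite tp.
  by rewrite st ltxx.
- have : 0 < sin (t - pi) by apply: sin_gt0_pi; apply/andP; split; lra.
  by rewrite sinB cospi sinpi st; lra.
- by move: ct; rewrite t1 cospi; lra.
Qed.

End Exponential.

Global Opaque expc.

(** * Reindexing of bilateral sums *)

Section SumHelpers.
Variable R : realType.

Lemma csum_shift (u : int -> R[i]) (a : int) :
  csum u = csum (fun n => u (n + a)).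
Proof.
by apply: (csum_bij (e := fun n => n + a) (e' := fun n => n - a)) => n;
  rewrite ?addrK ?subrK.
Qed.

Lemma summ_shift (u : int -> R[i]) (a : int) : summ u -> summ (fun n => u (n + a)).
Proof.
move=> s; apply/(summ_bij u (e := fun n => n + a) (e' := fun n => n - a)) => // n;
  by rewrite ?addrK ?subrK.
Qed.

Lemma csum_reflect (u : int -> R[i]) (a : int) :
  csum u = csum (fun n => u (a - n)).
Proof.
by apply: (csum_bij (e := fun n => a - n) (e' := fun n => a - n)) => n; ring.
Qed.

Lemma summ_reflect (u : int -> R[i]) (a : int) : summ u -> summ (fun n => u (a - n)).
Proof.
move=> s; apply/(summ_bij u (e := fun n => a - n) (e' := fun n => a - n)) => // n; ring.
Qed.

Lemma csum_natS (u : nat -> R[i]) : summ u ->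
  summ (fun k => u k.+1) /\ csum u = u 0%N + csum (fun k => u k.+1).
Proof.
move=> su; have sS : summ (fun k => u k.+1).
  by apply: (summ_comp (e := succn) _ su) => x y [].
split=> //.
pose a k := if k is 0%N then u 0%N else 0; pose b k := if k is m.+1 then u m.+1 else 0.
have [|sa Ea] := @csum_single _ _ 0%N a; first by case.
have sb : summ b.
  by apply: summ_dom su => -[|k] /=; rewrite ?cabs0 ?cabs_ge0.
have eS : injective succn by move=> x y [].
have <- : csum b = csum (fun k => u k.+1).
  rewrite (csum_inj eS)// => -[//|j] []; by exists j.
rewrite -[u 0%N]/(a 0%N) -Ea -csumD//.
by apply: eq_csum => -[|k] /=; rewrite ?addr0 ?add0r.
Qed.

Lemma fsumm_int (g : int -> R) : (forall n, 0 <= g n) ->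
  fsumm (fun k : nat => g (Posz k)) -> fsumm (fun k : nat => g (Negz k)) -> fsumm g.
Proof.
move=> g0 s1 s2.
have [sp _] := csum_nonneg (fun k => g0 (Posz k)) s1.
have [sn _] := csum_nonneg (fun k => g0 (Negz k)) s2.
have [s _] := csum_int (u := fun n => (g n)%:C) sp sn.
by apply: fsumm_le ((summE _).1 s) => n; rewrite cabs_real ler_norm.
Qed.

End SumHelpers.

Lemma expc_half (R : realType) : expc (twopii R / 2) = -1.
Proof.
have -> : twopii R / 2 = 'i * pi%:C.
  have -> : twopii R = 2 * ('i * pi%:C).
    rewrite /twopii -(rmorph_nat (real_complex R)).
    by apply: complex_ext; rewrite /=; ring.
  by rewrite mulrC mulKf// pnatr_eq0.
rewrite expc_def /=.
have -> : 0 * pi - 1 * 0 = 0 :> R by ring.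
have -> : 0 * 0 + 1 * pi = pi :> R by ring.
rewrite expR0 cospi sinpi.
by apply: complex_ext; rewrite /= !(mul0r, mul1r, mulr0, subr0, addr0, add0r, subrr) ?oppr0.
Qed.

(** The exponent n (n + 1) / 2 as a natural number: [k] and [- k - 1] have the same value. *)
Definition trin (n : int) : nat :=
  match n with Posz k => 'C(k.+1, 2) | Negz k => 'C(k.+1, 2) end.

Lemma bin2_double k : (2 * 'C(k.+1, 2) = k * k.+1)%N.
Proof. by elim: k => // k IH; rewrite binS mulnDr IH bin1; ring. Qed.

Lemma trinE (n : int) : (2 * trin n)%:Z = n * (n + 1).
Proof.
by case: n => k; rewrite /trin bin2_double ?NegzE; rewrite PoszM -addn1 PoszD; ring.
Qed.

(** * Theta functions *)

Section Theta.
Variables (R : realType) (tau : R[i]).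
Hypothesis htau : 0 < complex.Im tau.

Definition q := nome tau.
Definition period : R[i] := twopii R * tau.
(** The annulus [cabs q < cabs (expc z) < 1] is the strip [- width < Re z < 0]. *)
Definition width : R := 2 * pi * complex.Im tau.

Lemma width_gt0 : 0 < width.
Proof. by rewrite /width !mulr_gt0// pi_gt0. Qed.

Lemma qE : q = expc period. Proof. by []. Qed.

Lemma Re_period : complex.Re period = - width.
Proof.
by rewrite /period /twopii /width; case: tau => a b /=; rewrite mul0r sub0r.
Qed.

Lemma Re_Mperiod (n : int) : complex.Re (n%:~R * period) = - (n%:~R * width).
Proof.
have -> : n%:~R * period = (n%:~R : R)%:C * period by rewrite rmorph_int.
by have := Re_period; case: period => u v /= ->; rewrite mul0r subr0 mulrN.
Qed.

Lemma q_neq0 : q != 0. Proof. by rewrite qE expc_neq0. Qed.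

Lemma cabs_q : cabs q = expR (- width).
Proof. by rewrite qE cabs_expc Re_period. Qed.

Lemma cabs_q_gt0 : 0 < cabs q. Proof. by rewrite cabs_gt0 q_neq0. Qed.

Lemma cabs_q_lt1 : cabs q < 1.
Proof. by rewrite cabs_q -expR0 ltr_expR oppr_lt0 width_gt0. Qed.

Lemma qz (n : int) : q ^ n = expc (n%:~R * period).
Proof. by rewrite expcMz. Qed.

(** In both directions successive terms have ratio [cabs q ^+ k.+1 * B], eventually at most 1/2:
    Gaussian decay beats any exponential. *)
Lemma gauss_summ (B : R) : 0 <= B ->
  fsumm (fun n : int => cabs q ^+ trin n * B ^+ `|n|%N).
Proof.
move=> B0; have p0 := cabs_q_gt0; have p1 := cabs_q_lt1.
have half : 0 < 2^-1 :> R by lra.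
have g0 n : 0 <= cabs q ^+ trin n * B ^+ `|n|%N.
  by rewrite mulr_ge0// exprn_ge0// ltW.
have [N hN] : exists N, forall k, (N <= k)%N -> cabs q ^+ k.+1 * B <= 2^-1.
  have qq : `|cabs q| < 1 by rewrite gtr0_norm.
  have e0 : 0 < 2^-1 / (B + 1) by rewrite divr_gt0// ltr_wpDl.
  have := cvg_expr qq => /cvgrPdistC_le /(_ _ e0) [N _ hN].
  exists N => k Nk.
  have h : cabs q ^+ k.+1 <= 2^-1 / (B + 1).
    have := hN k.+1 (leq_trans Nk (leqnSn k)).
    by rewrite /= subr0 ger0_norm// exprn_ge0// ltW.
  apply: (@le_trans _ _ (2^-1 / (B + 1) * (B + 1))); last by rewrite divfK// gt_eqF// ltr_wpDl.
  apply: ler_pM => //; [by rewrite exprn_ge0// ltW|by rewrite lerDl].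
apply: (fsumm_int g0).
- apply: (@fsumm_ratio _ _ 2^-1 N) => [k||k Nk]; [exact: g0|by lra|].
  rewrite /trin/= binS bin1 exprD exprS [B ^+ k.+1]exprS.
  have -> : cabs q ^+ 'C(k.+1, 2) * (cabs q * cabs q ^+ k) * (B * B ^+ k) =
    (cabs q ^+ k.+1 * B) * (cabs q ^+ 'C(k.+1, 2) * B ^+ k) by rewrite exprS; ring.
  by rewrite ler_wpM2r ?hN// mulr_ge0 ?exprn_ge0// ltW.
- apply: (@fsumm_ratio _ _ 2^-1 N) => [k||k Nk]; [exact: g0|by lra|].
  rewrite /trin /= binS bin1 exprD exprS [B ^+ k.+2]exprS.
  have -> : cabs q ^+ 'C(k.+1, 2) * (cabs q * cabs q ^+ k) * (B * B ^+ k.+1) =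
    (cabs q ^+ k.+1 * B) * (cabs q ^+ 'C(k.+1, 2) * B ^+ k.+1) by rewrite [cabs q ^+ k.+1]exprS; ring.
  by rewrite ler_wpM2r ?hN// mulr_ge0 ?exprn_ge0// ltW.
Qed.

Lemma gauss_exp_summable (u nu : int -> R[i]) (a b : R) : 0 <= a -> 0 <= b ->
  (forall n, cabs (u n) <= cabs q ^+ trin n) ->
  (forall n, cabs (nu n) <= a * `|n|%N%:R + b) -> exp_summable u nu.
Proof.
move=> a0 b0 hu hnu r.
have [s _] := fsummZ (expR_ge0 (b * `|r|))
  (fun n => mulr_ge0 (exprn_ge0 (trin n) (ltW cabs_q_gt0)) (exprn_ge0 `|n|%N (expR_ge0 (a * `|r|))))
  (gauss_summ (expR_ge0 (a * `|r|))).
apply: fsumm_le s => n; rewrite mulrCA; apply: ler_pM; rewrite ?cabs_ge0 ?expR_ge0//.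
rewrite -expRM_natl -expRD ler_expR.
apply: (@le_trans _ _ (cabs (nu n) * `|r|)).
  by rewrite ler_wpM2l ?cabs_ge0// ler_norm.
have -> : b * `|r| + `|n|%N%:R * (a * `|r|) = (a * `|n|%N%:R + b) * `|r| by ring.
by rewrite ler_wpM2r.
Qed.

Lemma cabs_signz (n : int) : cabs ((-1) ^ n : R[i]) = 1.
Proof.
have h k : cabs ((-1) ^+ k : R[i]) = 1 by rewrite cabsX cabsN cabs1 expr1n.
case: n => k; first exact: h.
by rewrite NegzE -exprnN cabsV h invr1.
Qed.

Lemma cabs_int (n : int) : cabs (n%:~R : R[i]) = `|n|%N%:R.
Proof.
by case: n => k; rewrite ?NegzE ?mulrNz ?cabsN ?abszN; exact: cabs_nat.
Qed.

Definition tc (n : int) : R[i] := (-1) ^ n * q ^+ trin n.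
Definition tnu (n : int) : R[i] := n%:~R + 2^-1.

Lemma cabs_tc n : cabs (tc n) = cabs q ^+ trin n.
Proof. by rewrite /tc cabsM cabs_signz mul1r cabsX. Qed.

Lemma cabs_half : cabs (2^-1 : R[i]) = 2^-1.
Proof. by rewrite cabsV cabs_nat. Qed.

Lemma theta_summable : exp_summable tc tnu.
Proof.
apply: (@gauss_exp_summable _ _ 1 1) => // n; first by rewrite cabs_tc.
rewrite /tnu mul1r; apply: (le_trans (cabsD _ _)); rewrite cabs_int cabs_half lerD2l.
lra.
Qed.

Lemma tc_summ : summ tc.
Proof.
have := expsum_summ theta_summable 0.
by apply: eq_summ => n; rewrite mulr0 expc0 mulr1.
Qed.

Lemma signzS (n : int) : ((-1) ^ (n + 1) : R[i]) = - (-1) ^ n.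
Proof.
rewrite expfzDr ?oppr_eq0 ?oner_eq0//.
by rewrite expr1z mulrN1.
Qed.

Lemma trinS (n : int) : (trin (n + 1) : int) = (trin n : int) + (n + 1).
Proof.
have := trinE n; have := trinE (n + 1); rewrite !PoszM => h1 h2.
have : 2 * (trin (n + 1) : int) = 2 * ((trin n : int) + (n + 1)) by rewrite mulrDr h1 h2; ring.
by lia.
Qed.

Lemma tcS n : tc (n + 1) = - q ^ (n + 1) * tc n.
Proof.
rewrite /tc signzS (exprnP q (trin (n + 1))) trinS expfzDr ?q_neq0//.
by rewrite -exprnP; ring.
Qed.

(** [n] and [-1 - n] share their triangular number but have opposite parities and opposite
    frequencies [tnu]; this makes [Theta] odd and [dTheta] even. *)
Lemma tc_reflect n : tc (-1 - n) = - tc n.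
Proof.
rewrite /tc; have -> : trin (-1 - n) = trin n.
  have := trinE n; have := trinE (-1 - n); rewrite !PoszM => h1 h2.
  have : 2 * (trin (-1 - n) : int) = 2 * (trin n : int) by rewrite h1 h2; ring.
  by lia.
rewrite -mulNr; congr (_ * _).
rewrite expfzDr ?oppr_eq0 ?oner_eq0// -[in LHS](opprK n) opprK.
have e : ((-1) ^ (- n) : R[i]) = (-1) ^ n.
  by case: n => k; rewrite ?NegzE ?opprK -exprnN invr_sign.
by rewrite e exprN1 invrN invr1 mulN1r.
Qed.

Definition Theta z := expsum tc tnu z.
Definition dTheta z := expsum (fun n => tc n * tnu n) tnu z.

Lemma ThetaE z : Theta z = csum (fun n => tc n * expc (tnu n * z)).
Proof. by []. Qed.

Lemma dThetaE z : dTheta z = csum (fun n => tc n * tnu n * expc (tnu n * z)).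
Proof. by []. Qed.

Lemma Theta_entire : entire Theta.
Proof. exact: expsum_entire theta_summable. Qed.

Lemma Theta_Cder z : Cder Theta z (dTheta z).
Proof. exact: expsum_Cder theta_summable z. Qed.

Lemma dTheta_entire : entire dTheta.
Proof.
apply: expsum_entire => r.
apply: fsumm_le (theta_summable (r + 1)) => n.
rewrite cabsM -mulrA ler_wpM2l ?cabs_ge0// mulrDr mulr1 expRD mulrC ler_wpM2l ?expR_ge0//.
by apply: le_trans (expR_ge1Dx _); rewrite lerDr.
Qed.

Lemma Theta_odd z : Theta (- z) = - Theta z.
Proof.
rewrite /Theta /expsum (csum_reflect _ (-1)) -csumN; last exact: expsum_summ theta_summable z.
apply: eq_csum => n; rewrite tc_reflect /tnu intrB mulNr; congr (- (_ * expc _)).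
by field.
Qed.

Lemma Theta0 : Theta 0 = 0.
Proof.
have := Theta_odd 0; rewrite oppr0 => h.
have : 2 * Theta 0 = 0 by rewrite mulr_natl mulr2n {1}h addNr.
by move=> /eqP; rewrite mulf_eq0 pnatr_eq0/= => /eqP.
Qed.

Lemma tc_sum0 : csum tc = 0.
Proof.
rewrite -Theta0; apply: eq_csum => n; by rewrite mulr0 expc0 mulr1.
Qed.

Lemma Theta_period z : Theta (z + period) = - expc (- period / 2 - z) * Theta z.
Proof.
rewrite /Theta /expsum -csumZ; last exact: expsum_summ theta_summable z.
rewrite [RHS](csum_shift _ 1); apply: eq_csum => n.
rewrite tcS qz.
have -> : tnu n * (z + period) = (- period / 2 - z) + ((n + 1)%:~R * period + tnu (n + 1) * z).
  by rewrite /tnu intrD; field.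
by rewrite !expcD; ring.
Qed.

Lemma Theta_twopii z : Theta (z + twopii R) = - Theta z.
Proof.
rewrite /Theta /expsum -csumN; last exact: expsum_summ theta_summable z.
apply: eq_csum => n; rewrite -mulrN; congr (_ * _).
have -> : tnu n * (z + twopii R) = tnu n * z + (twopii R * n%:~R + twopii R / 2).
  by rewrite /tnu; field.
rewrite !expcD expc_twopii_int mul1r -[RHS]mulrN1; congr (_ * _).
exact: expc_half.
Qed.

(** Only the shape of the multiplier is kept, a nonzero constant times an exponential. Translations
    with such a multiplier form a group, so the two generators [twopii R] and [period] suffice. *)
Lemma Theta_lattice_shift l : in_lattice tau l ->
  exists C d : R[i], C != 0 /\ forall z, Theta (z + l) = C * expc (d * z) * Theta z.
Proof.
pose P l := exists C d : R[i], C != 0 /\ forall z, Theta (z + l) = C * expc (d * z) * Theta z.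
have Pn l1 : P l1 -> P (- l1).
  move=> [C [d [C0 h]]]; exists (C^-1 * expc (d * l1)), (- d).
  rewrite mulf_neq0 ?invr_neq0 ?expc_neq0//; split=> // z.
  have := h (z - l1); rewrite subrK => ->; rewrite mulrBr mulNr expcB !expcN.
  by field; rewrite C0 !expc_neq0.
have Pa l1 l2 : P l1 -> P l2 -> P (l1 + l2).
  move=> [C [d [C0 h]]] [C' [d' [C0' h']]].
  exists (C * C' * expc (d' * l1)), (d + d').
  split=> [|z]; first by rewrite mulf_neq0 ?expc_neq0// mulf_neq0.
  by rewrite addrA h' h mulrDr mulrDl !expcD; ring.
have P0 : P 0.
  by exists 1, 0; split=> [|z]; rewrite ?oner_eq0// addr0 mul0r expc0 !mul1r.
have Pz l1 (n : int) : P l1 -> P (n%:~R * l1).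
  move=> pl; have pk (k : nat) : P (k%:R * l1).
    by elim: k => [|k IH]; [rewrite mul0r|rewrite -natr1 mulrDl mul1r; exact: Pa].
  case: n => k; first exact: pk.
  by rewrite NegzE mulrNz mulNr; apply: Pn; exact: pk.
have P1 : P (twopii R).
  exists (-1), 0; rewrite oppr_eq0 oner_eq0; split=> // z.
  by rewrite Theta_twopii mul0r expc0 mulr1 mulN1r.
have P2 : P period.
  exists (- expc (- period / 2)), (-1); rewrite oppr_eq0 expc_neq0; split=> // z.
  by rewrite Theta_period expcD !mulNr mul1r.
move=> [m [n ->]].
have -> : twopii R * (m%:~R + n%:~R * tau) = m%:~R * twopii R + n%:~R * period.
  by rewrite /period; ring.
by apply: Pa; exact: Pz.
Qed.

Definition ca (i : int) : R[i] := q ^ (i * i).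
Definition cb (j : int) : R[i] := q ^ (j * j + j).
(** Up to a factor q^(1/4) for [thetaB], [thetaA] and [thetaB] are the theta series of first
    characteristic 0 and 1/2 at the doubled arguments (2 x, 2 tau). *)
Definition thetaA x := expsum ca (fun i => 2 * i%:~R) x.
Definition thetaB x := expsum cb (fun j => 2 * j%:~R + 1) x.

Lemma cabs_qz_le (n : int) (k : nat) : (k : int) <= n -> cabs (q ^ n) <= cabs q ^+ k.
Proof.
case: n => // m; rewrite lez_nat => km; rewrite -exprnP cabsX.
by apply: ler_wiXn2l; rewrite ?cabs_ge0// ltW// cabs_q_lt1.
Qed.

Lemma ca_summable : exp_summable ca (fun i => 2 * i%:~R).
Proof.
apply: (@gauss_exp_summable _ _ 2 0) => // n.
  by apply: cabs_qz_le; have := trinE n; nia.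
by rewrite cabsM cabs_nat cabs_int addr0.
Qed.

Lemma cb_summable : exp_summable cb (fun j => 2 * j%:~R + 1).
Proof.
apply: (@gauss_exp_summable _ _ 2 1) => // n.
  by apply: cabs_qz_le; have := trinE n; nia.
by apply: (le_trans (cabsD _ _)); rewrite cabsM cabs_nat cabs_int cabs1.
Qed.

(** The term [(m, n)] of Theta (x + y) Theta (x - y) has frequency m + n + 1 in x and m - n in y,
    exactly one of which is odd. The new indices make the even one 2 i and the odd one 2 j + 1; the
    boolean is true when the odd one belongs to x. *)
Definition split_e (p : bool * (int * int)) : int * int :=
  let: (b, (i, j)) := p in if b then (i + j, j - i) else (i + j, i - j - 1).
Definition split_e' (p : int * int) : bool * (int * int) :=
  let: (m, n) := p in
  if ((m - n) %% 2)%Z == 0 then (true, (((m - n) %/ 2)%Z, ((m + n) %/ 2)%Z))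
  else (false, (((m + n + 1) %/ 2)%Z, ((m - n - 1) %/ 2)%Z)).

Lemma split_eK : cancel split_e split_e'.
Proof.
case=> -[] [i j] /=; rewrite /split_e'.
- rewrite ifT; last by apply/eqP; lia.
  by congr (_, (_, _)); lia.
- rewrite ifF; last by apply/negbTE/eqP; lia.
  by congr (_, (_, _)); lia.
Qed.

Lemma split_eK' : cancel split_e' split_e.
Proof.
case=> m n; rewrite /split_e'; case: ifPn => /eqP h /=; congr (_, _); lia.
Qed.

Lemma tcM (a b : int) :
  tc a * tc b = (-1) ^ (a + b) * q ^ ((trin a : int) + (trin b : int)).
Proof.
by rewrite !expfzDr ?q_neq0 ?oppr_eq0 ?oner_eq0// /tc mulrACA.
Qed.

Lemma signz_double (j : int) : ((-1) ^ (j + j) : R[i]) = 1.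
Proof.
by rewrite expfzDr ?oppr_eq0 ?oner_eq0// -expfzMl mulrNN mulr1 exp1rz.
Qed.

Lemma Theta_bilinear x y :
  Theta (x + y) * Theta (x - y) = thetaB x * thetaA y - thetaA x * thetaB y.
Proof.
have s1 := expsum_summ theta_summable (x + y).
have s2 := expsum_summ theta_summable (x - y).
pose f (p : int * int) := tc p.1 * expc (tnu p.1 * (x + y)) *
  (tc p.2 * expc (tnu p.2 * (x - y))).
have sf : summ f by exact: summ_prod s1 s2.
have -> : Theta (x + y) * Theta (x - y) = csum f by exact: csum_prod s1 s2.
have sfe : summ (f \o split_e) by apply/(summ_bij f split_eK split_eK').
rewrite (csum_bij f split_eK split_eK').
have st : summ (fun p => (f \o split_e) (true, p)).
  by apply: (summ_comp (e := fun p => (true, p)) _ sfe) => a b [].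
have sn : summ (fun p => (f \o split_e) (false, p)).
  by apply: (summ_comp (e := fun p => (false, p)) _ sfe) => a b [].
have [_ ->] := csum_bool st sn.
have sA z := expsum_summ ca_summable z; have sB z := expsum_summ cb_summable z.
(* In both classes the exponents of [q] add up to i^2 + (j^2 + j), which separates the variables,
   while the sign (-1)^(m + n) is constant on each class. *)
have tq (i j : int) : (trin (i + j) : int) + (trin (j - i) : int) = i * i + (j * j + j).
  by have := trinE (i + j); have := trinE (j - i); nia.
have tq' (i j : int) : (trin (i + j) : int) + (trin (i - j - 1) : int) = i * i + (j * j + j).
  by have := trinE (i + j); have := trinE (i - j - 1); nia.
congr (_ + _).
- rewrite mulrC /thetaA /thetaB /expsum csum_prod//; apply: eq_csum => -[i j] /=.
  rewrite /f /= mulrACA tcM tq.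
  have -> : i + j + (j - i) = j + j by ring.
  rewrite signz_double mul1r -expcD.
  have -> : tnu (i + j) * (x + y) + tnu (j - i) * (x - y) =
      2 * i%:~R * y + (2 * j%:~R + 1) * x.
    by rewrite /tnu intrB intrD; field.
  by rewrite expcD /ca /cb expfzDr ?q_neq0//; ring.
- rewrite /thetaA /thetaB /expsum csum_prod// -csumN; last exact: (summ_prod (sA x) (sB y)).
  apply: eq_csum => -[i j] /=; rewrite /f /= mulrACA tcM tq'.
  have -> : i + j + (i - j - 1) = (i - 1) + (i - 1) + 1 by ring.
  rewrite signzS signz_double.
  rewrite mulN1r mulNr -expcD; congr (- _).
  have -> : tnu (i + j) * (x + y) + tnu (i - j - 1) * (x - y) =
      2 * i%:~R * x + (2 * j%:~R + 1) * y.
    by rewrite /tnu !intrB intrD; field.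
  by rewrite expcD /ca /cb expfzDr ?q_neq0//; ring.
Qed.

(** Write [X, Y] for the minor B(X) A(Y) - A(X) B(Y). The half-sums below turn the claim into the
    Pluecker relation [X, Y] [U, V] = [X, U] [Y, V] - [X, V] [Y, U]. *)
Lemma Theta_three_term (s x1 x2 y1 y2 : R[i]) :
  Theta (x1 + x2 - y1 - y2 + s) * Theta s * Theta (x1 - x2) * Theta (y2 - y1) =
  Theta (x1 - y1 + s) * Theta (x2 - y2 + s) * Theta (x1 - y2) * Theta (x2 - y1) -
  Theta (x1 - y2 + s) * Theta (x2 - y1 + s) * Theta (x1 - y1) * Theta (x2 - y2).
Proof.
have br (a b X Y : R[i]) : a = X + Y -> b = X - Y ->
    Theta a * Theta b = thetaB X * thetaA Y - thetaA X * thetaB Y.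
  by move=> -> ->; exact: Theta_bilinear.
pose X := (x1 + x2 - y1 - y2) / 2 + s; pose Y := (x1 + x2 - y1 - y2) / 2.
pose U := (x1 - x2 + y2 - y1) / 2; pose V := (x1 - x2 - y2 + y1) / 2.
rewrite -!(mulrA (Theta _ * Theta _) (Theta _) (Theta _)).
rewrite (br _ _ X Y); [|by rewrite /X /Y; field|by rewrite /X /Y; field].
rewrite (br _ _ U V); [|by rewrite /U /V; field|by rewrite /U /V; field].
rewrite (br _ _ X U); [|by rewrite /X /U; field|by rewrite /X /U; field].
rewrite (br _ _ Y V); [|by rewrite /Y /V; field|by rewrite /Y /V; field].
rewrite (br _ _ X V); [|by rewrite /X /V; field|by rewrite /X /V; field].
rewrite (br _ _ Y U); [|by rewrite /Y /U; field|by rewrite /Y /U; field].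
move: (thetaA X) (thetaA Y) (thetaA U) (thetaA V) => a1 a2 a3 a4.
move: (thetaB X) (thetaB Y) (thetaB U) (thetaB V) => b1 b2 b3 b4.
ring.
Qed.

End Theta.

Global Opaque Theta dTheta.

(** * Kronecker's formula *)

Section Kronecker.
Variables (R : realType) (tau : R[i]).
Hypothesis htau : 0 < complex.Im tau.
Local Notation q := (q tau).
Local Notation tc := (tc tau).
Local Notation period := (period tau).
Local Notation width := (width tau).
Local Notation Theta := (Theta tau).
Local Notation dTheta := (dTheta tau).

Lemma tends_bounded (u : nat -> R[i]) l : tends \oo u l ->
  exists2 C : R, 0 <= C & forall n, cabs (u n) <= C.
Proof.
move=> /(_ 1 ltr01) [N _ h].
exists (cabs l + 1 + \sum_(k < N) cabs (u k)).
  by rewrite addr_ge0// ?sumr_ge0// => [|k _]; rewrite ?cabs_ge0// addr_ge0 ?cabs_ge0.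
move=> n; have [Nn|nN] := leqP N n.
  have := h n Nn; have := cabsD (u n - l) l; rewrite subrK => h1 h2.
  have : 0 <= \sum_(k < N) cabs (u k) by apply: sumr_ge0 => k _; exact: cabs_ge0.
  lra.
rewrite (bigD1 (Ordinal nN))//=.
have : 0 <= \sum_(k < N | k != Ordinal nN) cabs (u k).
  by apply: sumr_ge0 => k _; exact: cabs_ge0.
by have := cabs_ge0 l; lra.
Qed.

Lemma tends_geo (x : R[i]) : cabs x < 1 -> tends \oo (fun n => x ^+ n) 0.
Proof.
move=> x1 e e0.
have x0 : `|cabs x| < 1 by rewrite ger0_norm ?cabs_ge0.
have := cvg_expr x0 => /cvgrPdistC_le /(_ e e0) [N _ h].
exists N => // n Nn; have := h n Nn => /=.
by rewrite !subr0 cabsX ger0_norm// exprn_ge0// cabs_ge0.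
Qed.

Section FixedS.
Variable s : R[i].
Hypothesis hs : forall n : int, expc s * q ^ n != 1.

Definition kd (n : int) : R[i] := (1 - expc s * q ^ n)^-1.

Lemma kd_neq0 n : 1 - expc s * q ^ n != 0.
Proof. by rewrite subr_eq0 eq_sym hs. Qed.

(** Towards +oo the denominators tend to 1; at n = - k, pulling out q^(- k) leaves a factor q^k with
    a bounded coefficient. This asymmetry makes Kronecker's series converge in a strip to the left
    of 0. *)
Lemma kd_bound : exists2 C : R, 0 <= C &
  (forall k : nat, cabs (kd (Posz k)) <= C) /\
  (forall k : nat, cabs (kd (Negz k)) <= C * cabs q ^+ k.+1).
Proof.
have tq := tends_geo (cabs_q_lt1 htau).
have h1 : tends \oo (fun k : nat => kd (Posz k)) (1 - expc s * 0)^-1.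
  apply: tendsV; first by rewrite mulr0 subr0 oner_eq0.
  by apply: tendsB (tends_cst _) _; apply: tendsM (tends_cst _) tq.
have h2 : tends \oo (fun k : nat => (q ^+ k - expc s)^-1) (0 - expc s)^-1.
  apply: tendsV; first by rewrite sub0r oppr_eq0 expc_neq0.
  by apply: tendsB tq (tends_cst _).
have [C1 C10 b1] := tends_bounded h1; have [C2 C20 b2] := tends_bounded h2.
exists (C1 + C2); first exact: addr_ge0.
split=> k; first by apply: (le_trans (b1 k)); rewrite lerDl.
have -> : kd (Negz k) = (q ^+ k.+1 - expc s)^-1 * q ^+ k.+1.
  rewrite /kd NegzE -exprnN; apply: (mulfI (kd_neq0 (Negz k))).
  rewrite NegzE -exprnN mulfV; last by have := kd_neq0 (Negz k); rewrite NegzE -exprnN.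
  have qk : q ^+ k.+1 != 0 by rewrite expf_neq0// q_neq0.
  have := kd_neq0 (Negz k); rewrite NegzE -exprnN => h.
  have h' : q ^+ k.+1 - expc s != 0.
    have -> : q ^+ k.+1 - expc s = q ^+ k.+1 * (1 - expc s * q ^- k.+1) by field.
    by rewrite mulf_neq0.
  by field; rewrite h' qk.
rewrite cabsM cabsX ler_wpM2r ?exprn_ge0 ?cabs_ge0//.
by apply: (le_trans (b2 _)); rewrite lerDr.
Qed.

Lemma kd_bounded : exists2 C : R, 0 <= C & forall n, cabs (kd n) <= C.
Proof.
have [C C0 [h1 h2]] := kd_bound; exists C => // -[k|k]; first exact: h1.
apply: (le_trans (h2 k)); rewrite ler_piMr// exprn_ile1// ?cabs_ge0//.
by rewrite ltW// cabs_q_lt1.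
Qed.

Lemma summ_kdM (u : int -> R[i]) : summ u -> summ (fun n => u n * kd n).
Proof.
move=> su; have [C C0 h] := kd_bounded.
have [s1 _] := fsummZ C0 (fun n => cabs_ge0 (u n)) ((summE _).1 su).
by apply: summ_le s1 => n; rewrite cabsM mulrC ler_wpM2r// cabs_ge0.
Qed.

Definition Kr z : R[i] := csum (fun n : int => expc (n%:~R * z) * kd n).

Lemma Kr_summ z : - width < complex.Re z < 0 ->
  summ (fun n : int => expc (n%:~R * z) * kd n).
Proof.
move=> /andP[z1 z2]; have [C C0 [h1 h2]] := kd_bound.
have ez : cabs (expc z) < 1 by rewrite cabs_expc -expR0 ltr_expR.
have qz1 : cabs (q / expc z) < 1.
  by rewrite qE -expcB cabs_expc -expR0 ltr_expR raddfB/= Re_period; lra.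
have [||su _] := @csum_int _ (fun n : int => expc (n%:~R * z) * kd n); last exact: su.
- have cz : 0 <= cabs (expc z) < 1 by rewrite cabs_ge0.
  have [sg _] := fsummZ C0 (fun k => exprn_ge0 k (cabs_ge0 (expc z))) (fsumm_geo cz).
  apply: summ_le sg => k; rewrite expcMn cabsM cabsX mulrC ler_wpM2r//.
  by rewrite exprn_ge0// cabs_ge0.
- have cg : 0 <= cabs (q / expc z) < 1 by rewrite cabs_ge0.
  have cC : 0 <= C * cabs (q / expc z) by rewrite mulr_ge0// cabs_ge0.
  have [sg _] := fsummZ cC (fun k => exprn_ge0 k (cabs_ge0 (q / expc z))) (fsumm_geo cg).
  apply: summ_le sg => k; rewrite NegzE mulrNz mulNr expcN expcMn cabsM cabsV cabsX.
  rewrite -mulrA -exprS cabsM cabsV exprMn exprVn.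
  have ek : 0 <= (cabs (expc z) ^+ k.+1)^-1 by rewrite invr_ge0 exprn_ge0// cabs_ge0.
  apply: (@le_trans _ _ ((cabs (expc z) ^+ k.+1)^-1 * (C * cabs q ^+ k.+1))).
    by rewrite ler_wpM2l// -NegzE.
  by rewrite le_eqVlt; apply/orP; left; apply/eqP; ring.
Qed.

(** [Theta] stripped of exp (z / 2): a Laurent series in exp z, whose product with [Kr] is a
    convolution over the integers. *)
Definition th z := expsum tc (fun n => n%:~R) z.

Lemma th_summable : exp_summable tc (fun n => n%:~R).
Proof.
apply: (@gauss_exp_summable _ _ htau _ _ 1 0) => // n; first by rewrite cabs_tc.
by rewrite cabs_int mul1r addr0.
Qed.

Lemma Theta_th z : Theta z = expc (z / 2) * th z.
Proof.
rewrite ThetaE /th /expsum -csumZ; last exact: expsum_summ th_summable z.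
apply: eq_csum => n.
have -> : tnu R n * z = z / 2 + n%:~R * z by rewrite /tnu; field.
by rewrite expcD; ring.
Qed.

(** The coefficient of exp (N z) in [th z * Kr z]. *)
Definition kg (N : int) : R[i] := csum (fun n => tc (N - n) * kd n).

Lemma kg_summ N : summ (fun n => tc (N - n) * kd n).
Proof. exact: summ_kdM (summ_reflect N (tc_summ htau)). Qed.

(* The recurrence c (n + 1) = - q ^ (n + 1) c n passes to the convolution with
   1 / (1 - t q ^ n) up to the term th 0 = 0. *)
Lemma kg_rec N : kg (N + 1) = - (expc s * q ^ (N + 1)) * kg N.
Proof.
have e n : tc (N + 1 - n) * kd n =
    tc (N + 1 - n) + (- (expc s * q ^ (N + 1))) * (tc (N - n) * kd n).
  have -> : N + 1 - n = N - n + 1 by ring.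
  have E : q ^ (N - n + 1) * q ^ n = q ^ (N + 1).
    by rewrite -expfzDr ?q_neq0//; congr (_ ^ _); ring.
  rewrite (tcS htau) -E /kd; have := kd_neq0 n; set a := q ^ n; set b := q ^ (N - n + 1).
  by move=> h; field.
rewrite /kg (eq_csum e) csumD; last 2 first.
- exact: summ_reflect (tc_summ htau).
- by apply: summZ; exact: kg_summ.
rewrite csumZ; last exact: kg_summ.
by rewrite -csum_reflect tc_sum0// add0r.
Qed.

Lemma kg_sol N : kg N = expc s ^ N * tc N * kg 0.
Proof.
have nz n : - (expc s * q ^ n) != 0.
  by rewrite oppr_eq0 mulf_neq0 ?expc_neq0// expfz_neq0// q_neq0.
(* The multiplier of the recurrence never vanishes, so it can be run downwards to the negative
   indices too. *)
have step n : kg n = expc s ^ n * tc n * kg 0 <->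
    kg (n + 1) = expc s ^ (n + 1) * tc (n + 1) * kg 0.
  have es : expc s ^ (n + 1) = expc s ^ n * expc s.
    by rewrite expfzDr ?expc_neq0// expr1z.
  rewrite kg_rec (tcS htau) es.
  have -> : expc s ^ n * expc s * (- q ^ (n + 1) * tc n) * kg 0 =
    - (expc s * q ^ (n + 1)) * (expc s ^ n * tc n * kg 0) by ring.
  by split=> [->//|]; move/(mulfI (nz _)).
have tc0 : tc 0 = 1 by rewrite /tc expr0z mul1r expr0.
have base : kg 0 = expc s ^ 0 * tc 0 * kg 0 by rewrite expr0z tc0 !mul1r.
case: N => k.
  elim: k => [//|k IH]; have := (step (Posz k)).1 IH.
  by rewrite -PoszD addn1.
elim: k => [|k IH].
  by apply/step; rewrite (_ : Negz 0 + 1 = 0)//.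
by apply/step; rewrite (_ : Negz k.+1 + 1 = Negz k)// !NegzE -addn1 PoszD; ring.
Qed.

Lemma th_Kr z : - width < complex.Re z < 0 -> th z * Kr z = kg 0 * th (z + s).
Proof.
move=> hz; have sK := Kr_summ hz; have st := expsum_summ th_summable z.
rewrite /th /expsum /Kr csum_prod//.
pose f (p : int * int) := tc p.1 * expc (p.1%:~R * z) * (expc (p.2%:~R * z) * kd p.2).
pose e (p : int * int) := (p.1 - p.2, p.2); pose e' (p : int * int) := (p.1 + p.2, p.2).
have c1 : cancel e e' by case=> a b; rewrite /e /e'/= subrK.
have c2 : cancel e' e by case=> a b; rewrite /e /e'/= addrK.
have sf : summ f by exact: summ_prod st sK.
rewrite -/f (csum_bij f c1 c2) csum_pair; last by apply/(summ_bij f c1 c2).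
rewrite -csumZ; last by have := expsum_summ th_summable (z + s).
apply: eq_csum => N.
transitivity (expc (N%:~R * z) * kg N).
  rewrite /kg -csumZ; last exact: kg_summ.
  apply: eq_csum => n; rewrite /f /e /=.
  have -> : N%:~R * z = (N - n)%:~R * z + n%:~R * z by rewrite intrB; ring.
  by rewrite expcD; ring.
by rewrite kg_sol mulrDr expcD [expc (N%:~R * s)]expcMz; ring.
Qed.

(** The terms of index k + 1 and - k - 1 of [Kr] together, with the limit 1 of [kd] at +oo removed.
    The removed part is a geometric series and carries the pole at 0; the rest converges on both
    sides of 0. *)
Definition rho z (k : nat) : R[i] :=
  expc z ^+ k.+1 * (kd (Posz k.+1) - 1) + expc (- z) ^+ k.+1 * kd (Negz k).

Definition Krest z : R[i] := csum (rho z).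

Lemma kd_sub1 n : kd n - 1 = expc s * q ^ n * kd n.
Proof. by rewrite /kd; have := kd_neq0 n => h; field. Qed.

Lemma rho_bound : exists2 C : R, 0 <= C & forall z, - (width / 2) <= complex.Re z <= width / 2 ->
  forall k, cabs (rho z k) <= C * expR (- (width / 2)) ^+ k.+1.
Proof.
have [C C0 [h1 h2]] := kd_bound.
exists (C * cabs (expc s) + C).
  by rewrite addr_ge0// mulr_ge0// cabs_ge0.
move=> z /andP[z1 z2] k.
have qp : cabs q = expR (- (width / 2)) * expR (- (width / 2)).
  by rewrite cabs_q -expRD; congr expR; lra.
have b1 : cabs (expc z) * cabs q <= expR (- (width / 2)).
  by rewrite cabs_expc cabs_q -expRD ler_expR; lra.
have b2 : cabs (expc (- z)) * cabs q <= expR (- (width / 2)).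
  by rewrite cabs_expc cabs_q -expRD ler_expR raddfN/=; lra.
have pw (a b : R) : 0 <= a -> a <= b -> a ^+ k.+1 <= b ^+ k.+1.
  by move=> a0 ab; rewrite lerXn2r ?nnegrE// (le_trans a0).
apply: (le_trans (cabsD _ _)); rewrite mulrDl; apply: lerD.
  rewrite kd_sub1 -exprnP cabsM cabsX cabsM [cabs (expc s * _)]cabsM cabsX.
  apply: (@le_trans _ _ ((C * cabs (expc s)) * ((cabs (expc z) * cabs q) ^+ k.+1))).
    rewrite exprMn; have := h1 k.+1; set a := cabs (kd _) => ha.
    have -> : cabs (expc z) ^+ k.+1 * (cabs (expc s) * cabs q ^+ k.+1 * a) =
      (cabs (expc s) * (cabs (expc z) ^+ k.+1 * cabs q ^+ k.+1)) * a by ring.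
    have -> : C * cabs (expc s) * (cabs (expc z) ^+ k.+1 * cabs q ^+ k.+1) =
      (cabs (expc s) * (cabs (expc z) ^+ k.+1 * cabs q ^+ k.+1)) * C by ring.
    by rewrite ler_wpM2l// !mulr_ge0// ?exprn_ge0// cabs_ge0.
  rewrite ler_wpM2l ?mulr_ge0 ?cabs_ge0//.
  by apply: pw b1; rewrite mulr_ge0 ?cabs_ge0.
rewrite cabsM cabsX.
apply: (@le_trans _ _ (C * (cabs (expc (- z)) * cabs q) ^+ k.+1)).
  rewrite exprMn mulrCA ler_wpM2l ?exprn_ge0 ?cabs_ge0//.
rewrite ler_wpM2l//; apply: pw b2; by rewrite mulr_ge0 ?cabs_ge0.
Qed.

Lemma half_geo : fsumm (fun k => expR (- (width / 2)) ^+ k.+1).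
Proof.
have w0 := width_gt0 htau.
have h : 0 <= expR (- (width / 2)) < 1.
  by rewrite expR_ge0 expR_lt1; lra.
have [sg _] := fsummZ (expR_ge0 (- (width / 2))) (fun k => exprn_ge0 k (expR_ge0 (- (width / 2)))) (fsumm_geo h).
by apply: fsumm_le sg => k; rewrite exprS.
Qed.

Lemma Krest_bound : exists2 C : R, 0 <= C & forall z,
  - (width / 2) <= complex.Re z <= width / 2 -> cabs (Krest z) <= C.
Proof.
have [C C0 h] := rho_bound.
have g0 k : 0 <= expR (- (width / 2)) ^+ k.+1 by rewrite exprn_ge0// expR_ge0.
have [sg lg] := fsummZ C0 g0 half_geo.
exists (C * nsum (fun k => expR (- (width / 2)) ^+ k.+1)).
  by rewrite mulr_ge0// nsum_ge0.
by move=> z hz; apply: le_trans lg; apply: cabs_csum_le => // k; exact: h.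
Qed.

Lemma geo_csum (x : R[i]) : cabs x < 1 ->
  summ (fun k => x ^+ k.+1) /\ csum (fun k => x ^+ k.+1) = x / (1 - x).
Proof.
move=> x1.
have s0 : summ (fun k => x ^+ k).
  by apply: summ_le (fsumm_geo (_ : 0 <= cabs x < 1)) => [k|]; rewrite ?cabsX ?cabs_ge0.
have [s1 E] := csum_natS s0; split=> //.
have E2 : csum (fun k => x ^+ k.+1) = x * csum (fun k => x ^+ k).
  by rewrite -csumZ//; apply: eq_csum => k; rewrite exprS.
have n1 : 1 - x != 0.
  by rewrite subr_eq0; apply: contraTneq x1 => <-; rewrite cabs1 ltxx.
move: E; rewrite expr0 E2 => E.
have -> : csum (fun k => x ^+ k) = (1 - x)^-1; last by [].
apply: (mulIf n1); rewrite mulVf// mulrBr mulr1 {1}E; ring.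
Qed.

Lemma Kr_split z : - (width / 2) <= complex.Re z < 0 ->
  Kr z = kd 0 + expc z / (1 - expc z) + Krest z.
Proof.
move=> /andP[z1 z2]; have w0 := width_gt0 htau.
have hz : - width < complex.Re z < 0 by rewrite z2 andbT; lra.
have sK := Kr_summ hz; have [sp sn] := summ_int sK.
have [_ E] := csum_int (u := fun n : int => expc (n%:~R * z) * kd n) sp sn.
rewrite /Kr E.
have [sp1 ->] := csum_natS sp.
rewrite mul0r expc0 mul1r -!addrA; congr (_ + _).
have ez : cabs (expc z) < 1 by rewrite cabs_expc -expR0 ltr_expR.
have [sg <-] := geo_csum ez.
have sr : summ (rho z).
  have [C C0 h] := rho_bound.
  have g0 k : 0 <= expR (- (width / 2)) ^+ k.+1 by rewrite exprn_ge0// expR_ge0.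
  have [sgg _] := fsummZ C0 g0 half_geo.
  by apply: summ_le sgg; apply: h; apply/andP; split; lra.
rewrite -csumD// /Krest -csumD//; apply: eq_csum => k.
rewrite /rho expcMn NegzE mulrNz mulNr -mulrN expcMn; ring.
Qed.

(** Kronecker's formula is available for [- width < Re z < 0]. Limits at 0, in [z] as well as in
    [s], are therefore taken along these real points of the strip. *)
Definition zn (n : nat) : R[i] := (- (width / 2) / n.+1%:R)%:C.

Lemma zn_Re n : - (width / 2) <= complex.Re (zn n) < 0.
Proof.
have w0 := width_gt0 htau.
have n0 : 0 < n.+1%:R :> R by rewrite ltr0n.
have n1 : 1 <= n.+1%:R :> R by rewrite ler1n.
rewrite /= mulNr lerN2 oppr_lt0 divr_gt0 ?andbT//; last by lra.
by rewrite ler_pdivrMr// ler_peMr//; lra.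
Qed.

Lemma zn_neq0 n : zn n != 0.
Proof.
by have /andP[_] := zn_Re n; apply: contraTneq => ->; rewrite ltxx.
Qed.

Lemma zn_tends : tends \oo zn 0.
Proof.
rewrite -(_ : (0 : R)%:C = 0 :> R[i])//; apply: real_tends.
have -> : (fun n : nat => - (width / 2) / n.+1%:R) = (fun n => (- (width / 2)) * (harmonic n)).
  by apply/funext => n.
by rewrite -[X in _ --> X](mulr0 (- (width / 2))); apply: cvgM; [exact: cvg_cst|exact: cvg_harmonic].
Qed.

Lemma expc_tends z : tends (nbhs z) (@expc R) (expc z).
Proof. exact: Cder_tends (Cder_expc z). Qed.

Lemma tends_zn (f : R[i] -> R[i]) (l : R[i]) : tends (nbhs (0 : R[i])) f l -> tends \oo (fun n => f (zn n)) l.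
Proof.
by move=> fl; apply: tends_comp fl; exact: tends_nbhs zn_tends _.
Qed.

Lemma Kr_residue : tends \oo (fun n => (1 - expc (zn n)) * Kr (zn n)) 1.
Proof.
have [C C0 hC] := Krest_bound.
have e1 : tends \oo (fun n => expc (zn n)) 1.
  by rewrite -(expc0 R); apply: tends_zn; exact: expc_tends.
have e0 : tends \oo (fun n => 1 - expc (zn n)) 0.
  by rewrite -(subrr 1); exact: tendsB (tends_cst _) e1.
have r0 : tends \oo (fun n => (1 - expc (zn n)) * Krest (zn n)) 0.
  move=> e ep; have ec : 0 < e / (C + 1) by rewrite divr_gt0// ltr_wpDl.
  apply: filterS (e0 _ ec) => n; rewrite !subr0 cabsM => h.
  apply: (@le_trans _ _ (e / (C + 1) * (C + 1))); last by rewrite divfK// gt_eqF// ltr_wpDl.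
  apply: ler_pM; rewrite ?cabs_ge0//.
  apply: (@le_trans _ _ C); last by rewrite lerDl.
  have w0 := width_gt0 htau.
  by apply: hC; have /andP[h1 h2] := zn_Re n; apply/andP; split; lra.
have -> : (1 : R[i]) = 0 * kd 0 + 1 + 0 by ring.
apply: tends_ext (tendsD (tendsD (tendsM e0 (tends_cst (kd 0))) e1) r0) => n.
rewrite Kr_split ?zn_Re//.
have n0 : 1 - expc (zn n) != 0.
  rewrite subr_eq0; have /andP[_ h] := zn_Re n.
  have : cabs (expc (zn n)) < 1 by rewrite cabs_expc -expR0 ltr_expR.
  by apply: contraTneq => <-; rewrite cabs1 ltxx.
by field.
Qed.

End FixedS.
End Kronecker.

(** * The zeros of Theta and the constant in Kronecker's formula *)

Section Zeros.
Variables (R : realType) (tau : R[i]).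
Hypothesis htau : 0 < complex.Im tau.
Local Notation q := (q tau).
Local Notation tc := (tc tau).
Local Notation period := (period tau).
Local Notation width := (width tau).
Local Notation Theta := (Theta tau).
Local Notation dTheta := (dTheta tau).
Local Notation zn := (zn tau).

Lemma Cder_quotient (f g : R[i] -> R[i]) z a b : Cder f z a -> Cder g z b ->
  f z = 0 -> g z = 0 -> b != 0 -> tends (z^') (fun w => f w / g w) (a / b).
Proof.
move=> [p [pz pl fE]] [u [uz ul gE]] f0 g0 b0.
have H : tends (z^') (fun w => p w / u w) (a / b).
  by apply: tendsM (tends_punct pl) _; apply: tendsV => //; exact: tends_punct.
apply: tends_near H.
have /nbhscP[e e0 h] : \forall w \near z, f w = f z + p w * (w - z) /\
    g w = g z + u w * (w - z) by exact: filterI fE gE.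
apply/dnbhscP; exists e => // w wz we; have [-> ->] := h w we.
by rewrite f0 g0 !add0r -mulf_div divff ?mulr1// subr_eq0.
Qed.

Lemma tends_zn_punct (f : R[i] -> R[i]) (l : R[i]) :
  tends ((0 : R[i])^') f l -> tends \oo (fun n => f (zn n)) l.
Proof.
move=> fl e e0; have /dnbhscP[d d0 h] := fl e e0.
have d2 : 0 < d / 2 by rewrite divr_gt0.
have z0 := zn_tends tau d2.
apply: filterS z0 => n nd; apply: h; first exact: zn_neq0.
by move: nd; lra.
Qed.

Lemma expc_zn_neq1 n : 1 - expc (zn n) != 0.
Proof.
rewrite subr_eq0; have /andP[_ h] := zn_Re htau n.
have : cabs (expc (zn n)) < 1 by rewrite cabs_expc -(expR0 R) ltr_expR.
by apply: contraTneq => <-; rewrite cabs1 ltxx.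
Qed.

Lemma near_zn_all (P : R[i] -> Prop) :
  (\forall z \near (0 : R[i])^', P z) -> \forall n \near \oo, P (zn n).
Proof.
move=> /dnbhscP[d d0 h].
have d2 : 0 < d / 2 by rewrite divr_gt0.
have z0 := zn_tends tau d2.
apply: filterS z0 => n nd; apply: h; first exact: zn_neq0.
by move: nd; lra.
Qed.

Lemma near_zn (P : R[i] -> Prop) :
  (\forall z \near (0 : R[i])^', P z) -> exists n, P (zn n).
Proof. by move=> /near_zn_all[N _ h]; exists N; apply: h => /=. Qed.

(* Averaging over the 2 ^ k-th roots of unity isolates the constant coefficient. *)
Lemma Theta_not0 : ~ (forall z, Theta z = 0).
Proof.
move=> T0.
have t0 z : th tau z = 0.
  have := T0 z; rewrite Theta_th// => /eqP; rewrite mulf_eq0.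
  by rewrite (negbTE (expc_neq0 _)) => /eqP.
pose d k (n : int) : bool := (((2 ^ k)%N : int) %| n)%Z.
pose a k n : R[i] := if d k n then tc n else 0.
have sa k z : summ (fun n : int => a k n * expc (n%:~R * z)).
  apply: summ_dom (expsum_summ (th_summable htau) z) => n.
  by rewrite /a; case: ifP => // _; rewrite mul0r cabs0 cabs_ge0.
have P k : forall z, csum (fun n : int => a k n * expc (n%:~R * z)) = 0.
  elim: k => [|k IH] z.
    rewrite -(t0 z); apply: eq_csum => n; by rewrite /a /d expn0 dvd1z.
  (* Translation by [w] multiplies the term of index m 2^k by (-1)^m, so averaging over [z] and
     [z + w] keeps the multiples of 2^(k + 1). *)
  pose w := twopii R / (2 ^ k.+1)%:R.
  have := IH z; have := IH (z + w) => h1 h2.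
  have : csum (fun n : int => 2 * (a k.+1 n * expc (n%:~R * z))) = 0.
    rewrite -[RHS]addr0 -{1}h1 -h2 -csumD//; apply: eq_csum => n.
    rewrite /a /d; case: (boolP (((2 ^ k)%N : int) %| n)%Z) => [/dvdzP[m ->]|nd].
      have ew : expc ((m * (2 ^ k)%N)%:~R * w) = (-1) ^ m.
        have -> : (m * (2 ^ k)%N)%:~R * w = m%:~R * (twopii R / 2).
          rewrite /w intrM expnS natrM -pmulrn.
          have h0 : ((2 ^ k)%:R : R[i]) != 0 by rewrite pnatr_eq0 -lt0n expn_gt0.
          by field.
        by rewrite expcMz expc_half.
      have -> : (((2 ^ k.+1)%N : int) %| m * (2 ^ k)%N)%Z = (2 %| m)%Z.
        by rewrite expnS PoszM dvdz_mul2r// eqz_nat -lt0n expn_gt0.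
      rewrite mulrDr expcD ew.
      case: (boolP (2 %| m)%Z) => [/dvdzP[j ->]|odd_m].
        have -> : ((-1) ^ (j * 2) : R[i]) = 1.
          have -> : j * 2 = j + j by ring.
          exact: signz_double.
        by ring.
      have -> : ((-1) ^ m : R[i]) = -1.
        have -> : m = (m %/ 2)%Z + (m %/ 2)%Z + 1.
          have m2 : (m %% 2)%Z != 0 by apply: contraNneq odd_m => /dvdz_mod0P.
          by move/eqP: m2 => m2; lia.
        by rewrite signzS signz_double.
      by ring.
    rewrite ifF ?mul0r ?mulr0 ?addr0//.
    apply: contraNF nd; apply: dvdz_trans.
    by rewrite expnS PoszM dvdz_mull.
  rewrite csumZ// => /eqP; rewrite mulf_eq0 pnatr_eq0/= => /eqP//.
have Pa k : csum (a k) = 0.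
  by rewrite -(P k 0); apply: eq_csum => n; rewrite mulr0 expc0 mulr1.
have : tends \oo (fun k => csum (a k)) (csum (fun n => if n == 0 then tc n else 0)).
  apply: (tends_csum (M := fun n => cabs (tc n))).
  - apply: nearW => k n; rewrite /a; case: ifP => // _; rewrite cabs0; exact: cabs_ge0.
  - exact: ((summE _).1 (tc_summ htau)).
  - move=> n; have [->|n0] := eqVneq n 0.
      by apply: tends_ext (tends_cst (tc 0)) => k; rewrite /a /d dvdz0.
    apply: tends_near (tends_cst (0 : R[i])).
    exists `|n|%N => // k /= nk; rewrite /a /d ifF//.
    apply: contraNF n0 => /dvdzP[m E].
    have : (`|n| = `|m| * 2 ^ k)%N by rewrite E abszM absz_nat.
    have := ltn_expl k (ltnSn 1); case: (`|m|)%N => [|j]; last by nia.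
    by rewrite mul0n => _ /eqP; rewrite absz_eq0.
move=> h1; have h2 : tends \oo (fun k => csum (a k)) 0.
  by apply: tends_ext (tends_cst 0) => k; rewrite Pa.
have E : csum (fun n : int => if n == 0 then tc n else 0) = 0.
  exact: tends_unique h1 h2.
move: E; have [|_ ->] := @csum_single _ _ (0 : int) (fun n => if n == 0 then tc n else 0).
  by move=> n /negbTE ->.
by rewrite eqxx /tc expr0z mul1r expr0 => /eqP; rewrite oner_eq0.
Qed.

Lemma Theta_isolated z0 : \forall z \near z0^', Theta z != 0.
Proof.
have [h|//] := analytic_zero_dich (Theta_entire htau z0).
exfalso; apply: Theta_not0 => z.
apply: (@entire_eq _ Theta (fun=> 0) z0) => //; first exact: Theta_entire.
by move=> w; exact: analytic_cst.
Qed.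

Definition regular (s : R[i]) := forall n : int, expc s * q ^ n != 1.

Lemma regular_strip s : - width < complex.Re s < 0 -> regular s.
Proof.
move=> /andP[s1 s2] n; apply/eqP => /(congr1 (@cabs R)).
rewrite qz -expcD cabs1 cabs_expc -(expR0 R) => /expR_inj.
rewrite ReD Re_Mperiod.
move=> E; have w0 := width_gt0 htau.
have [n0|n0] := lerP 0 n.
  have : 0 <= (n%:~R : R) * width by rewrite mulr_ge0 ?ler0z// ltW.
  by lra.
have : (n%:~R : R) <= -1 by rewrite -(rmorphN1 (intmul 1)) ler_int; lia.
move=> h; have h' : (n%:~R : R) * width <= -1 * width by rewrite ler_wpM2r// ltW.
by lra.
Qed.

Lemma zn_strip n : - width < complex.Re (zn n) < 0.
Proof.
have w0 := width_gt0 htau; have /andP[h1 h2] := zn_Re htau n.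
by apply/andP; split; lra.
Qed.

Lemma zn_regular n : regular (zn n).
Proof. exact: regular_strip (zn_strip n). Qed.

Lemma regular_lattice s : ~ in_lattice tau s -> regular s.
Proof.
move=> h n; apply/eqP; rewrite qz -expcD => /expc_eq1[m E]; apply: h.
exists m, (- n); rewrite mulrDr -E /period mulrNz; ring.
Qed.

Lemma expm1_Cder : Cder (fun z : R[i] => 1 - expc z) 0 (-1).
Proof.
have := CderZ (-1) (Cder_expc (0 : R[i])); rewrite expc0 mulr1 => -[p [pz pl E]].
exists p; split=> //; apply: filterS E => w; rewrite expc0 => h.
rewrite !mulN1r in h; by rewrite h; ring.
Qed.

Definition kk s := kg tau s 0 * expc (- s / 2).

Lemma Theta_Kr s z : regular s -> - width < complex.Re z < 0 ->
  Theta z * Kr tau s z = kk s * Theta (z + s).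
Proof.
move=> hs hz; rewrite !Theta_th// -mulrA th_Kr// /kk.
have -> : (z + s) / 2 = z / 2 + s / 2 by field.
rewrite mulNr expcN expcD.
have e1 := expc_neq0 (s / 2); by field.
Qed.

(** Compare limits at z = 0 in [Theta_Kr]: Theta z / (1 - exp z) tends to - Theta'(0), and (1 - exp
    z) times [Kr] tends to 1. Being a product, the left-hand side also locates the zeros: once
    Theta'(0) is nonzero, [Theta s] cannot vanish. *)
Lemma kk_Theta s : regular s -> kk s * Theta s = - dTheta 0.
Proof.
move=> hs.
have T0 := Theta_Cder htau (0 : R[i]).
have h1 : tends ((0 : R[i])^') (fun w => Theta w / (1 - expc w)) (dTheta 0 / -1).
  apply: Cder_quotient T0 expm1_Cder _ _ _; first exact: Theta0.
    by rewrite expc0 subrr.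
  by rewrite oppr_eq0 oner_eq0.
have h2 := tends_zn_punct h1.
have h3 : tends \oo (fun n => Theta (zn n) / (1 - expc (zn n)) *
    ((1 - expc (zn n)) * Kr tau s (zn n))) (dTheta 0 / -1 * 1).
  exact: tendsM h2 (Kr_residue htau hs).
have h4 : tends \oo (fun n => kk s * Theta (zn n + s)) (kk s * Theta s).
  apply: tendsM (tends_cst _) _.
  by have := tends_zn_punct (tends_shift (Theta_entire htau (0 + s))); rewrite add0r.
have -> : - dTheta 0 = dTheta 0 / -1 * 1 by rewrite invrN invr1 mulrN1 mulr1.
symmetry; apply: tends_unique h3 _; apply: tends_ext h4 => n.
rewrite -Theta_Kr//; last exact: zn_strip.
by have n0 := expc_zn_neq1 n; field.
Qed.

(** Otherwise [kk] vanishes at a point of the strip where [Theta] does not. For that parameter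
    Kronecker's series is 0 at all [zn n] close to 0, which contradicts [Kr_residue]. *)
Lemma dTheta0_neq0 : dTheta 0 != 0.
Proof.
apply/eqP => d0.
have [m Tm] := near_zn (Theta_isolated 0).
have hs := zn_regular m.
have k0 : kk (zn m) = 0.
  by have /eqP := kk_Theta hs; rewrite d0 oppr0 mulf_eq0 (negbTE Tm) orbF => /eqP.
have K0 : \forall n \near \oo, Kr tau (zn m) (zn n) = 0.
  apply: filterS (near_zn_all (Theta_isolated 0)) => n Tn.
  have /eqP := Theta_Kr hs (zn_strip n).
  by rewrite k0 mul0r mulf_eq0 (negbTE Tn)/= => /eqP.
have h1 := Kr_residue htau hs.
have h2 : tends \oo (fun n => (1 - expc (zn n)) * Kr tau (zn m) (zn n)) 0.
  by apply: tends_near (tends_cst 0); apply: filterS K0 => n ->; rewrite mulr0.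
have E : (1 : R[i]) = 0 := tends_unique h1 h2.
by have := oner_neq0 R[i]; rewrite E eqxx.
Qed.

Lemma Theta_neq0 s : regular s -> Theta s != 0.
Proof.
move=> hs; apply/eqP => T0; have := kk_Theta hs.
by rewrite T0 mulr0 => /esym/eqP; rewrite oppr_eq0 (negbTE dTheta0_neq0).
Qed.

Lemma Theta_zero z : Theta z = 0 -> in_lattice tau z.
Proof.
move=> T0; apply: contrapT => /regular_lattice/Theta_neq0.
by rewrite T0 eqxx.
Qed.

Lemma kronecker s z : regular s -> - width < complex.Re z < 0 ->
  Theta z * Theta s * Kr tau s z = - dTheta 0 * Theta (z + s).
Proof.
by move=> hs hz; rewrite mulrAC Theta_Kr// -(kk_Theta hs); ring.
Qed.

(** Every zero is a lattice point, and the multiplier of the translation carries the simple zero at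
    0 to it. *)
Lemma dTheta_neq0 z : Theta z = 0 -> dTheta z != 0.
Proof.
move=> /Theta_zero lz.
have [C [d [C0 h]]] := Theta_lattice_shift htau lz.
have e1 : Cder (fun w => expc (d * (w - z))) z (1 * (d * 1)).
  apply: (Cder_comp (f := @expc R)).
    by apply: CderZ; exists (fun=> 1); split=> //; [exact: tends_cst|apply/nbhscP; exists 1 => // w _; ring].
  by have := Cder_expc (0 : R[i]); rewrite expc0 subrr mulr0.
have e2 : Cder (fun w => Theta (w - z)) z (dTheta 0).
  by apply: Cder_shift; rewrite subrr; exact: Theta_Cder.
have := CderM (CderZ C e1) e2; rewrite subrr Theta0// !(mulr0, add0r) expc0 mulr1 => e3.
rewrite (Cder_unique (Theta_Cder htau z) (m := C * dTheta 0)) ?mulf_neq0 ?dTheta0_neq0//.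
apply: Cder_near e3; apply/nbhscP; exists 1 => // w _ /=.
by rewrite -h subrK.
Qed.

End Zeros.

(** * The logarithmic derivative *)

Section LogDerivative.
Variables (R : realType) (tau : R[i]).
Hypothesis htau : 0 < complex.Im tau.
Local Notation q := (q tau).
Local Notation width := (width tau).
Local Notation Theta := (Theta tau).
Local Notation dTheta := (dTheta tau).
Local Notation zn := (zn tau).

Lemma ReN (z : R[i]) : complex.Re (- z) = - complex.Re z.
Proof. by case: z. Qed.

Lemma fsumm_bool (I : choiceType) (g : bool * I -> R) : (forall p, 0 <= g p) ->
  fsumm (fun i => g (true, i)) -> fsumm (fun i => g (false, i)) -> fsumm g.
Proof.
move=> g0 s1 s2.
have [sp _] := csum_nonneg (fun k => g0 (true, k)) s1.
have [sn _] := csum_nonneg (fun k => g0 (false, k)) s2.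
have [s _] := csum_bool (f := fun p => (g p)%:C) sp sn.
by apply: fsumm_le ((summE _).1 s) => n; rewrite cabs_real ler_norm.
Qed.

(** The square root of [cabs q]. For [Re z >= - width / 2] each power of exp (- z) costs one power
    of [p], which leaves another for convergence. *)
Let p : R := expR (- (width / 2)).

Lemma p_gt0 : 0 < p. Proof. exact: expR_gt0. Qed.

Lemma p_lt1 : p < 1.
Proof. by have w0 := width_gt0 htau; rewrite expR_lt1; lra. Qed.

Lemma p_geo : fsumm (fun k => p ^+ k).
Proof. by apply: fsumm_geo; rewrite (ltW p_gt0) p_lt1. Qed.

Lemma qpp : cabs q = p * p.
Proof. by rewrite cabs_q -expRD; congr expR; lra. Qed.

Lemma cabs_geo (x : R[i]) (r : R) : cabs x <= r -> r < 1 -> cabs (x / (1 - x)) <= cabs x / (1 - r).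
Proof.
move=> xr r1; have x1 : 1 - r <= cabs (1 - x).
  by have := cabsD (1 - x) x; rewrite subrK cabs1; lra.
have r0 : 0 < 1 - r by lra.
rewrite cabsM cabsV ler_wpM2l ?cabs_ge0// lef_pV2// posrE//.
exact: lt_le_trans x1.
Qed.

Lemma kd_neg s k : regular tau s ->
  kd tau s (Negz k) = - (expc (- s) * q ^+ k.+1 / (1 - expc (- s) * q ^+ k.+1)).
Proof.
move=> hs; rewrite /kd; have := kd_neq0 hs (Negz k).
rewrite NegzE -exprnN expcN.
have e0 := expc_neq0 s; have qk : q ^+ k.+1 != 0 by rewrite expf_neq0// q_neq0.
move: (q ^+ k.+1) (expc s) e0 qk => a t t0 a0 h.
have h' : a - t != 0.
  have -> : a - t = a * (1 - t * a^-1) by field.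
  by rewrite mulf_neq0.
have h2 : t - a != 0 by rewrite -opprB oppr_eq0.
by field; rewrite ?t0 ?a0 ?h' ?h2.
Qed.

Definition lam (k : nat) : R[i] := q ^+ k.+1 / (1 - q ^+ k.+1).
(** The limit of [Krest] for s tending to 0: there [kd] at k + 1, less 1, tends to [lam k], and [kd]
    at - k - 1 tends to [- lam k]. *)
Definition Kr0 z : R[i] := csum (fun k => lam k * (expc z ^+ k.+1 - expc (- z) ^+ k.+1)).

Lemma qk_lt1 k : cabs (q ^+ k.+1) < 1.
Proof.
by rewrite cabsX exprn_ilt1// ?cabs_ge0// cabs_q_lt1.
Qed.

Lemma qk_neq1 k : 1 - q ^+ k.+1 != 0.
Proof.
by rewrite subr_eq0; apply: contraTneq (qk_lt1 k) => <-; rewrite cabs1 ltxx.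
Qed.

Lemma Krest_limit n : tends \oo (fun m => Krest tau (zn m) (zn n)) (Kr0 (zn n)).
Proof.
have p0 := p_gt0; have p1 := p_lt1; have w0 := width_gt0 htau.
have p1' : 0 < 1 - p by rewrite subr_gt0.
have pinv : 0 <= (1 - p)^-1 by rewrite invr_ge0 ltW.
have /andP[z1 z2] := zn_Re htau n.
have Ez : cabs (expc (zn n)) <= 1 by rewrite cabs_expc -(expR0 R) ler_expR ltW.
have Ez' : cabs (expc (- zn n)) * p <= 1.
  by rewrite cabs_expc -expRD expR_le1 ReN; move: z1; lra.
have qp k : cabs q ^+ k.+1 <= p ^+ k.+1.
  rewrite qpp lerXn2r ?nnegrE ?mulr_ge0 ?(ltW p0)//.
  by rewrite ler_piMl// ltW.
(* In the worse, negative half, exp (- z) costs p^(- k - 1) and exp (- s) one more p^(- 1), while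
   q^(k + 1) supplies p^(2 k + 2): hence the exponent [k]. *)
pose M (k : nat) : R := 2 * (1 - p)^-1 * p ^+ k.
have sM : fsumm M.
  have c0 : 0 <= 2 * (1 - p)^-1 by rewrite mulr_ge0.
  by have [] := fsummZ c0 (fun k => exprn_ge0 k (ltW p0)) p_geo.
apply: (tends_csum (M := M)) => //.
- apply: nearW => m k.
  have hs := zn_regular htau m; have /andP[s1 s2] := zn_Re htau m.
  have t1 : cabs (expc (zn m)) <= 1 by rewrite cabs_expc -(expR0 R) ler_expR ltW.
  have t2 : cabs (expc (- zn m)) * p <= 1.
    by rewrite cabs_expc -expRD expR_le1 ReN; move: s1; lra.
  have -> : M k = (1 - p)^-1 * p ^+ k + (1 - p)^-1 * p ^+ k by rewrite /M; ring.
  apply: (le_trans (cabsD _ _)); apply: lerD.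
    rewrite kd_sub1// /kd -exprnP cabsM cabsX.
    apply: (@le_trans _ _ (1 * cabs (expc (zn m) * q ^+ k.+1 / (1 - expc (zn m) * q ^+ k.+1)))).
      by rewrite ler_wpM2r ?cabs_ge0// exprn_ile1// cabs_ge0.
    rewrite mul1r.
    have b : cabs (expc (zn m) * q ^+ k.+1) <= p ^+ k.+1.
      rewrite cabsM cabsX; apply: le_trans (qp k).
      by rewrite ler_piMl// exprn_ge0// cabs_ge0.
    have b' : p ^+ k.+1 <= p by rewrite exprS ler_piMr ?exprn_ile1 ?(ltW p0) ?(ltW p1).
    apply: (le_trans (cabs_geo (le_trans b b') p1)).
    rewrite mulrC ler_wpM2l//; apply: (le_trans b).
    by rewrite exprS ler_piMl ?exprn_ge0 ?(ltW p0) ?(ltW p1).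
  rewrite kd_neg// cabsM cabsX cabsN.
  set E := cabs (expc (- zn n)) in Ez' *.
  have E0 : 0 <= E by exact: cabs_ge0.
  have b : cabs (expc (- zn m) * q ^+ k.+1) <= p ^+ k.+1 * p ^+ k.
    rewrite cabsM cabsX qpp exprMn.
    have -> : cabs (expc (- zn m)) * (p ^+ k.+1 * p ^+ k.+1) =
      (cabs (expc (- zn m)) * p) * (p ^+ k.+1 * p ^+ k) by rewrite [p ^+ k.+1]exprS; ring.
    by rewrite ler_piMl// mulr_ge0 ?exprn_ge0// ltW.
  have pk k' : 0 <= p ^+ k' <= 1 by rewrite exprn_ge0 ?exprn_ile1 ?(ltW p0) ?(ltW p1).
  have b' : p ^+ k.+1 * p ^+ k <= p.
    have /andP[a1 a2] := pk k.
    rewrite exprS -mulrA ler_piMr ?(ltW p0)//.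
    by rewrite -(mulr1 1) ler_pM.
  apply: (@le_trans _ _ (E ^+ k.+1 * ((p ^+ k.+1 * p ^+ k) / (1 - p)))).
    rewrite ler_wpM2l ?exprn_ge0//.
    by apply: (le_trans (cabs_geo (le_trans b b') p1)); rewrite ler_wpM2r.
  have -> : E ^+ k.+1 * ((p ^+ k.+1 * p ^+ k) / (1 - p)) =
    (E * p) ^+ k.+1 * ((1 - p)^-1 * p ^+ k) by rewrite exprMn; ring.
  rewrite ler_piMl ?exprn_ile1 ?mulr_ge0 ?exprn_ge0 ?(ltW p0)//.
- move=> k.
  have e1 : tends \oo (fun m => expc (zn m)) 1.
    rewrite -(expc0 R); apply: tends_zn; exact: expc_tends.
  have e2 : tends \oo (fun m => expc (- zn m)) 1.
    apply: (@tends_ext _ _ _ (fun m => (expc (zn m))^-1)).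
      by move=> m; rewrite expcN.
    by rewrite -[1]invr1; apply: tendsV e1; exact: oner_neq0.
  have lim (t : nat -> R[i]) : tends \oo t 1 ->
      tends \oo (fun m => t m * q ^+ k.+1 / (1 - t m * q ^+ k.+1)) (lam k).
    move=> t1.
    have -> : lam k = (1 * q ^+ k.+1) / (1 - 1 * q ^+ k.+1) by rewrite /lam mul1r.
    have t2 : tends \oo (fun m => t m * q ^+ k.+1) (1 * q ^+ k.+1).
      by apply: tendsM t1 _; exact: tends_cst.
    apply: (tendsM t2); apply: tendsV; first by rewrite mul1r qk_neq1.
    by apply: tendsB t2; exact: tends_cst.
  have -> : lam k * (expc (zn n) ^+ k.+1 - expc (- zn n) ^+ k.+1) =
    expc (zn n) ^+ k.+1 * lam k + expc (- zn n) ^+ k.+1 * - lam k by ring.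
  apply: tendsD; (apply: tendsM; first exact: tends_cst).
    apply: tends_ext (lim _ e1) => m.
    by rewrite kd_sub1//; exact: zn_regular.
  apply: tends_ext (tendsN (lim _ e2)) => m.
  by rewrite kd_neg//; exact: zn_regular.
Qed.

(** The logarithmic derivative with its pole and its Lambert series compensated; as s tends to 0,
    Kronecker's formula shows this combination to be independent of z. *)
Definition Dlog z := dTheta z / Theta z + expc z / (1 - expc z) + Kr0 z.

(** The sequence does not involve [n], so all values [Dlog (zn n)] coincide. It comes from
    Kronecker's formula at s = zn m, with Theta (z + s) split into Theta z and a difference whose
    quotient by Theta s has a limit. *)
Lemma Dlog_limit n :
  tends \oo (fun m => - dTheta 0 / Theta (zn m) - (1 - expc (zn m))^-1) (Dlog (zn n)).
Proof.
have Tn := Theta_neq0 htau (zn_regular htau n).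
have d0 := dTheta0_neq0 htau.
have c2 : Cder (fun w => Theta (w + zn n) - Theta (zn n)) 0 (dTheta (zn n)).
  by apply/Cder_subc/Cder_shift; rewrite add0r; exact: Theta_Cder.
have l1 : tends ((0 : R[i])^') (fun w => (Theta (w + zn n) - Theta (zn n)) / Theta w)
    (dTheta (zn n) / dTheta 0).
  apply: Cder_quotient c2 (Theta_Cder htau 0) _ _ d0; last exact: Theta0.
  by rewrite add0r subrr.
have l2 := tends_zn_punct htau l1.
rewrite /Dlog; have -> : dTheta (zn n) / Theta (zn n) =
    (dTheta 0 / Theta (zn n)) * (dTheta (zn n) / dTheta 0) by field; rewrite Tn d0.
apply: tends_ext (tendsD (tendsD (tendsM (tends_cst (dTheta 0 / Theta (zn n))) l2)
  (tends_cst (expc (zn n) / (1 - expc (zn n))))) (Krest_limit n)) => m /=.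
have hs := zn_regular htau m.
have Tm := Theta_neq0 htau hs.
have := kronecker htau hs (zn_strip htau n); rewrite Kr_split//; last exact: zn_Re.
rewrite /kd expr0z mulr1 [zn n + zn m]addrC => E.
have em := expc_zn_neq1 htau m; have en := expc_zn_neq1 htau n.
apply: (mulfI (mulf_neq0 Tn Tm)).
have -> : Theta (zn n) * Theta (zn m) * (- dTheta 0 / Theta (zn m) - (1 - expc (zn m))^-1) =
  - dTheta 0 * Theta (zn n) - Theta (zn n) * Theta (zn m) * (1 - expc (zn m))^-1 by field; rewrite em Tm.
have -> : - dTheta 0 * Theta (zn n) = - dTheta 0 * Theta (zn m + zn n) +
   dTheta 0 * (Theta (zn m + zn n) - Theta (zn n)) by ring.
rewrite -E !mulrDr.
have -> : Theta (zn n) * Theta (zn m) * (dTheta 0 / Theta (zn n) *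
   ((Theta (zn m + zn n) - Theta (zn n)) / Theta (zn m))) =
   dTheta 0 * (Theta (zn m + zn n) - Theta (zn n)) by field; rewrite Tm Tn.
ring.
Qed.

Lemma Dlog_const n m : Dlog (zn n) = Dlog (zn m).
Proof. exact: tends_unique (Dlog_limit n) (Dlog_limit m). Qed.

(** [Kr0] as one exponential sum over [bool * nat], so that [expsum_ps0] yields its Taylor
    coefficients; the weights are summable at radius [width / 2]. *)
Definition lc (x : bool * nat) : R[i] := if x.1 then lam x.2 else - lam x.2.
Definition lnu (x : bool * nat) : R[i] := (if x.1 then 1 else -1) * x.2.+1%:R.

Lemma width2_gt0 : 0 < width / 2.
Proof. by have := width_gt0 htau; lra. Qed.

Lemma lam_bound k : cabs (lam k) * expR (k.+1%:R * (width / 2)) <= (1 - cabs q)^-1 * p ^+ k.+1.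
Proof.
have q1 := cabs_q_lt1 htau.
have b : cabs (q ^+ k.+1) <= cabs q.
  by rewrite cabsX exprS ler_piMr ?cabs_ge0// exprn_ile1 ?cabs_ge0// ltW.
apply: (@le_trans _ _ (cabs (q ^+ k.+1) / (1 - cabs q) * expR (k.+1%:R * (width / 2)))).
  by rewrite ler_wpM2r ?expR_ge0//; exact: cabs_geo.
rewrite expRM_natl cabsX qpp exprMn.
have -> : p ^+ k.+1 * p ^+ k.+1 / (1 - p * p) * expR (width / 2) ^+ k.+1 =
  (1 - p * p)^-1 * p ^+ k.+1 * (p * expR (width / 2)) ^+ k.+1 by rewrite [(p * expR _) ^+ _]exprMn; ring.
have -> : p * expR (width / 2) = 1 by rewrite /p -expRD addNr expR0.
by rewrite expr1n mulr1.
Qed.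

Lemma lam_fsumm : fsumm (fun k => cabs (lam k) * expR (k.+1%:R * (width / 2))).
Proof.
have q1 := cabs_q_lt1 htau.
have c0 : 0 <= (1 - cabs q)^-1 * p by rewrite mulr_ge0 ?(ltW p_gt0)// invr_ge0; lra.
have [s _] := fsummZ c0 (fun k => exprn_ge0 k (ltW p_gt0)) p_geo.
by apply: fsumm_le s => k; apply: (le_trans (lam_bound k)); rewrite exprS mulrA.
Qed.

Lemma lc_fsumm : fsumm (fun x => cabs (lc x) * expR (cabs (lnu x) * (width / 2))).
Proof.
apply: fsumm_bool => [x||]; first by rewrite mulr_ge0 ?cabs_ge0 ?expR_ge0.
  by rewrite /lc /lnu/=; apply: fsumm_le lam_fsumm => k; rewrite mul1r cabs_nat.
by rewrite /lc /lnu/=; apply: fsumm_le lam_fsumm => k; rewrite mulN1r !cabsN cabs_nat.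
Qed.

Lemma lc_half_summ b z : cabs z <= width / 2 ->
  summ (fun k : nat => lc (b, k) * expc (lnu (b, k) * z)).
Proof.
move=> hz; have s := summ_expsum hz lc_fsumm.
by apply: (summ_comp (e := fun k : nat => (b, k)) _ s) => c d [].
Qed.

Lemma lc_half z k : lc (true, k) * expc (lnu (true, k) * z) +
  lc (false, k) * expc (lnu (false, k) * z) =
  lam k * (expc z ^+ k.+1 - expc (- z) ^+ k.+1).
Proof.
rewrite /lc /lnu/=.
have -> : 1 * k.+1%:R * z = k.+1%:R * z by ring.
have -> : -1 * k.+1%:R * z = k.+1%:R * (- z) by ring.
by rewrite !expcMn; ring.
Qed.

Lemma Kr0_expsum z : cabs z <= width / 2 -> Kr0 z = expsum lc lnu z.
Proof.
move=> hz; rewrite /expsum.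
have st := lc_half_summ true hz; have sn := lc_half_summ false hz.
have [_ ->] := csum_bool (f := fun x => lc x * expc (lnu x * z)) st sn.
rewrite -(csumD st sn); apply: eq_csum => k.
by rewrite lc_half.
Qed.

Definition kcoef (j : nat) : R[i] := csum (fun x => lc x * expt (lnu x) j).

Lemma Kr0_ps : has_ps kcoef (width / 2) Kr0 0.
Proof.
have [h1 h2 h3] := expsum_ps0 width2_gt0 lc_fsumm.
split; [exact: h1|exact: h2|move=> h hr].
by rewrite -(h3 h hr) add0r Kr0_expsum.
Qed.

(** The inequality x^j / j! <= exp x at x = (k + 1) width / 2 trades the power of [k.+1] for the
    exponential weight of [lam_fsumm]. *)
Lemma lam_pow_summ j : summ (fun k => lam k * k.+1%:R ^+ j).
Proof.
have w2 := width2_gt0.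
have C0 : 0 <= (j`!%:R / (width / 2) ^+ j : R).
  by rewrite divr_ge0// exprn_ge0// ltW.
have [s _] := fsummZ C0 (fun k => mulr_ge0 (cabs_ge0 (lam k)) (expR_ge0 (k.+1%:R * (width / 2)))) lam_fsumm.
apply: summ_le s => k; rewrite cabsM mulrCA ler_wpM2l ?cabs_ge0// cabsX cabs_nat.
have x0 : 0 <= k.+1%:R * (width / 2) :> R by rewrite mulr_ge0// ltW.
rewrite mulrAC ler_pdivlMr ?exprn_gt0// -exprMn [leRHS]mulrC -ler_pdivrMr ?ltr0n ?fact_gt0//.
have [s1 <-] := nsum_expR x0.
apply: (@le_nsum_term _ _ (fun j => (k.+1%:R * (width / 2)) ^+ j / j`!%:R)) => // i.
by rewrite divr_ge0// exprn_ge0.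
Qed.

(** The two halves of [Kr0] cancel in even degree and double in odd degree, which gives the Lambert
    series of [eisenstein] with its factor 2. *)
Lemma kcoefE j : kcoef j = if odd j then 2 / j`!%:R * csum (fun k => lam k * k.+1%:R ^+ j) else 0.
Proof.
have s := lam_pow_summ j.
have st : summ (fun k : nat => lc (true, k) * expt (lnu (true, k)) j).
  by apply: eq_summ (summZ (j`!%:R^-1) s) => k; rewrite /lc /lnu /expt/= mul1r; ring.
have sn : summ (fun k : nat => lc (false, k) * expt (lnu (false, k)) j).
  apply: eq_summ (summZ (- (-1) ^+ j * j`!%:R^-1) s) => k; rewrite /lc /lnu /expt/=.
  by rewrite exprMn; ring.
rewrite /kcoef; have [_ ->] := csum_bool (f := fun x => lc x * expt (lnu x) j) st sn.
rewrite -(csumD st sn) -(csumZ _ s).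
case: ifPn => oj.
  by apply: eq_csum => k; rewrite /lc /lnu /expt/= mul1r exprMn -signr_odd oj; ring.
rewrite -[RHS](csum0 _ nat); apply: eq_csum => k; rewrite /lc /lnu /expt/=.
by rewrite mul1r exprMn -signr_odd (negbTE oj); ring.
Qed.

Lemma Kr0_analytic : analytic_at Kr0 0.
Proof. by apply/analyticP; eexists _, _; exact: Kr0_ps. Qed.

Lemma expc_analytic0 (z : R[i]) : analytic_at (@expc R) z.
Proof.
have := expc_analytic z 1; apply: analytic_near.
by apply/nbhscP; exists 1 => // w _; rewrite mul1r.
Qed.

Lemma expc_near1 : \forall z \near (0 : R[i])^', 1 - expc z != 0.
Proof.
have an : analytic_at (fun z : R[i] => 1 - expc z) 0.
  by apply: analyticB; [exact: analytic_cst|exact: expc_analytic0].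
have [h|//] := analytic_zero_dich an.
exfalso; have [n] := near_zn htau (nbhs_dnbhs h).
by apply/eqP; exact: expc_zn_neq1.
Qed.

(** Clearing denominators gives a function [H] analytic at 0 that vanishes at all [zn n]; these
    accumulate at 0, so [H] vanishes near 0. *)
Lemma Dlog_near : \forall z \near (0 : R[i])^', Dlog z = Dlog (zn 0).
Proof.
set D0 := Dlog (zn 0).
pose H z := dTheta z * (1 - expc z) + Theta z * (expc z + (1 - expc z) * (Kr0 z - D0)).
have e1 : analytic_at (fun z : R[i] => 1 - expc z) 0.
  by apply: analyticB; [exact: analytic_cst|exact: expc_analytic0].
have Ha : analytic_at H 0.
  have a1 := analyticM (dTheta_entire htau 0) e1.
  have a2 := analyticB Kr0_analytic (analytic_cst D0 0).
  have a3 := analyticD (expc_analytic0 0) (analyticM e1 a2).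
  exact: (analyticD a1 (analyticM (Theta_entire htau 0) a3)).
have key z : Theta z != 0 -> 1 - expc z != 0 -> (H z == 0) = (Dlog z == D0).
  move=> Tz ez; rewrite -[RHS]subr_eq0.
  have -> : H z = Theta z * (1 - expc z) * (Dlog z - D0) by rewrite /H /Dlog; field; rewrite Tz ez.
  by rewrite mulf_eq0 (negbTE (mulf_neq0 Tz ez)).
have H0 : \forall z \near (0 : R[i]), H z = 0.
  have [//|h] := analytic_zero_dich Ha.
  exfalso; have [n] := near_zn htau h.
  rewrite key ?(Dlog_const n 0) ?eqxx//; last exact: (expc_zn_neq1 htau).
  exact: (Theta_neq0 htau (zn_regular htau n)).
have T0 := Theta_isolated htau 0.
have PF := dnbhsc_proper (0 : R[i]).
apply: filterS3 (nbhs_dnbhs H0) T0 expc_near1 => z Hz Tz ez.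
by apply/eqP; rewrite -key// Hz.
Qed.

Lemma dTheta_even z : dTheta (- z) = dTheta z.
Proof.
rewrite !dThetaE (csum_reflect _ (-1)).
apply: eq_csum => n; rewrite tc_reflect//.
have -> : tnu R (-1 - n) = - tnu R n by rewrite /tnu intrB; field.
by rewrite mulrNN mulrNN.
Qed.

Lemma near_opp (P : R[i] -> Prop) :
  (\forall z \near (0 : R[i])^', P z) -> \forall z \near (0 : R[i])^', P (- z).
Proof.
move=> /dnbhscP[e e0 h]; apply/dnbhscP; exists e => // w w0 we; apply: h.
  by rewrite oppr_eq0.
by move: we; rewrite !subr0 cabsN.
Qed.

Lemma cabs_zn n : cabs (zn n) <= width / 2.
Proof.
have w := width2_gt0.
rewrite /zn cabs_real mulNr normrN ger0_norm; last by rewrite divr_ge0// ltW.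
by rewrite ler_pdivrMr ?ltr0n// ler_peMr ?(ltW w)// ler1n.
Qed.

(** Parity: [dTheta / Theta] and [Kr0] are odd, and exp z / (1 - exp z) plus its value at - z is -1,
    so twice the constant is -1. A [zn n] close enough to 0 makes [Dlog] take the constant value at
    both signs. *)
Lemma Dlog_value : Dlog (zn 0) = - 2^-1.
Proof.
have PF := dnbhsc_proper (0 : R[i]).
have : \forall z \near (0 : R[i])^', Dlog z = Dlog (zn 0) /\ Dlog (- z) = Dlog (zn 0).
  exact: filterI Dlog_near (near_opp Dlog_near).
move=> /(near_zn htau)[n [h1 h2]].
have ez := expc_zn_neq1 htau n; have e0 := expc_neq0 (zn n).
have Tz := Theta_neq0 htau (zn_regular htau n).
have K0 : Kr0 (- zn n) = - Kr0 (zn n).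
  rewrite /Kr0 opprK -csumN; last first.
    apply: eq_summ (summD (lc_half_summ true (cabs_zn n)) (lc_half_summ false (cabs_zn n))) => k.
    by rewrite lc_half.
  by apply: eq_csum => k; ring.
have : Dlog (zn n) + Dlog (- zn n) = -1.
  have To := Theta_odd htau (zn n).
  rewrite /Dlog dTheta_even To K0 expcN.
  have e1 : expc (zn n) - 1 != 0 by rewrite -opprB oppr_eq0.
  by field; rewrite ?Tz ?ez ?e0 ?e1.
rewrite h1 h2; move: (Dlog (zn 0)) => D h.
have -> : D = (D + D) / 2 by field.
by rewrite h mulN1r.
Qed.

Lemma logder_near : \forall z \near (0 : R[i])^',
  [/\ Theta z != 0, 1 - expc z != 0 &
   dTheta z / Theta z = 2^-1 + (expc z - 1)^-1 - Kr0 z].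
Proof.
have PF := dnbhsc_proper (0 : R[i]).
apply: filterS3 Dlog_near (Theta_isolated htau 0) expc_near1 => z.
rewrite Dlog_value /Dlog => h Tz ez; split=> //.
have e1 : expc z - 1 != 0 by rewrite -opprB oppr_eq0.
have -> : dTheta z / Theta z = - 2^-1 - expc z / (1 - expc z) - Kr0 z by rewrite -h; ring.
by field; rewrite ?ez ?e1.
Qed.

End LogDerivative.

(** * Laurent expansion at the origin *)

Section BernoulliSeries.
Variable R : realType.
Implicit Types z : R[i].

Lemma size_bernoulli_seq (F : fieldType) n : size (bernoulli_seq F n) = n.
Proof. by elim: n => //= n IH; rewrite size_rcons IH. Qed.

Lemma nth_bernoulli_seq (F : fieldType) n k : (k < n)%N ->
  (bernoulli_seq F n)`_k = bernoulli F k.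
Proof.
elim: n => // n IH; rewrite ltnS leq_eqVlt => /orP[/eqP -> //|kn].
by rewrite -IH//= nth_rcons size_bernoulli_seq kn.
Qed.

Lemma bernoulli_rec m :
  \sum_(k < m.+1) 'C(m.+1, k)%:R * bernoulli R[i] k = (m == 0)%N%:R.
Proof.
rewrite big_ord_recr/= {2}/bernoulli/= nth_rcons size_bernoulli_seq ltnn eqxx.
rewrite binSn.
rewrite mulrC divfK ?pnatr_eq0//.
rewrite (_ : \sum_(i < m) _ = \sum_(k < m) 'C(m.+1, k)%:R * (bernoulli_seq R[i] m)`_k).
  by rewrite addrC subrK.
by apply: eq_bigr => k _; rewrite nth_bernoulli_seq.
Qed.

Definition bcoef k : R[i] := bernoulli R[i] k / k`!%:R.

(** The recursion of the Bernoulli numbers divided by (m + 1)!; it says that the series of [bcoef]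
    times (exp z - 1) / z is 1. *)
Lemma bcoef_rec m : \sum_(k < m.+1) bcoef k * (m - k).+1`!%:R^-1 = (m == 0)%N%:R.
Proof.
transitivity ((m.+1`!%:R)^-1 * \sum_(k < m.+1) 'C(m.+1, k)%:R * bernoulli R[i] k).
  rewrite mulr_sumr; apply: eq_bigr => k _; rewrite /bcoef.
  have km : (k <= m.+1)%N by rewrite ltnW.
  rewrite -(bin_fact km) subSn; last by rewrite -ltnS.
  have f1 := @fact_neq0 R k; have f2 := @fact_neq0 R (m - k).+1.
  have b0 : ('C(m.+1, k)%:R : R[i]) != 0 by rewrite pnatr_eq0 -lt0n bin_gt0.
  move: ((m - k).+1`!) f2 => d f2; rewrite !natrM.
  by field; rewrite f1 f2 b0.
by rewrite bernoulli_rec; case: m => [|m]; rewrite ?mulr1 ?invr1// mulr0.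
Qed.

Lemma bcoef0 : bcoef 0 = 1.
Proof. by have := bcoef_rec 0; rewrite big_ord1 invr1 mulr1. Qed.

Lemma half_sum_le1 m : \sum_(k < m) (2^-1 : R) ^+ (m - k) <= 1.
Proof.
elim: m => [|m IH]; first by rewrite big_ord0.
rewrite big_ord_recr/= subSnn expr1.
rewrite (_ : \sum_(i < m) _ = 2^-1 * \sum_(k < m) (2^-1 : R) ^+ (m - k)); first by lra.
by rewrite mulr_sumr; apply: eq_bigr => k _; rewrite subSn ?exprS// ltnW.
Qed.

Lemma fact_ge_exp2 n : (2 ^ n <= n.+1`!)%N.
Proof. by elim: n => // n IH; rewrite factS expnS leq_mul. Qed.

(** By (j + 1)! >= 2^j the recursion bounds each coefficient by a sum of powers of 1/2 with total at
    most 1. The series then converges for [cabs z <= 2^-1]. *)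
Lemma bcoef_le1 m : cabs (bcoef m) <= 1.
Proof.
elim/ltn_ind: m => m IH.
have := bcoef_rec m; rewrite big_ord_recr/= subnn invr1 mulr1 => h.
have -> : bcoef m = (m == 0)%N%:R - \sum_(k < m) bcoef k * (m - k).+1`!%:R^-1.
  by rewrite -h; ring.
case: m IH {h} => [|m] IH; first by rewrite big_ord0 subr0 cabs1.
rewrite sub0r cabsN; apply: le_trans (half_sum_le1 m.+1).
apply: (le_trans (cabs_sum _)); apply: ler_sum => k _.
rewrite cabsM cabsV cabs_nat -[leRHS]mul1r ler_pM ?cabs_ge0 ?invr_ge0//; first exact: IH.
rewrite exprVn lef_pV2 ?posrE ?exprn_gt0 ?ltr0n ?fact_gt0//.
by rewrite -natrX ler_nat fact_ge_exp2.
Qed.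

Lemma half_lt : 0 <= (2^-1 : R) < 1.
Proof. by apply/andP; split; lra. Qed.

Lemma bcoef_summ z : cabs z <= 2^-1 -> summ (fun k => bcoef k * z ^+ k).
Proof.
move=> hz; apply: summ_le (fsumm_geo half_lt) => k.
rewrite cabsM cabsX -[leRHS]mul1r ler_pM ?cabs_ge0 ?exprn_ge0 ?cabs_ge0 ?bcoef_le1//.
by apply: lerXn2r; rewrite ?nnegrE ?cabs_ge0.
Qed.

Definition bsum z := csum (fun k => bcoef k * z ^+ k).

Lemma bsumE z : cabs z <= 2^-1 -> bsum z * (expc z - 1) = z.
Proof.
move=> hz; have [s1 E] := csum_natS (summ_expt z).
have e0 : expt z 0 = 1 by rewrite /expt expr0 fact0 divr1.
pose u k : R[i] := k.+1`!%:R^-1 * z ^+ k.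
have uE k : expt z k.+1 = z * u k by rewrite /expt /u exprS; ring.
have [->|z0] := eqVneq z 0; first by rewrite expc0 subrr mulr0.
have su : summ u.
  by apply: eq_summ (summZ z^-1 s1) => k; rewrite uE mulrA mulVf// mul1r.
have -> : expc z - 1 = z * csum u.
  rewrite expcE E e0 addrAC subrr add0r -csumZ//.
  by apply: eq_csum => k; rewrite uE.
rewrite mulrCA -[RHS]mulr1; congr (_ * _).
have [_ ->] := cauchy_prod (bcoef_summ hz) su.
have [|_ ->] := @csum_single _ _ 0%N (fun k => \sum_(i < k.+1) bcoef i * z ^+ i * u (k - i)%N).
  move=> k k0.
  rewrite (_ : \sum_(i < _) _ = (\sum_(i < k.+1) bcoef i * (k - i).+1`!%:R^-1) * z ^+ k).
    by rewrite bcoef_rec (negbTE k0) mul0r.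
  rewrite mulr_suml; apply: eq_bigr => i _; rewrite /u.
  have -> : z ^+ k = z ^+ i * z ^+ (k - i) by rewrite -exprD subnKC// -ltnS.
  ring.
by rewrite big_ord1 bcoef0 /u/= !expr0 invr1 !mul1r.
Qed.

(** Coefficients of the even part of z / (exp z - 1), which is z / (exp z - 1) + z / 2. The term B_1
    z drops out, in accordance with [eisenstein] being 0 at odd weights and with the constant 1/2 of
    [logder_near]. *)
Definition bev k : R[i] := if odd k then 0 else bcoef k.

Lemma bev_summ z : cabs z <= 2^-1 -> summ (fun k => bev k * z ^+ k).
Proof.
move=> /bcoef_summ; apply: summ_dom => k; rewrite /bev; case: ifP => // _.
by rewrite mul0r cabs0 cabs_ge0.
Qed.

Lemma bev_sum z : cabs z <= 2^-1 -> 1 - expc z != 0 ->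
  csum (fun k => bev k * z ^+ k) = z * (2^-1 + (expc z - 1)^-1).
Proof.
move=> hz ez.
have hN : cabs (- z) <= 2^-1 by rewrite cabsN.
have b1 := bsumE hz; have b2 := bsumE hN.
have e1 : expc z - 1 != 0 by rewrite -opprB oppr_eq0.
have e0 := expc_neq0 z.
have B1 : bsum z = z / (expc z - 1) by rewrite -{2}b1 mulfK.
have eN : expc (- z) - 1 = (1 - expc z) / expc z by rewrite expcN; field.
have B2 : bsum (- z) = - z * expc z / (1 - expc z).
  rewrite -{2}b2 eN; field; by rewrite e0 ez.
have -> : csum (fun k => bev k * z ^+ k) = (bsum z + bsum (- z)) / 2.
  rewrite /bsum -csumD; [|exact: bcoef_summ|exact: bcoef_summ].
  rewrite mulrC -csumZ; last by apply: summD; exact: bcoef_summ.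
  apply: eq_csum => k; rewrite exprNn -signr_odd /bev.
  by case: (odd k); rewrite ?expr1 ?expr0; field.
by rewrite B1 B2; field; rewrite ez e1.
Qed.

Lemma bev0 : bev 0 = 1.
Proof. exact: bcoef0. Qed.

End BernoulliSeries.

Lemma summ_natS (R : realType) (u : nat -> R[i]) : summ (fun k => u k.+1) -> summ u.
Proof.
move=> s; pose g k := if k is 0 then 0 else u k.
have sg : summ g.
  apply/(summ_inj (e := S)) => [k l [] //|[|k] // h|]; last exact: s.
have [|s0 _] := @csum_single _ _ 0%N (fun k => if k is 0 then u 0%N else 0) => [[]//|].
by apply: eq_summ (summD s0 sg) => -[|k]; rewrite /g ?addr0 ?add0r.
Qed.

Section LaurentExpansion.
Variables (R : realType) (tau : R[i]).
Hypothesis htau : 0 < complex.Im tau.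
Local Notation q := (q tau).
Local Notation width := (width tau).
Local Notation Theta := (Theta tau).
Local Notation dTheta := (dTheta tau).

(** The coefficient of z^k in 1 / z - Theta' / Theta, hence the Eisenstein series of weight k + 1,
    which explains the shift in [bev]. *)
Definition ecoef k : R[i] := kcoef tau k - bev R k.+1.
Definition lcoef k : R[i] := ecoef k.-1 / k%:R.

Lemma ecoef0 : ecoef 0 = 0.
Proof. by rewrite /ecoef kcoefE//= subr0. Qed.

Lemma eisensteinE j : eisenstein j.+2 tau = ecoef j.+1.
Proof.
rewrite /eisenstein /ecoef kcoefE// /bev/= negbK.
case: ifPn => oj; first by rewrite subr0.
rewrite addrC; congr (_ * _ - _).
rewrite -limn_csum; last exact: lam_pow_summ.
congr (limn (series _)); apply/funext => s.
by rewrite /lam [RHS]mulrC mulrA.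
Qed.

(** 1/2 is the radius of the Bernoulli estimates and [width / 2] that of [Kr0_ps]. *)
Definition erad : R := Num.min 2^-1 (width / 2).

Lemma erad_gt0 : 0 < erad.
Proof. by rewrite lt_min invr_gt0 ltr0n (width2_gt0 htau). Qed.

Lemma ecoef_ps : has_ps ecoef erad (fun z => csum (fun k => ecoef k * z ^+ k)) 0.
Proof.
split; [exact: erad_gt0| |by move=> h _; rewrite add0r].
have [w0 s _] := Kr0_ps htau.
have e0 := erad_gt0.
have ce : cabs (erad%:C : R[i]) = erad by rewrite cabs_real gtr0_norm.
have h1 : cabs (erad%:C : R[i]) <= width / 2 by rewrite ce ge_min lexx orbT.
have h2 : cabs (erad%:C : R[i]) <= 2^-1 by rewrite ce ge_min lexx.
have s1 := ps_summ h1 s.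
have [s2 _] := csum_natS (bev_summ h2).
have r0 : erad%:C != 0 :> R[i] by rewrite -cabs_gt0 ce.
have s3 : summ (fun k => bev R k.+1 * erad%:C ^+ k).
  by apply: eq_summ (summZ (erad%:C)^-1 s2) => k; rewrite exprS; field.
apply: eq_summ (summD s1 (summN s3)) => k.
by rewrite /ecoef mulrBl.
Qed.

Lemma ecoef_summ z : cabs z <= erad -> summ (fun k => ecoef k * z ^+ k).
Proof. by move=> hz; have [_ s _] := ecoef_ps; exact: ps_summ s. Qed.

Definition esumz z := csum (fun k => ecoef k * z ^+ k).
Definition lsumz z := csum (fun k => lcoef k * z ^+ k).

Lemma esumzE z : cabs z <= erad -> 1 - expc z != 0 ->
  z * esumz z = z * Kr0 tau z - (z * (2^-1 + (expc z - 1)^-1) - 1).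
Proof.
move=> hz ez; rewrite le_min in hz; have /andP[h2 h1] := hz.
have [_ sk KE] := Kr0_ps htau.
have s1 := ps_summ h1 sk.
have [s2 E2] := csum_natS (bev_summ h2).
have -> : Kr0 tau z = csum (fun k => kcoef tau k * z ^+ k) by rewrite -(KE _ h1) add0r.
rewrite -(bev_sum h2 ez) E2 expr0 mulr1 bev0 addrAC subrr add0r.
rewrite -(csumZ _ s1) -(csumB (summZ z s1) s2) /esumz -csumZ; last first.
  by apply: ecoef_summ; rewrite le_min.
apply: eq_csum => k; rewrite /ecoef exprS; ring.
Qed.

Lemma logder_esumz : \forall z \near (0 : R[i])^',
  [/\ Theta z != 0, z != 0 & dTheta z / Theta z = z^-1 - esumz z].
Proof.
have PF := dnbhsc_proper (0 : R[i]).
have near_e : \forall z \near (0 : R[i])^', z != 0 /\ cabs z <= erad.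
  apply/dnbhscP; exists erad; first exact: erad_gt0.
  by move=> w w0; rewrite subr0 => /ltW.
apply: filterS2 near_e (logder_near htau) => z [z0 hz] [Tz ez ->]; split=> //.
apply: (mulfI z0); rewrite !mulrBr esumzE// mulfV//; ring.
Qed.

Lemma P1_series z : cabs z <= erad ->
  limn (series (fun j : nat => let k := j.+2 in eisenstein k tau * z ^+ k.-1)) = esumz z.
Proof.
move=> /ecoef_summ s; have [s' E] := csum_natS s.
rewrite /esumz E ecoef0 mul0r add0r -(limn_csum s').
by congr (limn (series _)); apply/funext => j /=; rewrite eisensteinE.
Qed.

Lemma lcoef_summ z : cabs z <= erad -> summ (fun k => lcoef k * z ^+ k).
Proof.
move=> hz; have s := ecoef_summ hz.
apply: summ_natS; apply: summ_dom (summZ z s) => k.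
rewrite /lcoef/= exprS (_ : _ * _ = k.+1%:R^-1 * (z * (ecoef k * z ^+ k))); last by ring.
rewrite (cabsM k.+1%:R^-1); apply: ler_piMl; first exact: cabs_ge0.
by rewrite cabsV cabs_nat invf_le1 ?ltr0n// ler1n.
Qed.

Lemma lcoef0 : lcoef 0 = 0.
Proof. by rewrite /lcoef ecoef0 mul0r. Qed.

Lemma lcoef1 : lcoef 1 = 0.
Proof. by rewrite /lcoef ecoef0 mul0r. Qed.

Lemma prime_form_series z : cabs z <= erad ->
  limn (series (fun j : nat => let k := j.+2 in
    k%:R^-1 * eisenstein k tau * z ^+ k)) = lsumz z.
Proof.
move=> /lcoef_summ s; have [s1 E1] := csum_natS s; have [s2 E2] := csum_natS s1.
rewrite /lsumz E1 E2 lcoef0 lcoef1 !mul0r !add0r -(limn_csum s2).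
congr (limn (series _)); apply/funext => j /=; rewrite eisensteinE /lcoef/=.
by rewrite [_^-1 * _]mulrC.
Qed.

Lemma lsumz_Cder z : cabs z < erad -> Cder lsumz z (esumz z).
Proof.
move=> hz.
have ps : has_ps lcoef erad lsumz 0.
  split; [exact: erad_gt0| |by move=> h _; rewrite add0r].
  by apply: lcoef_summ; rewrite cabs_real gtr0_norm ?erad_gt0.
have [s D] := ps_deriv ps hz.
rewrite (_ : esumz z = csum (fun k => lcoef k * k%:R * z ^+ k.-1)) //.
have [_ ->] := csum_natS s; rewrite mulr0 mul0r add0r.
by apply: eq_csum => k; rewrite /lcoef/= divfK ?pnatr_eq0.
Qed.

Lemma lsumz0 : lsumz 0 = 0.
Proof.
have [|_ E] := @csum_single _ _ 0%N (fun k => lcoef k * 0 ^+ k).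
  by move=> k /negbTE k0; rewrite expr0n k0 mulr0.
by rewrite /lsumz E lcoef0 mul0r.
Qed.

End LaurentExpansion.

(** * Identification of P_1 and of the prime form *)

Section ClassicalFunctions.
Variables (R : realType) (tau : R[i]).
Hypothesis htau : 0 < complex.Im tau.
Local Notation Theta := (Theta tau).
Local Notation dTheta := (dTheta tau).

Lemma Theta_exists : exists z, Theta z != 0.
Proof. exists (zn tau 0); exact: (Theta_neq0 htau (zn_regular htau 0)). Qed.

Lemma logder_mero : meromorphic (fun z => dTheta z / Theta z).
Proof.
apply: div_mero.
- exact: dTheta_entire.
- exact: Theta_entire.
- by move=> z /(dTheta_neq0 htau).
- exact: Theta_exists.
Qed.

Lemma near0_erad : \forall z \near (0 : R[i]), cabs z <= erad tau.
Proof.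
apply/nbhscP; exists (erad tau); first exact: erad_gt0.
by move=> w; rewrite subr0 => /ltW.
Qed.

Lemma logder_is_P1 : is_P1 tau (fun z => dTheta z / Theta z).
Proof.
split; first exact: logder_mero.
have PF := dnbhsc_proper (0 : R[i]).
apply: filterS2 (logder_esumz htau) (nbhs_dnbhs near0_erad) => z [_ _ E] hz.
rewrite E; congr (_ - _); by rewrite P1_series.
Qed.

(** [P1] is chosen by [xget], so only [is_P1] is known of it. The explicit quotient satisfies
    [is_P1] too, and the identity theorem makes both equal wherever the quotient is analytic. *)
Lemma P1E z : Theta z != 0 -> P1 tau z = dTheta z / Theta z.
Proof.
move=> Tz.
have [m1 n1] : is_P1 tau (P1 tau).
  apply: (@xgetPex _ (fun=> 0) [set f | is_P1 tau f]).
  exists (fun z => dTheta z / Theta z); exact: logder_is_P1.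
have [m2 n2] := logder_is_P1.
have PF := dnbhsc_proper (0 : R[i]).
apply: (@mero_eq _ _ (fun z => dTheta z / Theta z) 0 z m1 m2).
  by apply: filterS2 n1 n2 => w -> ->.
exact: (analytic_div (dTheta_entire htau z) (Theta_entire htau z) Tz).
Qed.

(** Its logarithmic derivative Theta' / Theta - 1 / w + esumz is 0 near 0, so it is constant there;
    exponentiating [lsumz] keeps clear of branches of the logarithm. The value at 0 is the limit. *)
Definition Gaux w : R[i] :=
  if w == 0 then dTheta 0 else Theta w * w^-1 * expc (lsumz tau w).

Lemma Gaux_tends0 : tends (nbhs (0 : R[i])) Gaux (dTheta 0).
Proof.
have [p [p0 pl E]] := Theta_Cder htau 0.
have L : tends (nbhs (0 : R[i])) (fun w => p w * expc (lsumz tau w)) (dTheta 0 * 1).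
  apply: (tendsM pl).
  have Lc : tends (nbhs (0 : R[i])) (lsumz tau) 0.
    rewrite -[X in tends _ _ X](lsumz0 htau); apply: Cder_tends.
    apply: lsumz_Cder => //; rewrite cabs0; exact: erad_gt0.
  have Ec : tends (nbhs (0 : R[i])) (@expc R) 1.
    by have H := expc_tends (0 : R[i]); rewrite expc0 in H; exact: H.
  by apply: tends_comp Ec; exact: tends_nbhs Lc _.
rewrite mulr1 in L.
apply: tends_near L; apply: filterS E => w; rewrite Theta0// add0r subr0 => Ew.
rewrite /Gaux; have [->|w0] := eqVneq w 0.
  by rewrite p0 lsumz0// expc0 mulr1.
by rewrite Ew mulfK.
Qed.

Lemma Gaux_Cder w : w != 0 -> cabs w < erad tau -> Theta w != 0 ->
  dTheta w / Theta w = w^-1 - esumz tau w -> Cder Gaux w 0.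
Proof.
move=> w0 hw Tw h.
have D1 := CderM (Theta_Cder htau w) (Cder_inv w0).
have D2 : Cder (fun w => expc (lsumz tau w)) w (expc (lsumz tau w) * esumz tau w).
  apply: (Cder_comp (f := @expc R)); last exact: Cder_expc.
  exact: lsumz_Cder.
have D := CderM D1 D2.
have -> : 0 = (dTheta w * w^-1 + Theta w * - w^-1 ^+ 2) * expc (lsumz tau w) +
              Theta w * w^-1 * (expc (lsumz tau w) * esumz tau w).
  have -> : esumz tau w = w^-1 - dTheta w / Theta w by rewrite h; ring.
  by field; rewrite w0 Tw.
apply: Cder_near D; apply/nbhscP; exists (cabs w); first by rewrite cabs_gt0.
move=> u uw; rewrite /Gaux ifN//; apply: contraTneq uw => ->.
by rewrite sub0r cabsN ltxx.
Qed.

Lemma Theta_exp : \forall z \near (0 : R[i]),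
  Theta z = dTheta 0 * (z * expc (- lsumz tau z)).
Proof.
have /dnbhscP[e e0 h] := logder_esumz htau.
have r0 := erad_gt0 htau.
apply/nbhscP; exists (Num.min e (erad tau)); first by rewrite lt_min e0 r0.
move=> z; rewrite subr0 lt_min => /andP[ze zr].
have [->|z0] := eqVneq z 0; first by rewrite Theta0// mul0r mulr0.
have zpos : 0 < cabs z by rewrite cabs_gt0.
have Cd w : w != 0 -> cabs w <= cabs z -> Cder Gaux w 0.
  move=> w0 wz; have we : cabs (w - 0) < e by rewrite subr0; exact: le_lt_trans wz ze.
  have [Tw _ E] := h _ w0 we.
  by apply: Gaux_Cder => //; exact: le_lt_trans wz zr.
have tz (t : R) : 0 <= t <= 1 -> cabs (t%:C * z) <= cabs z.
  by move=> /andP[t0 t1]; rewrite cabsM cabs_real ger0_norm// ler_piMl// ltW.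
have : Gaux z = Gaux 0.
  apply: Cder0_const => t.
    move=> /andP[t0 t1]; apply: Cd; last by apply: tz; rewrite !ltW.
    by rewrite mulf_neq0// -cabs_gt0 cabs_real normr_gt0 gt_eqF.
  move=> ht; have [->|w0] := eqVneq (t%:C * z) 0.
    by rewrite {2}/Gaux eqxx; exact: Gaux_tends0.
  by apply: Cder_tends (Cd _ w0 (tz _ ht)).
rewrite /Gaux eqxx (negbTE z0) => <-.
rewrite expcN; have en := expc_neq0 (lsumz tau z); by field; rewrite z0 en.
Qed.

Definition Kf z : R[i] := (dTheta 0)^-1 * Theta z.

Lemma Kf_is_prime_form : is_prime_form tau Kf.
Proof.
split; first by move=> z; apply: analyticZ; exact: Theta_entire.
apply: filterS2 Theta_exp near0_erad => z E hz.
by rewrite /Kf E mulKf ?dTheta0_neq0// prime_form_series.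
Qed.

Lemma prime_formE z : prime_form tau z = (dTheta 0)^-1 * Theta z.
Proof.
have [e1 n1] : is_prime_form tau (prime_form tau).
  apply: (@xgetPex _ (fun=> 0) [set f | is_prime_form tau f]).
  exists Kf; exact: Kf_is_prime_form.
have [e2 n2] := Kf_is_prime_form.
apply: (entire_eq (z0 := 0) e1 e2).
by apply: filterS2 n1 n2 => w -> ->.
Qed.

End ClassicalFunctions.

(** * Frobenius's determinant *)

Section Determinants.
Variable F : fieldType.

Lemma det_pivot n (M : 'M[F]_n.+1) : M 0 0 != 0 ->
  \det M = M 0 0 * \det (\matrix_(i < n, j < n)
    (M (lift ord0 i) (lift ord0 j) - M (lift ord0 i) 0 * M 0 (lift ord0 j) / M 0 0)).
Proof.
move=> a0; set N := (X in _ = _ * \det X).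
have E : (M : 'M[F]_(1 + n)) = block_mx 1%:M 0 (\col_i (M (lift ord0 i) 0 / M 0 0)) 1%:M *m
             block_mx (M 0 0)%:M (\row_j M 0 (lift ord0 j)) 0 N.
  rewrite mulmx_block !mul1mx !mul0mx !addr0 mul_mx_scalar.
  apply/matrixP => i j; rewrite !mxE; case: split_ordP => k ->; rewrite !mxE;
    case: split_ordP => l ->; rewrite ?ord1 ?lshift0 ?rshift1 !mxE ?eqxx ?mulr1n//.
    by rewrite mulrC divfK.
  rewrite big_ord_recl big_ord0 !mxE addr0; field; exact: a0.
have := congr1 (@determinant F (1 + n)) E.
by rewrite det_mulmx det_lblock det_ublock !det1 !mul1r det_scalar1.
Qed.

Lemma det_scale n (M : 'M[F]_n) (a b : 'I_n -> F) :
  \det (\matrix_(i, j) (a i * b j * M i j)) =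
  (\prod_i a i) * (\prod_i b i) * \det M.
Proof.
have -> : \matrix_(i, j) (a i * b j * M i j) =
   diag_mx (\row_i a i) *m M *m diag_mx (\row_i b i).
  by rewrite mul_diag_mx mul_mx_diag; apply/matrixP => i j; rewrite !mxE mulrAC.
rewrite !det_mulmx !det_diag mulrAC; congr (_ * _ * _);
  by apply: eq_bigr => i _; rewrite mxE.
Qed.

(** Starting from the block triangular matrix of [M] with corner [- k], add - 1 / k times the last
    row to the others. The term common to all entries, which becomes infinite as [k] tends to 0, is
    thereby traded for a harmless border. *)
Lemma det_bordered n (M : 'M[F]_n) k : k != 0 ->
  \det (block_mx (\matrix_(i, j) (M i j - k^-1)) (const_mx 1 : 'cV[F]_n)
                 (const_mx 1 : 'rV[F]_n) (- k)%:M) = - k * \det M.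
Proof.
move=> k0; have -> : block_mx (\matrix_(i, j) (M i j - k^-1)) (const_mx 1 : 'cV[F]_n)
    (const_mx 1 : 'rV[F]_n) (- k)%:M =
  block_mx 1%:M (const_mx (- k^-1)) 0 1%:M *m block_mx M 0 (const_mx 1) (- k)%:M.
  rewrite mulmx_block !mul1mx !mul0mx !add0r mul_mx_scalar.
  congr block_mx; apply/matrixP => i j; rewrite !mxE.
    by rewrite big_ord_recl big_ord0 !mxE addr0 mulr1.
  by rewrite mulNr mulrN opprK mulfV.
by rewrite det_mulmx det_ublock det_lblock !det1 !mul1r det_scalar1 mulrC.
Qed.

Lemma prod_lt_recl n (G : 'I_n.+1 -> 'I_n.+1 -> F) :
  \prod_(i < n.+1) \prod_(j < n.+1 | (i < j)%N) G i j =
  (\prod_(j < n) G ord0 (lift ord0 j)) *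
  \prod_(i < n) \prod_(j < n | (i < j)%N) G (lift ord0 i) (lift ord0 j).
Proof.
rewrite big_ord_recl; congr (_ * _).
  by rewrite big_mkcond big_ord_recl/= mul1r.
apply: eq_bigr => i _; rewrite big_mkcond big_ord_recl/= mul1r [RHS]big_mkcond.
by apply: eq_bigr => j _.
Qed.

Lemma prod_recl2 n (G : 'I_n.+1 -> 'I_n.+1 -> F) :
  \prod_(i < n.+1) \prod_(j < n.+1) G i j =
  G ord0 ord0 * (\prod_(j < n) G ord0 (lift ord0 j)) *
  (\prod_(i < n) G (lift ord0 i) ord0) *
  \prod_(i < n) \prod_(j < n) G (lift ord0 i) (lift ord0 j).
Proof.
rewrite big_ord_recl big_ord_recl -!mulrA; congr (_ * (_ * _)).
by rewrite -big_split; apply: eq_bigr => i _; rewrite big_ord_recl.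
Qed.

Definition cauchy_ratio n (K : F -> F) (x y : 'I_n -> F) : F :=
  (\prod_(i < n) \prod_(j < n | (i < j)%N) (K (x i - x j) * K (y i - y j))) /
  \prod_(i < n) \prod_(j < n) K (x i - y j).

End Determinants.

(** * Frobenius's formula and its degeneration at s = 0 *)

Section Frobenius.
Variables (R : realType) (K : R[i] -> R[i]).
Hypothesis K_odd : forall z, K (- z) = - K z.
Hypothesis K_entire : entire K.
Hypothesis K_isolated : forall z0, \forall z \near z0^', K z != 0.
Hypothesis K_three_term : forall s x1 x2 y1 y2,
  K (x1 + x2 - y1 - y2 + s) * K s * K (x1 - x2) * K (y2 - y1) =
  K (x1 - y1 + s) * K (x2 - y2 + s) * K (x1 - y2) * K (x2 - y1) -
  K (x1 - y2 + s) * K (x2 - y1 + s) * K (x1 - y1) * K (x2 - y2).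

Definition frob_kernel s z := K (z + s) / (K z * K s).

Definition frob_formula n (x y : 'I_n -> R[i]) s :=
  \det (\matrix_(i < n, j < n) frob_kernel s (x i - y j)) =
  (-1) ^+ 'C(n, 2) * (K (\sum_(i < n) (x i - y i) + s) / K s) * cauchy_ratio K x y.

Lemma near_punct_shift (P : R[i] -> Prop) s0 c :
  (\forall s \near (s0 + c)^', P s) -> \forall s \near s0^', P (s + c).
Proof.
move=> /dnbhscP[e e0 h]; apply/dnbhscP; exists e => // s ss0 hs; apply: h.
  by rewrite (inj_eq (addIr c)).
by rewrite opprD addrACA subrr addr0.
Qed.

Lemma frob_kernel_pivot s x1 x2 y1 y2 :
  K s != 0 -> K (s + (x1 - y1)) != 0 -> K (x1 - y1) != 0 -> K (x1 - y2) != 0 ->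
  K (x2 - y1) != 0 -> K (x2 - y2) != 0 ->
  frob_kernel s (x2 - y2) -
    frob_kernel s (x2 - y1) * frob_kernel s (x1 - y2) / frob_kernel s (x1 - y1) =
  K (x1 - x2) / K (x2 - y1) * (K (y2 - y1) / K (x1 - y2)) *
    frob_kernel (s + (x1 - y1)) (x2 - y2).
Proof.
rewrite /frob_kernel [s + _]addrC => Ks Ks' K11 K12 K21 K22.
have := K_three_term s x1 x2 y1 y2.
have -> : x1 + x2 - y1 - y2 + s = x2 - y2 + (x1 - y1 + s) by ring.
move: (K (x1 - y1 + s)) (K (x2 - y2 + (x1 - y1 + s))) (K (x1 - x2)) (K (y2 - y1)) Ks' => a b c d a0 H.
transitivity ((a * K (x2 - y2 + s) * K (x1 - y2) * K (x2 - y1) -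
  K (x1 - y2 + s) * K (x2 - y1 + s) * K (x1 - y1) * K (x2 - y2)) /
  (a * K s * K (x2 - y2) * K (x1 - y2) * K (x2 - y1))).
  by field; rewrite Ks a0 K11 K12 K21 K22.
by rewrite -H; field; rewrite Ks a0 K12 K21 K22.
Qed.

(** Each pivot asks that neither the current parameter nor its shift by [x ord0 - y ord0] be a zero
    of [K]. This fails only for isolated [s], so the induction runs on punctured neighbourhoods of
    an arbitrary [s0]; [frobenius] concludes by continuity. *)
Lemma frob_near n (x y : 'I_n -> R[i]) : (forall i j, K (x i - y j) != 0) ->
  forall s0, \forall s \near s0^', frob_formula x y s.
Proof.
elim: n x y => [|n IH] x y Kxy s0; have PF := dnbhsc_proper s0.
  apply: filterS (K_isolated s0) => s Ks.
  by rewrite /frob_formula /cauchy_ratio det_mx00 !big_ord0 add0r mulfV// mulfV ?oner_eq0// !mulr1.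
pose x' i := x (lift ord0 i); pose y' i := y (lift ord0 i).
pose c := x ord0 - y ord0.
have := IH x' y' (fun i j => Kxy _ _) (s0 + c); move=> /near_punct_shift IHs.
have Ksc := near_punct_shift (K_isolated (s0 + c)).
apply: filterS3 (K_isolated s0) Ksc IHs => s Ks Kc; rewrite /frob_formula => E.
have Fc : frob_kernel s c = K (s + c) / (K c * K s) by rewrite /frob_kernel addrC.
have M00 : frob_kernel s c != 0.
  by rewrite Fc mulf_neq0// invr_neq0// mulf_neq0// Kxy.
rewrite det_pivot !mxE//.
pose a i := K (x ord0 - x' i) / K (x' i - y ord0).
pose b j := K (y' j - y ord0) / K (x ord0 - y' j).
pose N := \matrix_(i < n, j < n) frob_kernel (s + c) (x' i - y' j).
rewrite (_ : \matrix_(i, j) _ = \matrix_(i < n, j < n) (a i * b j * N i j)); last first.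
  by apply/matrixP => i j; rewrite !mxE (frob_kernel_pivot Ks Kc).
rewrite det_scale E /a /b.
rewrite -/c Fc /cauchy_ratio prod_lt_recl prod_recl2 big_ord_recl -/c.
rewrite !prodf_div.
have -> : \prod_(j < n) (K (x ord0 - x (lift ord0 j)) * K (y ord0 - y (lift ord0 j))) =
  (\prod_(j < n) K (x ord0 - x' j)) * \prod_(j < n) K (y ord0 - y' j) by rewrite big_split.
(* Turning the [n] factors to the order of the right-hand side yields (-1)^n, the step from 'C(n, 2)
   to 'C(n.+1, 2). *)
have -> : \prod_(i < n) K (y' i - y ord0) = (-1) ^+ n * \prod_(i < n) K (y ord0 - y' i).
  rewrite -[n in _ ^+ n]card_ord -prodrN; apply: eq_bigr => i _.
  by rewrite -K_odd opprB.
have -> : \sum_(i < n) (x' i - y' i) + (s + c) = c + \sum_(i < n) (x' i - y' i) + s by ring.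
rewrite binS bin1 exprD.
have D1 : \prod_(i < n) K (x' i - y ord0) != 0 by apply/prodf_neq0 => i _; exact: Kxy.
have D2 : \prod_(i < n) K (x ord0 - y' i) != 0 by apply/prodf_neq0 => i _; exact: Kxy.
have D3 : \prod_(i < n) \prod_(j < n) K (x' i - y' j) != 0.
  by apply/prodf_neq0 => i _; apply/prodf_neq0 => j _; exact: Kxy.
have Kc0 : K c != 0 by exact: Kxy.
move: D1 D2 D3; rewrite /x' /y'.
move: (\prod_(i < n) K (x _ - y ord0)) => d1.
move: (\prod_(i < n) K (x ord0 - y _)) => d2.
move: (\prod_(i < n) \prod_(j < n) K (x _ - y _)) => d3 D1 D2 D3.
by field; rewrite Ks Kc Kc0 D1 D2 D3.
Qed.

Lemma frobenius n (x y : 'I_n -> R[i]) s : (forall i j, K (x i - y j) != 0) ->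
  K s != 0 -> frob_formula x y s.
Proof.
move=> Kxy Ks; have PF := dnbhsc_proper s.
have Kz z : tends (s^') (fun t => K (z + t)) (K (z + s)).
  rewrite addrC; apply: tends_ext (tends_shift (K_entire (s + z))) => t.
  by rewrite addrC.
have KV : tends (s^') (fun t => (K t)^-1) (K s)^-1.
  by apply: tendsV => //; apply: tends_punct; exact: analytic_tends.
have L : tends (s^') (fun t => \det (\matrix_(i < n, j < n) frob_kernel t (x i - y j)))
                     (\det (\matrix_(i < n, j < n) frob_kernel s (x i - y j))).
  apply: tends_det => i j; rewrite mxE.
  have H : tends (s^') (fun t => K (x i - y j + t) * ((K (x i - y j))^-1 * (K t)^-1))
     (K (x i - y j + s) * ((K (x i - y j))^-1 * (K s)^-1)).
    by apply: tendsM (Kz _) _; apply: tendsM KV; exact: tends_cst.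
  rewrite /frob_kernel invfM; apply: tends_ext H => t.
  by rewrite mxE /frob_kernel invfM.
apply: (tends_unique L).
have H : tends (s^') (fun t => (-1) ^+ 'C(n, 2) * (K (\sum_(i < n) (x i - y i) + t) * (K t)^-1) * cauchy_ratio K x y)
   ((-1) ^+ 'C(n, 2) * (K (\sum_(i < n) (x i - y i) + s) / K s) * cauchy_ratio K x y).
  apply: tendsM; last exact: tends_cst.
  apply: tendsM; first exact: tends_cst.
  exact: tendsM (Kz _) KV.
apply: tends_near H; apply: filterS (frob_near Kxy s) => t.
by rewrite /frob_formula => ->.
Qed.

Section Degenerate.
Variable dK : R[i] -> R[i].
Hypothesis K_Cder : forall z, Cder K z (dK z).
Hypothesis K0 : K 0 = 0.
Hypothesis dK0 : dK 0 = 1.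

(** The difference is (K (s + z) - K z) / K s divided by K z, and K s behaves like s at 0. *)
Lemma frob_kernel_expand z : K z != 0 ->
  tends ((0 : R[i])^') (fun s => frob_kernel s z - (K s)^-1) (dK z / K z).
Proof.
move=> Kz.
have D1 : Cder (fun s => K (s + z) - K z) 0 (dK z).
  by apply/Cder_subc/Cder_shift; rewrite add0r.
have D2 : Cder K 0 1 by rewrite -dK0.
have H : tends ((0 : R[i])^') (fun s => (K (s + z) - K z) / K s) (dK z / 1).
  by apply: Cder_quotient D1 D2 _ K0 _; [rewrite add0r subrr|exact: oner_neq0].
have H2 : tends ((0 : R[i])^') (fun s => (K (s + z) - K z) / K s * (K z)^-1) (dK z / 1 * (K z)^-1).
  by apply: tendsM H _; exact: tends_cst.
rewrite divr1 in H2; apply: tends_near H2.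
by apply: filterS (K_isolated 0) => s Ks; rewrite /frob_kernel [z + s]addrC; field; rewrite Ks Kz.
Qed.

(** With 1 / K s subtracted from the kernels and corner [- K s], the bordered determinant is - K s
    times Frobenius's. The factor K s cancels the denominator of his formula, and every entry of the
    bordered matrix has a limit at s = 0. *)
Lemma frobenius_degenerate n (x y : 'I_n -> R[i]) :
  (forall i j, K (x i - y j) != 0) ->
  \det (block_mx (\matrix_(i < n, j < n) (dK (x i - y j) / K (x i - y j)))
                 (const_mx 1 : 'cV[R[i]]_n) (const_mx 1 : 'rV[R[i]]_n)
                 (0 : 'M[R[i]]_1)) =
  - ((-1) ^+ 'C(n, 2) * K (\sum_(i < n) (x i - y i)) * cauchy_ratio K x y).
Proof.
move=> Kxy; have PF := dnbhsc_proper (0 : R[i]); set X := \sum_(i < n) _.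
pose B s := block_mx (\matrix_(i < n, j < n) (frob_kernel s (x i - y j) - (K s)^-1))
                 (const_mx 1 : 'cV[R[i]]_n) (const_mx 1 : 'rV[R[i]]_n) (- K s)%:M.
have Kc z : tends ((0 : R[i])^') (fun s => K (s + z)) (K z).
  by have := tends_shift (K_entire (0 + z)); rewrite add0r.
have L1 : tends ((0 : R[i])^') (fun s => \det (B s))
  (\det (block_mx (\matrix_(i < n, j < n) (dK (x i - y j) / K (x i - y j)))
                 (const_mx 1 : 'cV[R[i]]_n) (const_mx 1 : 'rV[R[i]]_n)
                 (0 : 'M[R[i]]_1))).
  apply: tends_det => i j; rewrite !mxE.
  case: (split_ordP i) => k ->{i}; rewrite !mxE; case: (split_ordP j) => l ->{j}; rewrite !mxE.
  - apply: tends_ext (frob_kernel_expand (Kxy k l)) => s.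
    by rewrite block_mxEul mxE.
  - by apply: tends_ext (tends_cst 1) => s; rewrite block_mxEur mxE.
  - by apply: tends_ext (tends_cst 1) => s; rewrite block_mxEdl mxE.
  - have KN : tends ((0 : R[i])^') (fun s => - K s) 0.
      rewrite -[X in tends _ _ X]oppr0; apply: tendsN.
      have := Kc 0; rewrite K0; apply: tends_ext => s; by rewrite addr0.
    by apply: tends_ext KN => s; rewrite block_mxEdr !ord1 mxE.
have L2 : tends ((0 : R[i])^') (fun s => - ((-1) ^+ 'C(n, 2) * K (s + X) * cauchy_ratio K x y))
   (- ((-1) ^+ 'C(n, 2) * K X * cauchy_ratio K x y)).
  apply: tendsN; apply: tendsM; last exact: tends_cst.
  apply: tendsM (Kc X); exact: tends_cst.
apply: (tends_unique L1); apply: tends_near L2.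
apply: filterS (K_isolated 0) => s Ks.
have := frobenius Kxy Ks; rewrite /frob_formula -/X [X + s]addrC => E.
pose M := \matrix_(i < n, j < n) frob_kernel s (x i - y j).
have -> : B s = block_mx (\matrix_(i, j) (M i j - (K s)^-1)) (const_mx 1 : 'cV[R[i]]_n)
                 (const_mx 1 : 'rV[R[i]]_n) (- K s)%:M.
  by congr block_mx; apply/matrixP => i j; rewrite !mxE.
by rewrite det_bordered// E; field.
Qed.

End Degenerate.
End Frobenius.

(** * The prime form as a Frobenius kernel *)

Section PrimeFormKernel.
Variables (R : realType) (tau : R[i]).
Hypothesis htau : 0 < complex.Im tau.
Local Notation Theta := (Theta tau).
Local Notation dTheta := (dTheta tau).
Local Notation period := (period tau).
Local Notation width := (width tau).
Local Notation K := (prime_form tau).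

Lemma prime_form_odd z : K (- z) = - K z.
Proof. by rewrite !prime_formE// (Theta_odd htau) mulrN. Qed.

Lemma prime_form_funE : K = (fun z => (dTheta 0)^-1 * Theta z).
Proof. by apply/funext => z; rewrite prime_formE. Qed.

Lemma prime_form_entire : entire K.
Proof. by rewrite prime_form_funE => z; apply: analyticZ; exact: Theta_entire. Qed.

Lemma prime_form_neq0 z : Theta z != 0 -> K z != 0.
Proof.
by move=> Tz; rewrite prime_formE// mulf_neq0// invr_neq0// dTheta0_neq0.
Qed.

Lemma prime_form_isolated z0 : \forall z \near z0^', K z != 0.
Proof.
have PF := dnbhsc_proper z0.
by apply: filterS (Theta_isolated htau z0) => z; exact: prime_form_neq0.
Qed.

Lemma prime_form_three_term s x1 x2 y1 y2 :
  K (x1 + x2 - y1 - y2 + s) * K s * K (x1 - x2) * K (y2 - y1) =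
  K (x1 - y1 + s) * K (x2 - y2 + s) * K (x1 - y2) * K (x2 - y1) -
  K (x1 - y2 + s) * K (x2 - y1 + s) * K (x1 - y1) * K (x2 - y2).
Proof.
rewrite prime_form_funE; move: (Theta_three_term htau s x1 x2 y1 y2).
move: (dTheta 0)^-1 => c; move: (Theta (_ + s)) => A.
move: (Theta (x1 - y1 + s)) (Theta (x2 - y2 + s)) (Theta (x1 - y2 + s)) (Theta (x2 - y1 + s)) => B1 B2 B3 B4.
move: (Theta s) (Theta (x1 - x2)) (Theta (y2 - y1)) => S1 S2 S3.
move: (Theta (x1 - y1)) (Theta (x2 - y2)) (Theta (x1 - y2)) (Theta (x2 - y1)) => C1 C2 C3 C4 E.
transitivity (c ^+ 4 * (A * S1 * S2 * S3)); first by ring.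
by rewrite E; ring.
Qed.

Lemma prime_form_Cder z : Cder K z ((dTheta 0)^-1 * dTheta z).
Proof. by rewrite prime_form_funE; apply: CderZ; exact: Theta_Cder. Qed.

Lemma prime_form0 : K 0 = 0.
Proof. by rewrite prime_formE// (Theta0 htau) mulr0. Qed.

Lemma prime_form_kernelE s z : Theta z != 0 -> Theta s != 0 ->
  frob_kernel K s z = dTheta 0 / Theta s * Theta (z + s) / Theta z.
Proof.
move=> Tz Ts; have d0 := dTheta0_neq0 htau.
by rewrite /frob_kernel !prime_formE//; field; rewrite d0 Tz Ts.
Qed.

Lemma P1_prime_form z : Theta z != 0 ->
  P1 tau z = (dTheta 0)^-1 * dTheta z / K z.
Proof.
move=> Tz; have d0 := dTheta0_neq0 htau.
by rewrite P1E// prime_formE//; field; rewrite d0 Tz.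
Qed.

Lemma strip_annulus z : `|nome tau| < `|expc z| < 1 <-> - width < complex.Re z < 0.
Proof.
rewrite -!cabsE -[1 in X in X <-> _](_ : (1 : R)%:C = 1)// !ltcR cabs_expc.
rewrite (_ : cabs (nome tau) = expR (- width)); last exact: cabs_q.
by rewrite ltr_expR expR_lt1.
Qed.

End PrimeFormKernel.

(** * The twisted Weierstrass function *)

Section Twisted.
Variables (R : realType) (tau : R[i]) (alpha lam : R).
Hypothesis htau : 0 < complex.Im tau.
Hypothesis hlam : 0 <= lam < 1.
Local Notation Theta := (Theta tau).
Local Notation dTheta := (dTheta tau).
Local Notation period := (period tau).
Local Notation width := (width tau).
Local Notation q := (q tau).
Local Notation K := (prime_form tau).

(** Chosen so that exp s is [theta^-1] times q^lam, which turns the twisted denominators into those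
    of [kd]. *)
Definition tshift : R[i] := twopii R * (alpha%:C + lam%:C * tau).
Local Notation s := tshift.
Local Notation theta := (expc (- (twopii R * alpha%:C))).
Local Notation phi := (expc (twopii R * lam%:C)).

Lemma periodE : period = twopii R * tau. Proof. by []. Qed.

Lemma widthE : width = 2 * pi * complex.Im tau. Proof. by []. Qed.

Lemma Re_tshift : complex.Re s = - (lam * width).
Proof.
rewrite /tshift widthE /twopii; case: tau => a b /=; ring.
Qed.

(** If exp s q^n = 1, moduli give [lam + n = 0], whence [n = 0] and [lam = 0] since [lam] lies in
    [0, 1); then exp s = 1 says that theta is 1 as well as phi. *)
Lemma tshift_regular : (theta, phi) <> (1, 1) -> regular tau s.
Proof.
move=> h n; apply/eqP => E; apply: h.
have w0 := width_gt0 htau.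
have R0 : complex.Re (s + n%:~R * period) = 0.
  have := congr1 (@cabs R) E; rewrite qz -expcD cabs_expc cabs1 -(expR0 R).
  exact: expR_inj.
have lw : (lam + n%:~R) * width = 0 by move: R0; rewrite ReD Re_tshift Re_Mperiod; lra.
have ln : lam + n%:~R = 0.
  by apply/eqP; move/eqP: lw; rewrite mulf_eq0 (gt_eqF w0) orbF.
have n0 : n = 0.
  have /andP[l0 l1] := hlam; have En : n%:~R = - lam by rewrite -[RHS]add0r -ln; ring.
  have h1 : (-1)%:~R < n%:~R :> R by rewrite mulrN1z En; lra.
  have h2 : n%:~R <= 0%:~R :> R by rewrite mulr0z En; lra.
  by move: h1 h2; rewrite ltr_int ler_int; lia.
have l0 : lam = 0 by move: ln; rewrite n0 addr0.
move: E; rewrite n0 expr0z mulr1 /tshift l0 mul0r addr0 => E.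
by rewrite expcN E invr1 mulr0 expc0.
Qed.

Definition twistf z : R[i] := dTheta 0 / Theta s * expc (lam%:C * z) * Theta (z + s) / Theta z.

Lemma Theta_shift_analytic c z : analytic_at (fun w => Theta (w + c)) z.
Proof.
have /analyticP[a [r [r0 sa E]]] := Theta_entire htau (z + c).
apply/analyticP; exists a, r; split=> // h hr.
by rewrite addrAC E.
Qed.

Lemma twistf_mero : Theta s != 0 -> meromorphic twistf.
Proof.
move=> Ts; apply: div_mero.
- move=> z; apply: analyticM; last exact: Theta_shift_analytic.
  by apply: analyticZ; exact: expc_analytic.
- exact: Theta_entire.
(* At a lattice point the shifted theta factor is a nonzero multiplier times [Theta s], so numerator
   and denominator have no common zero. *)
- move=> z /(Theta_zero htau) lz; have [C [d [C0 E]]] := Theta_lattice_shift htau lz.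
  rewrite [z + s]addrC E.
  have D0 := dTheta0_neq0 htau; have Ti := invr_neq0 Ts.
  by rewrite (mulf_neq0 (mulf_neq0 (mulf_neq0 D0 Ti) (expc_neq0 _))
    (mulf_neq0 (mulf_neq0 C0 (expc_neq0 _)) Ts)).
- exact: Theta_exists.
Qed.

Lemma twist_term z (m : int) : let n : R[i] := m%:~R + lam%:C in
  expc (n * z) / (1 - theta^-1 * expc (twopii R * n * tau)) =
  expc (lam%:C * z) * (expc (m%:~R * z) * kd tau s m).
Proof.
rewrite /= /kd qz mulrDl expcD -expcN opprK -!expcD.
have -> : twopii R * alpha%:C + twopii R * (m%:~R + lam%:C) * tau = s + m%:~R * period.
  by rewrite /tshift periodE; ring.
by rewrite (expcD (m%:~R * z)) -mulrA mulrCA.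
Qed.

Lemma twistf_strip z : regular tau s -> - width < complex.Re z < 0 ->
  twistf z = - zsum (fun m => let n : R[i] := m%:~R + lam%:C in
              expc (n * z) / (1 - theta^-1 * expc (twopii R * n * tau))).
Proof.
move=> hs hz.
have S := Kr_summ htau hs hz.
have Tz := Theta_neq0 htau (regular_strip htau hz).
have Ts := Theta_neq0 htau hs.
rewrite (_ : (fun m => _) = (fun m => expc (lam%:C * z) * (expc (m%:~R * z) * kd tau s m))); last first.
  by apply/funext => m; exact: twist_term.
rewrite zsum_csum; last exact: summZ.
rewrite csumZ// -/(Kr tau s z).
have Kk : Kr tau s z = - dTheta 0 * Theta (z + s) / (Theta z * Theta s).
  rewrite -(kronecker htau hs hz); field; by rewrite Tz Ts.
by rewrite Kk /twistf; field; rewrite Tz Ts.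
Qed.

Lemma twistf_is_twisted_P1 : regular tau s -> is_twisted_P1 theta phi tau twistf.
Proof.
move=> hs; split; first by apply: twistf_mero; exact: (Theta_neq0 htau hs).
exists lam; split=> // z /strip_annulus hz.
exact: twistf_strip.
Qed.

Lemma expc_twopii_inj (l1 l2 : R) : 0 <= l1 < 1 -> 0 <= l2 < 1 ->
  expc (twopii R * l1%:C) = expc (twopii R * l2%:C) -> l1 = l2.
Proof.
move=> h1 h2 E.
have : expc (twopii R * (l1 - l2)%:C) = 1.
  by rewrite rmorphB/= mulrBr expcB E mulfV// expc_neq0.
move=> /expc_eq1[m].
have t0 : twopii R != 0.
  rewrite /twopii; apply/eqP => /(congr1 (@complex.Im R)) /=.
  by apply/eqP; rewrite mulf_neq0 ?pnatr_eq0// gt_eqF// pi_gt0.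
move=> /(mulfI t0) /(congr1 (@complex.Re R)); rewrite -(rmorph_int (real_complex R)) /= => Em.
have m0 : m = 0.
  have a1 : (-1)%:~R < m%:~R :> R by rewrite mulrN1z; lra.
  have a2 : m%:~R < 1%:~R :> R by rewrite mulr1z; lra.
  by move: a1 a2; rewrite !ltr_int; lia.
by move: Em; rewrite m0; lra.
Qed.

Lemma twisted_P1E z : regular tau s -> Theta z != 0 ->
  twisted_P1 theta phi tau z = expc (lam%:C * z) * frob_kernel K s z.
Proof.
move=> hs Tz; have Ts := Theta_neq0 htau hs.
have [m1 [l [hl El n1]]] : is_twisted_P1 theta phi tau (twisted_P1 theta phi tau).
  apply: (@xgetPex _ (fun=> 0) [set f | is_twisted_P1 theta phi tau f]).
  exists twistf; exact: twistf_is_twisted_P1.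
(* The exponent [l] comes with the chosen continuation; [phi] and the range [0, 1) determine it. *)
have ll : l = lam by apply: expc_twopii_inj.
subst l.
transitivity (twistf z); last first.
  by rewrite prime_form_kernelE// /twistf; field; rewrite Tz Ts.
have PF := dnbhsc_proper (zn tau 0).
apply: (@mero_eq _ _ _ (zn tau 0) z m1 (twistf_mero Ts)); last first.
  apply: analytic_div Tz; last exact: Theta_entire.
  apply: analyticM; last exact: Theta_shift_analytic.
  by apply: analyticZ; exact: expc_analytic.
(* [zn 0] is the midpoint - width / 2 of the strip, so the open disc of radius [width / 2] around it
   stays in the strip. *)
apply: nbhs_dnbhs; apply/nbhscP; exists (width / 2).
  by have := width_gt0 htau; lra.
move=> w hw; have hz : - width < complex.Re w < 0.
  have := le_lt_trans (Re_le_cabs _) hw; rewrite ReD ReN /zn/= divr1 opprK.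
  by rewrite ltr_norml; lra.
by rewrite n1 ?twistf_strip//; apply/strip_annulus.
Qed.

Lemma trin_half (m : int) : (trin m : int)%:~R = m%:~R * (m%:~R + 1) / 2 :> R[i].
Proof.
have h : ((2 * trin m)%:Z)%:~R = (m * (m + 1))%:~R :> R[i] by rewrite trinE.
move: h; rewrite PoszM !intrM intrD => h.
transitivity (2%:Z%:~R * (trin m)%:~R / 2 : R[i]); first by field.
by rewrite h.
Qed.

Lemma theta_char_Theta (k : int) (beta : R) z : - beta = lam - k%:~R ->
  theta_char (- beta + 2^-1) (alpha + 2^-1) z tau =
  expc (period / 8 + twopii R / 4 + twopii R / 2 * lam%:C ^+ 2 * tau +
        lam%:C * (twopii R * (alpha + 2^-1)%:C)) *
  (expc (lam%:C * z) * Theta (z + s)).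
Proof.
move=> hb; set C := expc (_ + lam%:C * _).
have S := expsum_summ (theta_summable htau) (z + s).
rewrite /theta_char.
pose u (n : int) := C * (expc (lam%:C * z) * (tc tau n * expc (tnu R n * (z + s)))).
have E (n : int) : (let na : R[i] := n%:~R + (- beta + 2^-1)%:C in
    expc (twopii R / 2 * na ^+ 2 * tau + na * (z + twopii R * (alpha + 2^-1)%:C))) = u (n - k).
  rewrite /= /u /C /tc.
  have sg (m : int) : (-1) ^ m = expc (m%:~R * (twopii R / 2)) :> R[i].
    by rewrite expcMz expc_half.
  rewrite sg (exprnP q) qz -!expcD hb; congr expc.
  have T : (trin (n - k) : int)%:~R = (n - k)%:~R * ((n - k)%:~R + 1) / 2 :> R[i].
    exact: trin_half.
  have cD (a b : R) : (a + b)%:C = a%:C + b%:C by exact: rmorphD.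
  have cN (a : R) : (- a)%:C = - a%:C by exact: rmorphN.
  rewrite T /tnu /tshift periodE !cD cN intrB.
  have -> : (k%:~R : R)%:C = k%:~R by rewrite rmorph_int.
  have -> : (2^-1 : R)%:C = 2^-1 by rewrite fmorphV/= rmorph_nat.
  by field.
rewrite (_ : (fun n => _) = (fun n => u (n - k))); last by apply/funext => n; exact: E.
have su : summ u by apply: summZ; apply: summZ.
rewrite zsum_csum; last exact: summ_shift.
rewrite -csum_shift /u csumZ; last exact: summZ.
by rewrite csumZ// ThetaE.
Qed.

End Twisted.

Lemma floor_lam (R : realType) (beta : R) : exists (k : int) (lam : R),
  0 <= lam < 1 /\ - beta = lam - k%:~R.
Proof.
exists (- Num.floor (- beta)), (- beta - (Num.floor (- beta))%:~R).
have h1 := floor_le (- beta); have h2 := floorD1_gt (- beta).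
by rewrite mulrNz; move: h2; rewrite intrD; split; lra.
Qed.

Lemma expc_sum (R : realType) n (f : 'I_n -> R[i]) :
  \prod_(i < n) expc (f i) = expc (\sum_(i < n) f i).
Proof.
elim/big_rec2: _ => [|i a b _ ->]; first by rewrite expc0.
by rewrite expcD.
Qed.

(* The sign (-1) ^+ 'C(n, 2) is that of Cauchy's determinant: as all x i, y j
   tend to 0, P and K behave like 1 / z and z, and det (1 / (x i - y j)) is
   (-1) ^+ 'C(n, 2) * prod_(i < j) (x i - x j) (y i - y j) / prod_(i, j)
   (x i - y j).  It is often absorbed by writing K (y j - y i), as K is odd. *)
Theorem corollary6p8 (R : realType) (alpha beta : R) (theta phi tau : R[i])
    (n : nat) (x y : 'I_n -> R[i])
    (htheta : theta = expc (- (twopii R * alpha%:C)))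
    (hphi : phi = expc (- (twopii R * beta%:C)))
    (htau : 0 < complex.Im tau)
    (hn : (1 <= n)%N)
    (hxy : forall i j : 'I_n, ~ in_lattice tau (x i - y j)) :
  let K := prime_form tau in
  ((theta, phi) <> (1, 1) ->
    \det (\matrix_(i < n, j < n) twisted_P1 theta phi tau (x i - y j)) =
    (-1) ^+ 'C(n, 2) *
    (theta_char (- beta + 2^-1) (alpha + 2^-1) (\sum_(i < n) (x i - y i)) tau /
     theta_char (- beta + 2^-1) (alpha + 2^-1) 0 tau) *
    ((\prod_(i < n) \prod_(j < n | (i < j)%N) (K (x i - x j) * K (y i - y j))) /
     (\prod_(i < n) \prod_(j < n) K (x i - y j))))
  /\
  ((theta, phi) = (1, 1) ->
    \det (block_mx (\matrix_(i < n, j < n) P1 tau (x i - y j))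
                   (const_mx 1 : 'cV[R[i]]_n)
                   (const_mx 1 : 'rV[R[i]]_n)
                   (0 : 'M[R[i]]_1)) =
    - ((-1) ^+ 'C(n, 2) *
       (K (\sum_(i < n) (x i - y i)) *
        (\prod_(i < n) \prod_(j < n | (i < j)%N) (K (x i - x j) * K (y i - y j)))) /
       (\prod_(i < n) \prod_(j < n) K (x i - y j)))).
Proof.
move=> K.
have Txy i j : Theta tau (x i - y j) != 0.
  exact: (Theta_neq0 htau (regular_lattice (hxy i j))).
have Kxy i j : K (x i - y j) != 0 by exact: prime_form_neq0.
split=> [ne1|_].
  have [k [lam [hlam hb]]] := floor_lam beta.
  have phiE : phi = expc (twopii R * lam%:C).
    rewrite hphi -mulrN; have -> : - beta%:C = lam%:C - k%:~R.
      by rewrite -rmorphN/= hb rmorphB/= rmorph_int.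
    by rewrite mulrBr expcB expc_twopii_int divr1.
  rewrite htheta phiE in ne1 *.
  have hs := tshift_regular htau hlam ne1.
  set s := tshift tau alpha lam in hs.
  have Ts := Theta_neq0 htau hs.
  set X := \sum_(i < n) (x i - y i).
  have F := frobenius (prime_form_odd htau) (prime_form_entire htau)
    (prime_form_isolated htau) (prime_form_three_term htau) Kxy (prime_form_neq0 htau Ts).
  rewrite /frob_formula -/X in F.
  rewrite (_ : \matrix_(i, j) _ = \matrix_(i < n, j < n)
      (expc (lam%:C * x i) * expc (- (lam%:C * y j)) *
       (\matrix_(i < n, j < n) frob_kernel (prime_form tau) s (x i - y j)) i j)); last first.
    apply/matrixP => i j; rewrite !mxE twisted_P1E//.
    by rewrite mulrBr expcD.
  rewrite det_scale F !(@theta_char_Theta R tau alpha lam htau k beta _ hb) !expc_sum -expcD.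
  (* The exponentials taken out of rows and columns multiply to exp (lam X), the factor that
     [theta_char_Theta] attaches to Theta (X + s). *)
  rewrite (_ : \sum_(i < n) lam%:C * x i + _ = lam%:C * X); last first.
    by rewrite sumrN -mulr_sumr -mulr_sumr -mulrBr -sumrB.
  rewrite -/s mulr0 expc0 mul1r add0r !prime_formE// /cauchy_ratio -/K.
  set C := expc (_ + _).
  have C0 : C != 0 by exact: expc_neq0.
  have d0 := dTheta0_neq0 htau.
  move: (_ / \prod_(i < n) _) => P.
  by field; rewrite C0 d0 Ts.
have F := frobenius_degenerate (prime_form_odd htau) (prime_form_entire htau)
  (prime_form_isolated htau) (prime_form_three_term htau) (prime_form_Cder htau)
  (prime_form0 htau) (mulVf (dTheta0_neq0 htau)) Kxy.
rewrite (_ : \matrix_(i, j) P1 tau (x i - y j) = \matrix_(i < n, j < n)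
  ((dTheta tau 0)^-1 * dTheta tau (x i - y j) / K (x i - y j))); last first.
  by apply/matrixP => i j; rewrite !mxE P1_prime_form.
by rewrite F /cauchy_ratio !mulrA.
Qed.
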